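(* Let $1\le m<n$ be integers, $c_m=\frac{n-m}{m}$, and for $\alpha,\gamma\in\mathbb R$ define on $\{z\in\mathbb C^n: 0<|z|<1\}$ $$u_{\alpha,\gamma}(z)=-|z|^{-2\alpha}\bigl(-\log|z|^2\bigr)^{-\gamma}.$$ Say that $u_{\alpha,\gamma}$ is admissible if there is $\varepsilon\in(0,1)$ such that $u_{\alpha,\gamma}$ is $m$-subharmonic on the punctured ball $\{0<|z|<\varepsilon\}$. Then: (i) If $\alpha>0$, then $u_{\alpha,\gamma}$ is admissible if and only if either $\alpha<c_m$, or $\alpha=c_m$ and $\gamma\ge0$. (ii) If $\alpha=0$, then $u_{\alpha,\gamma}$ is admissible if and only if $\gamma\le0$. (iii) If $\alpha<0$, then $u_{\alpha,\gamma}$ is not admissible. Moreover, every admissible $u_{\alpha,\gamma}$ with a singularity at zero (i.e. unbounded near $0$) extends across zero: for some $\varepsilon>0$ it extends to an $m$-subharmonic function on the ball $\{|z|<\varepsilon\}$.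
   Context: Let $\beta=dd^c|z|^2$ on $\mathbb C^n$. A real constant-coefficient $(1,1)$-form $\alpha$ is $m$-positive if $\alpha^k\wedge\beta^{n-k}\ge0$ for $1\le k\le m$. For an open set $\Omega\subset\mathbb C^n$, a locally integrable, upper semicontinuous function $u:\Omega\to[-\infty,\infty)$ is $m$-subharmonic, written $u\in \mathrm{SH}_m(\Omega)$, if it is subharmonic and $dd^c u\wedge\alpha_1\wedge\cdots\wedge\alpha_{m-1}\wedge\beta^{n-m}\ge0$ (as a current) for all constant-coefficient $m$-positive $(1,1)$-forms $\alpha_j$. For $u\in C^2$ this is equivalent to nonnegativity of the first $m$ elementary symmetric functions $\sigma_1,\dots,\sigma_m$ of the eigenvalues of the complex Hessian $(u_{j\bar k})$. *)

(* Defs.v *)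
From HB Require Import structures.
From mathcomp Require Import all_boot all_order all_algebra.
From mathcomp Require Import perm sesquilinear complex.
From mathcomp Require Import all_classical all_reals all_analysis.

Set Implicit Arguments.
Unset Strict Implicit.
Unset Printing Implicit Defensive.

Import Order.TTheory GRing.Theory Num.Theory.
Import numFieldNormedType.Exports.

Local Open Scope classical_set_scope.
Local Open Scope ring_scope.
Local Open Scope complex_scope.

Definition cons_pair (R : realType) (n : nat)
  (p : measurableTypeR R * n.-tuple (measurableTypeR R)) :
  n.+1.-tuple (measurableTypeR R) := [tuple of p.1 :: p.2].

Lemma measurable_cons_pair (R : realType) (n : nat) :
  measurable_fun [set: measurableTypeR R * n.-tuple (measurableTypeR R)]
    (@cons_pair R n).
Proof. exact: measurable_cons. Qed.

Definition uncons (R : realType) (n : nat)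
  (t : n.+1.-tuple (measurableTypeR R)) :
  measurableTypeR R * n.-tuple (measurableTypeR R) :=
  (thead t, [tuple of behead t]).

Lemma cons_pairK (R : realType) (n : nat) :
  cancel (@cons_pair R n) (@uncons R n).
Proof. by move=> [x t]; congr pair => //; apply/val_inj. Qed.

Lemma measurable_uncons (R : realType) (n : nat) :
  measurable_fun [set: n.+1.-tuple (measurableTypeR R)] (@uncons R n).
Proof.
apply/measurable_fun_pairP; split; first exact: measurable_tnth.
exact: measurable_behead.
Qed.

(* Lebesgue measure on R^n.+1 is the image of the product of lebesgue_measure
   with Lebesgue measure on R^n under (x, t) |-> x :: t; that this gives the
   expected measure on boxes is lebesgue_tuple_box. *)
Definition lebesgue_step (R : realType) (n : nat)
    (mu : {sigma_finite_measure set (n.-tuple (measurableTypeR R)) -> \bar R}) :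
    set (n.+1.-tuple (measurableTypeR R)) -> \bar R :=
  pushforward (lebesgue_measure \x mu)%E (@cons_pair R n).

Section lebesgue_step.
Context (R : realType) (n : nat).
Context (mu : {sigma_finite_measure set (n.-tuple (measurableTypeR R)) -> \bar R}).

Let image : {measure set (n.+1.-tuple (measurableTypeR R)) -> \bar R} :=
  measure_function_pushforward__canonical__measure_function_Measure
    (lebesgue_measure \x mu)%E (@measurable_cons_pair R n).

Let lebesgue_step0 : lebesgue_step mu set0 = 0%E.
Proof. exact: (measure0 image). Qed.

Let lebesgue_step_ge0 A : (0 <= lebesgue_step mu A)%E.
Proof. exact: (measure_ge0 image). Qed.

Let lebesgue_step_sigma_additive : semi_sigma_additive (lebesgue_step mu).
Proof. exact: (@measure_semi_sigma_additive _ _ _ image). Qed.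

HB.instance Definition _ := isMeasure.Build _ _ _ (lebesgue_step mu)
  lebesgue_step0 lebesgue_step_ge0 lebesgue_step_sigma_additive.

Let lebesgue_step_sigma_finite : sigma_finite setT (lebesgue_step mu).
Proof.
have /sigma_finiteP[F [TF ndF Foo]] := sigma_finiteT (@lebesgue_measure R).
have /sigma_finiteP[G [TG ndG Goo]] := sigma_finiteT mu.
exists (fun k => @uncons R n @^-1` (F k `*` G k)).
  rewrite -preimage_bigcup -[LHS](preimage_setT (@uncons R n)); congr (_ @^-1` _).
  rewrite -setXTT TF TG predeqE => -[x y]; split; last first.
    by move=> [k _ []/= ? ?]; split; exists k.
  move=> [/= [i _ Fix] [k _ Gky]]; exists (maxn i k) => //; split.
    by move: x Fix; exact/subsetPset/ndF/leq_maxl.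
  by move: y Gky; exact/subsetPset/ndG/leq_maxr.
move=> k; have [mF Fk] := Foo k; have [mG Gk] := Goo k; split.
  rewrite -[X in measurable X]setTI.
  by apply: measurable_uncons => //; exact: measurableX.
rewrite /lebesgue_step /pushforward -comp_preimage.
rewrite (_ : _ \o _ = id); last by apply/funext => x; exact: cons_pairK.
by rewrite preimage_id product_measure1E// lte_mul_pinfty// ge0_fin_numE.
Qed.

HB.instance Definition _ := Measure_isSigmaFinite.Build _ _ _
  (lebesgue_step mu) lebesgue_step_sigma_finite.

End lebesgue_step.

Fixpoint lebesgue_tuple (R : realType) (n : nat) :
    {sigma_finite_measure set (n.-tuple (measurableTypeR R)) -> \bar R} :=
  match n with
  | 0 => \d_([tuple] : 0.-tuple (measurableTypeR R))
  | n'.+1 => lebesgue_step (lebesgue_tuple R n')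
  end.

Lemma lebesgue_tuple_box (R : realType) (n : nat)
    (A : 'I_n -> set (measurableTypeR R)) :
  (forall i, measurable (A i)) ->
  lebesgue_tuple R n [set t | forall i, A i (tnth t i)] =
  (\prod_(i < n) lebesgue_measure (A i))%E.
Proof.
elim: n A => [|n IH] A mA /=.
  rewrite big_ord0 diracE mem_set// => -[] //.
rewrite /lebesgue_step /pushforward.
have -> : @cons_pair R n @^-1` [set t | forall i, A i (tnth t i)] =
    A ord0 `*` [set t | forall i, A (lift ord0 i) (tnth t i)].
  apply/seteqP; split => -[x t] /=.
    move=> h; split; first exact: (h ord0).
    by move=> i; have := h (lift ord0 i); rewrite tnthS.
  move=> [h0 h] i; case: (unliftP ord0 i) => [j|] ->; last exact: h0.
  by rewrite tnthS; exact: h.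
have mB : measurable [set t : n.-tuple (measurableTypeR R) |
    forall i, A (lift ord0 i) (tnth t i)].
  have -> : [set t : n.-tuple (measurableTypeR R) |
      forall i, A (lift ord0 i) (tnth t i)] =
      \bigcap_(i in [set: 'I_n]) ((fun t => tnth t i) @^-1` A (lift ord0 i)).
    by apply/seteqP; split=> t h i; [move=> _; exact: h|exact: (h i I)].
  apply: fin_bigcap_measurable => // i _.
  by rewrite -[X in measurable X]setTI; exact: measurable_tnth.
rewrite product_measure1E// big_ord_recl; congr *%E.
by apply: (IH (fun i => A (lift ord0 i))).
Qed.

Definition row_of_tuple (R : realType) (N : nat)
  (t : N.-tuple (measurableTypeR R)) : 'rV[R]_N := \row_i tnth t i.

Definition lintegral (R : realType) (N : nat) (D : set 'rV[R]_N)
    (f : 'rV[R]_N -> \bar R) : \bar R :=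
  (\int[lebesgue_tuple R N]_(t in @row_of_tuple R N @^-1` D) f (row_of_tuple t))%E.

Definition lintegrable (R : realType) (N : nat) (D : set 'rV[R]_N)
    (f : 'rV[R]_N -> \bar R) : Prop :=
  (lebesgue_tuple R N).-integrable (@row_of_tuple R N @^-1` D)
    (f \o @row_of_tuple R N).

Definition locally_lintegrable (R : realType) (N : nat) (D : set 'rV[R]_N)
    (f : 'rV[R]_N -> \bar R) : Prop :=
  forall K : set 'rV[R]_N, compact K -> K `<=` D -> lintegrable K f.

(* The library norm on 'rV[R]_N is the sup norm. *)
Definition enorm (R : realType) (N : nat) (x : 'rV[R]_N) : R :=
  Num.sqrt (\sum_(i < N) x 0 i ^+ 2).

Definition partials (R : realType) (N : nat) (s : seq 'I_N)
    (f : 'rV[R]_N -> R) : 'rV[R]_N -> R :=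
  foldr (fun i g x => 'D_(delta_mx 0 i) g x) f s.

(* Only meaningful for D open, as are the predicates on a domain D below:
   partials s f x depends only on the germ of f at x. *)
Definition class_C (R : realType) (N k : nat) (D : set 'rV[R]_N)
    (f : 'rV[R]_N -> R) : Prop :=
  forall (s : seq 'I_N) (x : 'rV[R]_N), D x ->
    ((size s <= k)%N -> {for x, continuous (partials s f)}) /\
    ((size s < k)%N -> forall i, derivable (partials s f) x (delta_mx 0 i)).

Definition harmonic_on (R : realType) (N : nat) (D : set 'rV[R]_N)
    (h : 'rV[R]_N -> R) : Prop :=
  class_C 2 D h /\ forall x, D x -> \sum_(i < N) partials [:: i; i] h x = 0.

Definition usc_on (R : realType) (N : nat) (D : set 'rV[R]_N)
    (u : 'rV[R]_N -> \bar R) : Prop :=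
  forall x (c : R), D x -> (u x < c%:E)%E ->
    \forall y \near x, D y -> (u y < c%:E)%E.

(* Subharmonicity by comparison with harmonic majorants: for every compact K in
   D and every h continuous on K and harmonic in its interior, u <= h on the
   boundary of K implies u <= h on K. *)
Definition subharmonic (R : realType) (N : nat) (D : set 'rV[R]_N)
    (u : 'rV[R]_N -> \bar R) : Prop :=
  usc_on D u /\
  forall (K : set 'rV[R]_N) (h : 'rV[R]_N -> R),
    compact K -> K `<=` D ->
    {within K, continuous h} -> harmonic_on K° h ->
    (forall x, K x -> ~ K° x -> (u x <= (h x)%:E)%E) ->
    forall x, K x -> (u x <= (h x)%:E)%E.

Definition test_function (R : realType) (N : nat) (D : set 'rV[R]_N)
    (phi : 'rV[R]_N -> R) : Prop :=
  [/\ forall k, class_C k setT phi,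
      compact (closure [set x | phi x != 0]),
      closure [set x | phi x != 0] `<=` D &
      forall x, 0 <= phi x].

(* C^n is 'rV[R]_(n + n), the point with coordinates z_j = x_j + i y_j being
   (x_1, .., x_n, y_1, .., y_n). *)
Definition re_idx (n : nat) (j : 'I_n) : 'I_(n + n) := lshift n j.
Definition im_idx (n : nat) (j : 'I_n) : 'I_(n + n) := rshift n j.

(* The form i \sum_(j,k) a_jk dz_j /\ dz_k^bar is represented by the matrix
   (a_jk); it is real exactly when the matrix is Hermitian. *)

(* Entry (j, k) is f_(j k^bar) = (d/dz_j) (d/dz_k^bar) f, where
   d/dz = (d/dx - i d/dy) / 2 and d/dz^bar = (d/dx + i d/dy) / 2. *)
Definition complex_hessian (R : realType) (n : nat)
    (f : 'rV[R]_(n + n) -> R) (z : 'rV[R]_(n + n)) : 'M[R[i]]_n :=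
  \matrix_(j, k)
    ((partials [:: re_idx j; re_idx k] f z
      + partials [:: im_idx j; im_idx k] f z) / 4 +i*
     ((partials [:: re_idx j; im_idx k] f z
      - partials [:: im_idx j; re_idx k] f z) / 4)).

(* dd^c = 2 i d d^bar, that is d^c = i (d^bar - d). *)
Definition ddc (R : realType) (n : nat) (f : 'rV[R]_(n + n) -> R)
    (z : 'rV[R]_(n + n)) : 'M[R[i]]_n := 2 *: complex_hessian f z.

Global Instance is_derive_coord (R : realType) (N : nat) (i : 'I_N) (x v : 'rV[R]_N) :
  is_derive x v (fun y : 'rV[R]_N => y 0 i) (v 0 i).
Proof.
apply: DeriveDef; first exact/diff_derivable/differentiable_coord.
rewrite deriveE; last exact: differentiable_coord.
have @f : {linear 'rV[R]_N -> R}.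
  by exists (fun y : 'rV[R]_N => y 0 i); do 2![eexists]; do ?[constructor];
    rewrite ?mxE// => ? *; rewrite ?mxE//; move=> ?; rewrite !mxE.
rewrite (_ : (fun _ => _) = f) // diff_lin//; exact: coord_continuous.
Qed.

Lemma partials2_sqr_enorm (R : realType) (N : nat) (i j : 'I_N)
    (x : 'rV[R]_N) :
  partials [:: i; j] (fun y => enorm y ^+ 2) x = 2 *+ (i == j).
Proof.
rewrite (_ : (fun y => _) =
    \sum_(k < N) ((fun y : 'rV[R]_N => y 0 k) ^+ 2)); last first.
  apply/funext => y; rewrite fct_sumE /enorm sqr_sqrtr//.
  by apply: sumr_ge0 => k _; exact: sqr_ge0.
rewrite /partials /=.
have -> : (fun y => 'D_(delta_mx 0 j)
      (\sum_(k < N) ((fun y : 'rV[R]_N => y 0 k) ^+ 2)) y) =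
    (2 : R) \*: (fun y : 'rV[R]_N => y 0 j).
  apply/funext => y; rewrite derive_val (bigD1 j)//= big1 ?addr0.
    by rewrite !mxE !eqxx expr1 /GRing.scale/= mulr1.
  by move=> k kj; rewrite mxE (negbTE kj) andbF scaler0.
by rewrite derive_val mxE eqxx/= eq_sym; case: eqP; rewrite /GRing.scale/= ?mulr1 ?mulr0.
Qed.

Definition beta (R : realType) (n : nat) : 'M[R[i]]_n :=
  ddc (fun z => enorm z ^+ 2) 0.

Lemma betaE (R : realType) (n : nat) : beta R n = 2%:M.
Proof.
apply/matrixP => j k; rewrite !mxE !partials2_sqr_enorm.
rewrite !(inj_eq (@lshift_inj _ _), inj_eq (@rshift_inj _ _)).
rewrite eq_lrshift eq_rlshift subrr mul0r.
case: eqP => _ /=; last by rewrite addr0 mul0r mulr0.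
by rewrite -natrD divff ?pnatr_eq0// mulr1.
Qed.

(* The wedge product of the n (1,1)-forms in s, as a multiple of the positive
   volume form (i dz_1 /\ dz_1^bar) /\ .. /\ (i dz_n /\ dz_n^bar): expanding
   the product, the l-th factor contributes
   a^l_(p l)(q l) (i dz_(p l) /\ dz_(q l)^bar), only permutations p and q
   survive, and reordering the 1-forms produces their signs. The list s is to
   have length n; see also wedge_nseq. *)
Definition wedge (R : realType) (n : nat) (s : seq 'M[R[i]]_n) : R[i] :=
  \sum_(p : 'S_n) \sum_(q : 'S_n)
    (-1) ^+ p * (-1) ^+ q * \prod_(l < n) (nth 0 s l) (p l) (q l).

Lemma wedge_nseq (R : realType) (n : nat) (A : 'M[R[i]]_n) :
  wedge (nseq n A) = n`!%:R * \det A.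
Proof.
rewrite /wedge -(card_Sn n) -sum1_card natr_sum mulr_suml.
apply: eq_bigr => p _; rewrite mul1r /determinant.
rewrite (reindex_inj (mulgI p)) /=; apply: eq_bigr => q _.
rewrite odd_permM signr_addb mulrA -expr2 sqrr_sign mul1r; congr *%R.
under eq_bigr do rewrite nth_nseq ltn_ord permM.
by rewrite [RHS](reindex_inj (@perm_inj _ p)).
Qed.

Definition m_positive (R : realType) (n m : nat) (A : 'M[R[i]]_n) : Prop :=
  A \is hermsymmx /\
  forall k, (1 <= k <= m)%N ->
    0 <= wedge (nseq k A ++ nseq (n - k) (beta R n)).

(* The last condition is the positivity of the (n,n)-current
   dd^c u /\ alpha_1 /\ .. /\ alpha_(m-1) /\ beta^(n-m), tested against
   phi >= 0; the other factors being constant, dd^c is moved to phi. The wedge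
   product of real forms is real, and Re only changes its type. *)
Definition m_subharmonic (R : realType) (n m : nat) (D : set 'rV[R]_(n + n))
    (u : 'rV[R]_(n + n) -> \bar R) : Prop :=
  [/\ forall z, D z -> (u z < +oo)%E,
      locally_lintegrable D u,
      subharmonic D u &
      forall alpha : seq 'M[R[i]]_n, size alpha = m.-1 ->
        (forall A, A \in alpha -> m_positive m A) ->
        forall phi, test_function D phi ->
          (0 <= lintegral D (fun z => u z *
             (complex.Re (wedge (ddc phi z :: alpha
                                 ++ nseq (n - m) (beta R n))))%:E))%E].

Definition punctured_ball (R : realType) (N : nat) (r : R) : set 'rV[R]_N :=
  [set z | 0 < enorm z < r].

Definition eball (R : realType) (N : nat) (r : R) : set 'rV[R]_N :=
  [set z | enorm z < r].

Definition u_log (R : realType) (n : nat) (a g : R) (z : 'rV[R]_(n + n)) : R :=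
  - (enorm z `^ (- (2 * a)) * (- ln (enorm z ^+ 2)) `^ (- g)).

(* u_log is only used on 0 < |z| < 1, where - ln (|z|^2) > 0. *)
Definition admissible (R : realType) (n m : nat) (a g : R) : Prop :=
  exists2 e : R, 0 < e < 1 &
    m_subharmonic m (@punctured_ball R (n + n) e)
      (fun z => (u_log a g z)%:E).

Definition singular_at_0 (R : realType) (n : nat) (a g : R) : Prop :=
  forall M r : R, 0 < r < 1 ->
    exists2 z : 'rV[R]_(n + n), punctured_ball r z & M < `|u_log a g z|.

(* Main.v *)
(** With [s = |z|^2] and [u = F s], the complex Hessian of
    [u] is [F' s I + F'' s P], where [P] is the rank one matrix of [z]. A mixed
    discriminant with two entries [P] vanishes, so [dd^c u] is m-positive
    exactly when [F' >= 0] and [n F' + m s F'' >= 0]; for [u_log] the second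
    quantity has the sign of an explicit expression in [1 / (- ln s)].

    Sufficiency: Garding's inequality for the m-th symmetric function of a
    Hermitian matrix makes [dd^c u /\ alpha_1 /\ .. /\ beta^(n-m)] pointwise
    nonnegative. To cross the origin, [F (|z|^2 + delta)] is smooth and still
    m-positive on a ball, and decreases to [u] under the integrable bound [|u|],
    so that weak positivity passes to the limit by dominated convergence.
    Subharmonicity is the maximum principle applied to
    [u - h + epsilon |z|^2], whose maximum is not attained where [u = -oo].

    Necessity: where [n F' + m s F'' < 0], the m-positive form
    [beta/2 - (n / m) P / |z|^2], repeated [m - 1] times, makes the wedge
    product negative near [z], and a bump function detects it. *)

Require Import Defs.
From mathcomp Require Import all_boot all_order all_algebra.
From mathcomp Require Import perm sesquilinear complex finmap ring lra.
From mathcomp Require Import all_classical all_reals all_analysis.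
From mathcomp Require Import measurable_realfun.

Set Implicit Arguments.
Unset Strict Implicit.
Unset Printing Implicit Defensive.

Import Order.TTheory GRing.Theory Num.Theory.
Import numFieldNormedType.Exports.

Local Open Scope classical_set_scope.
Local Open Scope ring_scope.

(** * Roots of families of complex polynomials *)

Section complex_roots.
Local Open Scope complex_scope.
Variable R : realType.
Local Notation C := R[i].
Local Notation Im := complex.Im.
Local Notation Re := complex.Re.

(** Fixing arguments of a mixed discriminant leaves a form that is no longer a determinant.
    Garding's inequality is therefore proved for abstract symmetric multilinear forms, where an
    induction can fix one argument at a time. Fixing a cone vector [a] is, up to a factor,
    differentiation in the direction [a]; a Gauss-Lucas argument shows that it preserves
    hyperbolicity and the cone, once zeros are excluded from half-planes by a homotopy whose roots
    never meet the real axis.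

    With [L = - ln s], [y = 1 / L] and [w = a - g y], the derivative in [L] of the logarithm of
    [- F], the quantity [n F' + m s F''] is a positive multiple of [(c - w) w - g y ^ 2], where
    [c = (n - m) / m]. This is the origin of the threshold. For [a = c] and [a = 0] the limit at
    [y = 0] vanishes, and the sign of [g] decides.

    Since [c <= n - 1], the poles to be extended are at most of order [|z| ^ (2 - 2 n)] up to
    logarithms, and the spare power of [|z|] below the integrable order [2 n - 1] absorbs the
    logarithms. The only admissible function that does not tend to [-oo] is the constant given by
    [a = g = 0], treated apart. *)

Lemma normc_ge_Im (z : C) : `|Im z|%:C <= `|z|.
Proof.
have := normc_ge_Re (z * 'i); rewrite ReiNIm normrN normrM.
suff -> : `|'i : C| = 1 by rewrite mulr1.
by rewrite normc_def /= expr0n expr1n add0r sqrtr1.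
Qed.

(** Each factor [|w - s|] is at least [- Im s] and at least [|w| - |s|], hence at least a multiple
    of [1 + |w|]. The bound is uniform over the unbounded half-plane, so it can absorb a
    perturbation of degree [size rs] without any compactness in [w]. *)
Lemma prod_roots_lower_bound (rs : seq C) : (forall s, s \in rs -> Im s < 0) ->
  exists2 d : C, 0 < d & forall w, 0 <= Im w ->
    d * (1 + `|w|) ^+ size rs <= `|\prod_(s <- rs) (w - s)|.
Proof.
elim: rs => [_|s rs IH h].
  by exists 1 => // w _; rewrite big_nil normr1 expr0 mulr1.
have [|d d0 hd] := IH; first by move=> t ht; apply: h; rewrite inE ht orbT.
have s0 : Im s < 0 by apply: h; rewrite inE eqxx.
pose D : C := (- Im s)%:C.
have D0 : 0 < D by rewrite /D ltcR oppr_gt0.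
pose K : C := (1 + `|s|) / D + 1.
have K0 : 0 < K.
  by rewrite ltr_wpDl// divr_ge0// ?addr_ge0// ltW.
exists (K^-1 * d); first by rewrite mulr_gt0// invr_gt0.
move=> w hw; rewrite big_cons normrM exprS mulrACA.
apply: ler_pM.
- by rewrite mulr_ge0 ?invr_ge0 ?(ltW K0) ?addr_ge0.
- by rewrite mulr_ge0 ?(ltW d0)// exprn_ge0// addr_ge0.
- rewrite ler_pdivrMl//.
  have hD : D <= `|w - s|.
    apply: le_trans (normc_ge_Im _).
    rewrite /D lecR raddfB/=; apply: le_trans (ler_norm _).
    by rewrite lerDr.
  have -> : K * `|w - s| = (1 + `|s|) * (`|w - s| / D) + `|w - s|.
    by rewrite /K mulrDl mul1r mulrAC mulrA.
  have h1 : 1 + `|s| <= (1 + `|s|) * (`|w - s| / D).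
    rewrite -[X in X <= _]mulr1; apply: ler_wpM2l; first by rewrite addr_ge0.
    by rewrite ler_pdivlMr// mul1r.
  apply: le_trans (lerD h1 (lexx _)).
  rewrite -addrA lerD2l.
  by rewrite -[X in `|X| <= _](subrK s) addrC ler_normD.
- by apply: hd => //.
Qed.

(** Boundedness accompanies the Lipschitz estimate because the difference for [p * X + c] involves a
    value of [p] itself. *)
Lemma poly_lipschitz01 (p : {poly C}) : exists2 K : C, 0 <= K &
  forall r r' : R, 0 <= r <= 1 -> 0 <= r' <= 1 ->
    `|p.[r%:C]| <= K /\ `|p.[r%:C] - p.[r'%:C]| <= K * `|r - r'|%:C.
Proof.
elim/poly_ind: p => [|p c [K K0 IH]].
  by exists 0 => // r r' _ _; rewrite !horner0 subrr !normr0 mul0r.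
exists (K + K + `|c|); first by rewrite !addr_ge0.
move=> r r' hr hr'; rewrite !hornerMXaddC.
have [h1 h2] := IH _ _ hr hr'; have [h3 _] := IH _ _ hr' hr.
have hn (x : R) : 0 <= x <= 1 -> `|x%:C : C| <= 1.
  by move=> /andP[x0 x1]; rewrite ger0_norm ?ler0c// lecR.
split.
  apply: le_trans (ler_normD _ _) _; rewrite lerD2r normrM.
  apply: le_trans (ler_wpM2l _ (hn _ hr)) _ => //.
  by rewrite mulr1; apply: le_trans h1 _; rewrite lerDl.
have -> : p.[r%:C] * r%:C + c - (p.[r'%:C] * r'%:C + c) =
  (p.[r%:C] - p.[r'%:C]) * r%:C + p.[r'%:C] * (r - r')%:C.
  by rewrite rmorphB/=; ring.
have nrr : `|(r - r')%:C : C| = `|r - r'|%:C.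
  by rewrite normc_def/= expr0n addr0 sqrtr_sqr.
apply: le_trans (ler_normD _ _) _; rewrite !normrM nrr -addrA mulrDl.
apply: lerD.
  by apply: le_trans (ler_wpM2l _ (hn _ hr)) _ => //; rewrite mulr1.
apply: ler_wpM2r; first by rewrite ler0c.
by apply: le_trans h3 _; rewrite lerDl.
Qed.

(** The growth [(1 + |w|) ^ m] is the one of [prod_roots_lower_bound], so that the two estimates can
    be compared. *)
Lemma poly_family_lipschitz (m : nat) (c : nat -> {poly C}) :
  exists2 K : C, 0 <= K & forall (r r' : R) (w : C),
    0 <= r <= 1 -> 0 <= r' <= 1 ->
    `|\sum_(l < m.+1) (c l).[r%:C] * w ^+ l
      - \sum_(l < m.+1) (c l).[r'%:C] * w ^+ l| <=
    K * `|r - r'|%:C * (1 + `|w|) ^+ m.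
Proof.
have /choice[K hK] : forall l, exists K : C, 0 <= K /\
  forall r r' : R, 0 <= r <= 1 -> 0 <= r' <= 1 ->
     `|(c l).[r%:C] - (c l).[r'%:C]| <= K * `|r - r'|%:C.
  move=> l; have [K K0 h] := poly_lipschitz01 (c l).
  by exists K; split=> // r r' hr hr'; case: (h r r' hr hr').
exists (\sum_(l < m.+1) K l); first by apply: sumr_ge0 => l _; case: (hK l).
move=> r r' w hr hr'; rewrite -sumrB !mulr_suml.
apply: le_trans (ler_norm_sum _ _ _) _; apply: ler_sum => l _.
rewrite -mulrBl normrM; apply: ler_pM => //.
  by case: (hK l) => _; exact.
rewrite normrX; apply: (@le_trans _ _ ((1 + `|w|) ^+ l)).
  by apply: lerXn2r; rewrite ?nnegrE ?addr_ge0// lerDr.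
by apply: ler_weXn2l; [rewrite lerDl|rewrite -ltnS ltn_ord].
Qed.

(* The roots depend continuously on [r] and cannot cross the real line. *)
Lemma root_homotopy (m : nat) (c : nat -> {poly C}) (L : C) :
  let q (r : R) (w : C) := \sum_(l < m.+1) (c l).[r%:C] * w ^+ l in
  L != 0 -> (forall r : R, (c m).[r%:C] = L) ->
  (forall (r : R) (w : C), 0 <= r <= 1 -> Im w = 0 -> q r w != 0) ->
  (forall w, 0 <= Im w -> q 0 w != 0) ->
  forall w, 0 <= Im w -> q 1 w != 0.
Proof.
move=> q L0 cL qreal q0.
pose S r := forall w, 0 <= Im w -> q r w != 0.
have [K K0 hK] := poly_family_lipschitz m c.
(* The constant leading coefficient [L] keeps the number of roots equal to [m]: no root escapes to
   infinity. *)
have fact (r : R) : exists2 rs : seq C, size rs = m &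
    forall w, q r w = L * \prod_(s <- rs) (w - s).
  pose p := \poly_(l < m.+1) (c l).[r%:C].
  have sp : size p = m.+1 by rewrite size_poly_eq// cL.
  have lp : lead_coef p = L by rewrite lead_coefE sp/= coef_poly ltnSn cL.
  have [rs hp] := closed_field_poly_normal p.
  exists rs.
    have := congr1 (fun x : {poly C} => size x) hp.
    rewrite size_scale ?lp// size_prod_XsubC sp => -[] //.
  move=> w; transitivity (p.[w]); first by rewrite horner_poly.
  by rewrite hp hornerZ horner_prod lp; under eq_bigr do rewrite hornerXsubC.
have near_real (d : C) (e : C) : 0 < d -> 0 <= e ->
    exists2 del : R, 0 < del & forall x : R, x < del -> e * x%:C < d.
  move=> d0 e0; have e1 : 0 < e + 1 by rewrite ltr_wpDl.
  have dr : (Re (d / (e + 1)))%:C = d / (e + 1).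
    by apply: RRe_real; rewrite gtr0_real// divr_gt0.
  exists (Re (d / (e + 1))); first by rewrite -ltcR dr divr_gt0.
  move=> x; rewrite -ltcR dr ltr_pdivlMr// => hx.
  have [x0|x0] := leP 0 x.
    by apply: le_lt_trans hx; rewrite mulrC ler_wpM2l ?ler0c// lerDl.
  by apply: le_lt_trans d0; rewrite mulr_ge0_le0// lecR ltW.
(* Openness: all roots at [r] lie strictly below the real axis, so [|q r w|] dominates the change to
   [r'] for all [w] at once. *)
have Sopen r : 0 <= r <= 1 -> S r -> exists2 del : R, 0 < del &
    forall r', 0 <= r' <= 1 -> `|r - r'| < del -> S r'.
  move=> hr Sr; have [rs srs hrs] := fact r.
  have [s|d d0 hd] := @prod_roots_lower_bound rs.
    move=> srs'; rewrite ltNge; apply/negP => /Sr /negP; apply.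
    by rewrite hrs (big_rem s)//= subrr mul0r mulr0.
  have Ld0 : 0 < `|L| * d by rewrite mulr_gt0// normr_gt0.
  have [del del0 hdel] := near_real _ _ Ld0 K0.
  exists del => // r' hr' rr' w hw; apply/eqP => qw0.
  have h : `|L| * `|\prod_(s <- rs) (w - s)| <= K * `|r - r'|%:C * (1 + `|w|) ^+ m.
    by have := hK r r' w hr hr'; rewrite -/(q r w) -/(q r' w) qw0 subr0 hrs normrM.
  suff : K * `|r - r'|%:C * (1 + `|w|) ^+ m < K * `|r - r'|%:C * (1 + `|w|) ^+ m.
    by rewrite ltxx.
  apply: lt_le_trans h; apply: lt_le_trans (ler_wpM2l (normr_ge0 L) (hd _ hw)).
  rewrite mulrA srs ltr_pM2r; first exact: hdel.
  by rewrite exprn_gt0// ltr_wpDr.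
(* Closedness: a zero at [r] would have [Im w > 0]. At a nearby good parameter every root is below
   the axis, so each factor is at least [Im w], and [(Im w) ^ m] beats the perturbation. *)
have Sclosed r : 0 <= r <= 1 ->
    (forall del, 0 < del -> exists r', [/\ 0 <= r' <= 1, `|r' - r| < del & S r']) ->
    S r.
  move=> hr hS w hw; apply/eqP => qw0.
  have [w0|w0] := eqVneq (Im w) 0; first by have /negP := qreal r w hr w0; rewrite qw0 eqxx.
  have w1 : 0 < Im w by rewrite lt_neqAle eq_sym w0 hw.
  have d0 : 0 < `|L| * (Im w)%:C ^+ m by rewrite mulr_gt0 ?normr_gt0// exprn_gt0// ltcR.
  have e0 : 0 <= K * (1 + `|w|) ^+ m by rewrite mulr_ge0// exprn_ge0// addr_ge0.
  have [del del0 hdel] := near_real _ _ d0 e0.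
  have [r' [hr' rr' Sr']] := hS _ del0.
  have := hK r' r w hr' hr; rewrite -/(q r w) -/(q r' w) qw0 subr0.
  have [rs srs hrs] := fact r'; rewrite hrs normrM => h.
  suff : `|L| * `|\prod_(s <- rs) (w - s)| < `|L| * `|\prod_(s <- rs) (w - s)|.
    by rewrite ltxx.
  apply: le_lt_trans h _; rewrite mulrAC; apply: lt_le_trans (hdel _ rr') _.
  rewrite ler_wpM2l// -srs.
  have : forall s, s \in rs -> Im s < 0.
    move=> s srs'; rewrite ltNge; apply/negP => /Sr' /negP; apply.
    by rewrite hrs (big_rem s)//= subrr mul0r mulr0.
  elim: rs {srs hrs} => [_|s rs IH hs]; first by rewrite big_nil normr1 expr0.
  rewrite big_cons normrM exprS; apply: ler_pM; rewrite ?exprn_ge0 ?ler0c//.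
    apply: le_trans (normc_ge_Im _); rewrite lecR raddfB/=.
    apply: le_trans (ler_norm _); rewrite lerDl oppr_ge0 ltW// hs// inE eqxx//.
  by apply: IH => t ht; apply: hs; rewrite inE ht orbT.
suff : S 1 by [].
apply: contrapT => nS1.
(* Connectedness of the interval, through the supremum of the initial segments on which [S]
   holds. *)
pose A := [set r : R | 0 <= r <= 1 /\ forall r', 0 <= r' <= r -> S r'].
have A0 : A 0.
  split; first by rewrite lexx ler01.
  by move=> r'; rewrite -eq_le => /eqP <-; exact: q0.
have supA : has_sup A.
  by split; [exists 0|exists 1 => r -[/andP[]]].
pose t := sup A.
have t01 : 0 <= t <= 1.
  apply/andP; split; first by apply: (ub_le_sup supA.2).
  by apply: (ge_sup supA.1) => r -[/andP[]].
have hlt r : 0 <= r < t -> S r.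
  move=> /andP[r0 rt]; have [a [_ ha] ra] := sup_gt supA.1 rt.
  by apply: ha; rewrite r0 ltW.
have St : S t.
  have [t0|t0] := eqVneq t 0; first by rewrite t0.
  have tp : 0 < t by rewrite lt_neqAle eq_sym t0; case/andP: t01.
  apply: Sclosed => // del del0; pose r := Num.max 0 (t - del / 2).
  have rt : r < t by rewrite /r gt_max tp/= ltrBlDr ltrDl divr_gt0.
  have r0 : 0 <= r by rewrite /r le_max lexx.
  exists r; split; first by rewrite r0 (le_trans (ltW rt))//; case/andP: t01.
    rewrite distrC ger0_norm ?subr_ge0 ?(ltW rt)//.
    have : t - del / 2 <= r by rewrite /r le_max lexx orbT.
    have : 0 < del by [].
    by lra.
  by apply: hlt; rewrite r0.
have [del del0 hdel] := Sopen _ t01 St.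
have Snear r' : 0 <= r' <= 1 -> r' <= t + del / 2 -> S r'.
  move=> hr' r't; have [lt|ge] := ltP r' t; first by apply: hlt; case/andP: hr' => ->.
  apply: hdel => //; rewrite distrC ger0_norm ?subr_ge0//.
  have : 0 < del by [].
  by lra.
have [h1|h1] := leP 1 (t + del / 2); first by apply: nS1; apply: Snear => //; rewrite ler01 lexx.
have : A (t + del / 2).
  have h2 : 0 <= t + del / 2 by case/andP: t01 => ? _; rewrite addr_ge0// divr_ge0// ltW.
  split; first by rewrite h2 ltW.
  by move=> r' /andP[r'0 r'1]; apply: Snear => //; rewrite r'0 (le_trans r'1)// ltW.
move/(ub_le_sup supA.2); rewrite -/t gerDl.
by rewrite leNgt divr_gt0.
Qed.

(** The logarithmic derivative at 0: the location of the roots controls [p' (0) / p (0)]. *)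
Lemma deriv0_prod (rs : seq C) : (forall s, s \in rs -> s != 0) ->
  let p := \prod_(s <- rs) ('X - s%:P) in
  p`_1 = p`_0 * \sum_(s <- rs) (- s^-1).
Proof.
elim: rs => [|s rs IH] h p.
  by rewrite /p !big_nil mulr0 coef1.
rewrite /p !big_cons; set q := \prod_(_ <- _) _ in IH *.
have s0 : s != 0 by apply: h; rewrite inE eqxx.
have IH' : q`_1 = q`_0 * \sum_(s <- rs) (- s^-1).
  by apply: IH => t ht; apply: h; rewrite inE ht orbT.
rewrite !mulrBl !coefB !coefXM/= !coefCM IH' sub0r mulrDr.
by field.
Qed.

End complex_roots.

(** * Garding's inequality for symmetric multilinear forms *)

Section garding.
Local Open Scope complex_scope.
Variables (R : realType).
Local Notation C := R[i].
Local Notation Im := complex.Im.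
Local Notation Re := complex.Re.
Variable V : lmodType C.
Implicit Types (M : seq V -> C) (m : nat).

(** Arguments form a list, so that fixing one of them is consing it; only lists of length [m] are
    constrained. *)
Definition sym_multilinear m M :=
  (forall l, (size l).+1 = m ->
    forall a u v, M (a *: u + v :: l) = a * M (u :: l) + M (v :: l)) /\
  (forall l l', size l = m -> perm_eq l l' -> M l = M l').

Lemma sym_multilinear_cons m M a : sym_multilinear m.+1 M ->
  sym_multilinear m (fun l => M (a :: l)).
Proof.
move=> [lin sym]; split; last first.
  by move=> l l' sl ll'; apply: sym; [rewrite /= sl|rewrite perm_cons].
move=> l sl b u v.
have sw w : M [:: a, w & l] = M [:: w, a & l].
  by apply: sym => /=; [rewrite sl|rewrite -cat1s -(cat1s w) perm_catCA].
by rewrite !sw lin//= sl.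
Qed.

Lemma sym_multilinearD m M u v l : sym_multilinear m M -> (size l).+1 = m ->
  M (u + v :: l) = M (u :: l) + M (v :: l).
Proof. by move=> [lin _] sl; rewrite -[u in LHS]scale1r lin// mul1r. Qed.

Lemma sym_multilinear0 m M l : sym_multilinear m M -> (size l).+1 = m ->
  M (0 :: l) = 0.
Proof.
move=> hM sl; have := sym_multilinearD 0 0 hM sl.
by rewrite addr0 => /esym/eqP; rewrite -subr_eq0 addrK => /eqP.
Qed.

Lemma sym_multilinearZ m M a u l : sym_multilinear m M -> (size l).+1 = m ->
  M (a *: u :: l) = a * M (u :: l).
Proof.
by move=> hM sl; have [lin _] := hM; rewrite -[a *: u]addr0 lin// (sym_multilinear0 hM)// addr0.
Qed.

Lemma sym_multilinear_nseqZ m M a u : sym_multilinear m M ->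
  M (nseq m (a *: u)) = a ^+ m * M (nseq m u).
Proof.
elim: m M => [|m IH] M hM; first by rewrite /= mul1r.
rewrite /= (sym_multilinearZ _ _ hM) ?size_nseq//.
by rewrite (IH (fun l => M (u :: l))) ?exprS ?mulrA//; exact: sym_multilinear_cons.
Qed.

Lemma sym_multilinear_poly M (l : seq (V * V)) : sym_multilinear (size l) M ->
  exists P : {poly C}, forall s, P.[s] = M [seq p.1 + s *: p.2 | p <- l].
Proof.
elim: l M => [|[u v] l IH] M hM; first by exists (M [::])%:P => s; rewrite hornerC.
have [P hP] := IH _ (sym_multilinear_cons u hM).
have [Q hQ] := IH _ (sym_multilinear_cons v hM).
exists (P + 'X * Q) => s; rewrite !hornerE hP hQ /=.
rewrite (sym_multilinearD _ _ hM) ?size_map//.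
by rewrite (sym_multilinearZ _ _ hM) ?size_map.
Qed.

(** The linear coefficient turns a mixed value of [M] into a derivative at 0, to be read off the
    roots by [deriv0_prod]; the top coefficient fixes their number. *)
Lemma sym_multilinear_power m M u v : sym_multilinear m M ->
  exists P : {poly C}, [/\ (size P <= m.+1)%N,
    forall s, P.[s] = M (nseq m (u + s *: v)), P`_m = M (nseq m v) &
    P`_1 = m%:R * M (v :: nseq m.-1 u)].
Proof.
elim: m M => [|m IH] M hM.
  exists (M [::])%:P; split; first exact: size_polyC_leq1.
  - by move=> s; rewrite hornerC.
  - by rewrite coefC.
  - by rewrite coefC mul0r.
have [P [sP hP _ P1]] := IH _ (sym_multilinear_cons u hM).
have [Q [sQ hQ Qm _]] := IH _ (sym_multilinear_cons v hM).
exists (P + 'X * Q); split.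
- apply: leq_trans (size_polyD _ _) _; rewrite geq_max (leq_trans sP)//=.
  by rewrite mulrC (leq_trans (size_polyMleq _ _))// size_polyX addn2.
- move=> s; rewrite !hornerE hP hQ /=.
  rewrite (sym_multilinearD _ _ hM) ?size_nseq//.
  by rewrite (sym_multilinearZ _ _ hM) ?size_nseq.
- by rewrite coefD coefXM/= Qm nth_default// add0r.
- rewrite coefD coefXM/= P1 -horner_coef0 hQ scale0r addr0.
  case: m hM {IH P sP hP P1 Q sQ hQ Qm} => [|m] hM; first by rewrite mul0r add0r mul1r.
  have -> : M [:: u, v & nseq m.+1.-1 u] = M (v :: nseq m.+1 u).
    have [_ sym] := hM.
    apply: sym; first by rewrite /= size_nseq.
    by rewrite /= -cat1s -(cat1s v) perm_catCA.
  by rewrite -[m.+2]addn1 natrD mulrDl mul1r.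
Qed.

(** Puts a two-parameter restriction of [M] in the shape required by [root_homotopy], with a leading
    coefficient independent of [r]. *)
Lemma sym_multilinear_power2 m M u w v : sym_multilinear m M ->
  exists c : nat -> {poly C}, [/\
    forall r s, M (nseq m (u + r *: w + s *: v)) = \sum_(l < m.+1) (c l).[r] * s ^+ l,
    forall r, (c m).[r] = M (nseq m v) &
    forall l, (m < l)%N -> c l = 0].
Proof.
elim: m M => [|m IH] M hM.
  exists (fun l => if l is 0%N then (M [::])%:P else 0); split.
  - by move=> r s; rewrite big_ord1 hornerC expr0 mulr1.
  - by move=> r; rewrite hornerC.
  - by case.
have [a [ha _ za]] := IH _ (sym_multilinear_cons u hM).
have [b [hb _ zb]] := IH _ (sym_multilinear_cons w hM).
have [c [hc cm zc]] := IH _ (sym_multilinear_cons v hM).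
exists (fun l => a l + 'X * b l + if l is l'.+1 then c l' else 0); split.
- move=> r s /=.
  rewrite (sym_multilinearD _ _ hM) ?size_nseq//.
  rewrite (sym_multilinearD _ _ hM) ?size_nseq//.
  rewrite !(sym_multilinearZ _ _ hM) ?size_nseq// ha hb hc.
  under [RHS]eq_bigr do rewrite !hornerE !mulrDl.
  rewrite !big_split/=; congr (_ + _ + _).
  + by rewrite [RHS]big_ord_recr/= za// horner0 mul0r addr0.
  + rewrite [RHS]big_ord_recr/= zb// horner0 mulr0 mul0r addr0 mulr_sumr.
    by apply: eq_bigr => i _; rewrite mulrA.
  + rewrite [RHS]big_ord_recl/= horner0 mul0r add0r mulr_sumr.
    by apply: eq_bigr => i _; rewrite /bump leq0n add1n exprS mulrCA.
- by move=> r; rewrite (za _ (ltnSn m)) (zb _ (ltnSn m)) mulr0 !add0r; exact: cm.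
- case=> [//|l] hl.
  by rewrite (za _ (ltnW hl)) (zb _ (ltnW hl)) (zc l hl) mulr0 !addr0.
Qed.

(** [rl] is a real subspace of the complex space [V]; in the application it consists of the
    Hermitian matrices, and [e] is [beta]. *)
Variables (rl : V -> Prop) (e : V).
Hypothesis rlD : forall u v, rl u -> rl v -> rl (u + v).
Hypothesis rlZ : forall (a : R) u, rl u -> rl (a%:C *: u).
Hypothesis rle : rl e.

(** Real-rootedness of [t |-> M (x + t e, .., x + t e)] for real [x], stated as absence of zeros off
    the real axis. *)
Definition hyperbolic m M :=
  [/\ sym_multilinear m M, 0 < M (nseq m e) &
   forall x (t : C), rl x -> Im t != 0 -> M (nseq m (x + t *: e)) != 0].

(** The open Garding cone of [e]: for hyperbolic [M], all roots of [t |-> M (a + t e, .., a + t e)]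
    are negative. *)
Definition hyp_cone m M (a : V) :=
  rl a /\ forall t : R, 0 <= t -> M (nseq m (a + t%:C *: e)) != 0.

Lemma hyp_cone_id m M : hyperbolic m M -> hyp_cone m M e.
Proof.
move=> [hM pe _]; split=> // t t0; rewrite -[X in X + _]scale1r -scalerDl.
rewrite sym_multilinear_nseqZ// mulf_neq0//; last by rewrite gt_eqF.
by rewrite expf_neq0// gt_eqF// ltr_wpDr// ler0c.
Qed.

Lemma hyp_cone_neq0 m M a : hyp_cone m M a -> M (nseq m a) != 0.
Proof. by move=> [_ /(_ 0 (lexx _))]; rewrite scale0r addr0. Qed.

(** [root_homotopy] in the variable [s], as the base point moves along the segment from [x] to
    [x + z]. *)
Lemma multilinear_homotopy m M x z a : sym_multilinear m M ->
  M (nseq m a) != 0 ->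
  (forall (r : R) s, 0 <= r <= 1 -> Im s = 0 ->
     M (nseq m (x + r%:C *: z + s *: a)) != 0) ->
  (forall s, 0 <= Im s -> M (nseq m (x + s *: a)) != 0) ->
  forall s, 0 <= Im s -> M (nseq m (x + z + s *: a)) != 0.
Proof.
move=> hM a0 hreal h0 s hs.
have [c [hc cm _]] := sym_multilinear_power2 x z a hM.
have := @root_homotopy R m c _ a0 (fun r => cm _); rewrite /=.
move=> /(_ _ _ s hs).
rewrite -hc scale1r; apply => [r w hr hw|w hw].
  by rewrite -hc hreal.
by rewrite -hc scale0r addr0 h0.
Qed.

(** The starting point of the homotopies. By homogeneity the value is [s ^ m] times that at
    [a + (i t / s) e]: a nonreal quotient falls under hyperbolicity, and a real one is nonnegative
    because [t > 0] and [Im s >= 0], which is the cone condition. *)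
Lemma hyperbolic_lower0 m M a (t : R) s : hyperbolic m M -> hyp_cone m M a ->
  0 < t -> 0 <= Im s -> M (nseq m ((t *i) *: e + s *: a)) != 0.
Proof.
move=> hypM ca t0 hs; have [hM pe hM0] := hypM; have [ra ca0] := ca.
have [->|s0] := eqVneq s 0.
  rewrite scale0r addr0 sym_multilinear_nseqZ// mulf_neq0//; last by rewrite gt_eqF.
  by rewrite expf_neq0// eq_complex/= eqxx/= gt_eqF.
rewrite (_ : _ + _ = s *: (a + (t *i / s) *: e)); last first.
  by rewrite scalerDr scalerA mulrCA divff// mulr1 addrC.
rewrite sym_multilinear_nseqZ// mulf_neq0// ?expf_neq0//.
have [|im0] := eqVneq (Im (t *i / s)) 0; last exact: hM0.
case E : (t *i / s) => [x y] /= y0; rewrite y0; apply: ca0.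
have : t *i = x%:C * s.
  by rewrite -[LHS](divfK s0) E y0.
case: s s0 hs {E} => u v s0 /= v0 [_]; rewrite mul0r addr0 => txv.
rewrite leNgt; apply/negP => x0.
by have : t <= 0; [rewrite txv mulr_le0_ge0// ltW|rewrite leNgt t0].
Qed.

(** The homotopy starts at the base point [i (Im t) e]. For real [s] the argument is a real vector
    plus [i (Im t) e], where hyperbolicity forbids a zero. *)
Lemma hyperbolic_upper m M x a s t : hyperbolic m M -> rl x -> hyp_cone m M a ->
  0 < Im t -> 0 <= Im s -> M (nseq m (x + t *: e + s *: a)) != 0.
Proof.
move=> hypM rx ca; have [hM pe hM0] := hypM; have [ra _] := ca.
case: t => t1 t2 /= t20 hs.
have -> : x + (t1 +i* t2) *: e = t2 *i *: e + (x + t1%:C *: e).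
  by rewrite addrCA -scalerDl; congr (_ + _ *: _); simpc.
apply: multilinear_homotopy => //; first exact: hyp_cone_neq0 ca.
- move=> r w hr hw.
  rewrite -addrA addrC hM0 ?gt_eqF//.
  apply: rlD; first by apply/rlZ/rlD => //; exact: rlZ.
  by have -> : w = (Re w)%:C; [case: w hw => ? ? /= ->|exact: rlZ].
- by move=> w hw; exact: hyperbolic_lower0.
Qed.

(** The finitely many roots of [s |-> M (b + s e, .., b + s e)] are negative, hence stay so after a
    small shift. *)
Lemma hyp_cone_open m M b : hyperbolic m M -> hyp_cone m M b ->
  exists2 d : R, 0 < d & hyp_cone m M (b - d%:C *: e).
Proof.
move=> [hM pe hM0] [rb cb].
have [P [sP hP Pm _]] := sym_multilinear_power b e hM.
have P0 : P != 0.
  by apply: contraTneq pe => P0; rewrite -Pm P0 coef0 ltxx.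
have [rs hrs] := closed_field_poly_normal P.
have rsP s : s \in rs -> Im s = 0 /\ Re s < 0.
  move=> srs.
  have Ps : P.[s] = 0.
    by rewrite hrs hornerZ horner_prod (big_rem s)//= hornerXsubC subrr mul0r mulr0.
  have i0 : Im s = 0.
    by apply/eqP/negPn/negP => is0; have := hM0 b s rb is0; rewrite -hP Ps eqxx.
  split=> //; rewrite ltNge; apply/negP => rs0.
  have := cb _ rs0; rewrite -hP (_ : (Re s)%:C = s) ?Ps ?eqxx//.
  by case: s {srs Ps rs0} i0 => ? ? /= ->.
have [d d0 hd] : exists2 d : R, 0 < d & forall s, s \in rs -> Re s < - d.
  elim: rs {hrs} rsP => [|s rs IH] h; first by exists 1.
  have [|d d0 hd] := IH; first by move=> u hu; apply: h; rewrite inE hu orbT.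
  have [_ s0] := h s (mem_head _ _).
  exists (Num.min d (- Re s / 2)).
    by rewrite lt_min d0 divr_gt0// oppr_gt0.
  move=> u; rewrite inE => /predU1P[->|/hd hu].
    by rewrite ltrNr gt_min; apply/orP; right; lra.
  by apply: lt_le_trans hu _; rewrite lerN2 ge_min lexx.
exists d => //; split.
  by rewrite -scaleNr -(rmorphN (real_complex R)); apply: rlD => //; exact: rlZ.
move=> t t0; rewrite -addrA -scaleNr -scalerDl [- _ + _]addrC -(rmorphB (real_complex R)).
rewrite -hP hrs hornerZ mulf_neq0 ?lead_coef_eq0// horner_prod prodf_seq_neq0.
apply/allP => s /= srs; rewrite hornerXsubC subr_eq0.
apply: contraTneq (hd s srs) => <- /=.
by rewrite -leNgt lerBrDr addrC subrr.
Qed.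

(** Openness supplies a multiple of [e]: [i b = i d e + i (b - d e)], to which [hyperbolic_upper]
    applies with [t = i d] and [s = i]. *)
Lemma hyp_cone_stable m M b x : hyperbolic m M -> hyp_cone m M b -> rl x ->
  M (nseq m (x + 'i *: b)) != 0.
Proof.
move=> hypM cb rx; have [d d0 cd] := hyp_cone_open hypM cb.
have <- : x + (d *i) *: e + 'i *: (b - d%:C *: e) = x + 'i *: b.
  rewrite scalerBr scalerA -addrA; congr (_ + _).
  have -> : 'i * d%:C = d *i :> C.
    by apply/eqP; rewrite eq_complex /=; apply/andP; split; apply/eqP; ring.
  by rewrite addrCA subrr addr0.
by apply: hyperbolic_upper => //=; rewrite ler01.
Qed.

Lemma hyp_cone_segment m M b (r : R) : hyperbolic m M -> hyp_cone m M b ->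
  0 <= r <= 1 -> hyp_cone m M ((1 - r)%:C *: e + r%:C *: b).
Proof.
move=> hypM [rb cb] /andP[r0 r1]; have [hM pe _] := hypM.
split; first by apply: rlD; exact: rlZ.
move=> t t0; have [->|rn0] := eqVneq r 0.
  rewrite scale0r addr0 subr0 scale1r.
  by have [_] := hyp_cone_id hypM; exact.
have rC : r%:C != 0 :> C by rewrite eq_complex /= eqxx andbT.
have -> : (1 - r)%:C *: e + r%:C *: b + t%:C *: e =
    r%:C *: (b + ((1 - r + t) / r)%:C *: e).
  rewrite scalerDr scalerA -(rmorphM (real_complex R)) mulrC divfK//.
  by rewrite addrAC -scalerDl addrC -(rmorphD (real_complex R)).
rewrite sym_multilinear_nseqZ// mulf_neq0// ?expf_neq0// cb//.
by rewrite divr_ge0// addr_ge0// subr_ge0.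
Qed.

(** Here any cone vector [b] replaces [e] in the imaginary direction. The homotopy runs from [i e]
    to [x + i b]; for real [s] its imaginary part stays on the segment from [e] to [b], inside the
    cone. *)
Lemma hyp_cone_upper m M x a b s : hyperbolic m M -> rl x -> hyp_cone m M a ->
  hyp_cone m M b -> 0 <= Im s -> M (nseq m (x + 'i *: b + s *: a)) != 0.
Proof.
move=> hypM rx ca cb hs; have [hM pe hM0] := hypM; have [ra _] := ca.
have -> : x + 'i *: b = 'i *: e + (x + 'i *: (b - e)).
  by rewrite addrCA -scalerDr [e + _]addrC subrK.
apply: multilinear_homotopy => //; first exact: hyp_cone_neq0 ca.
- move=> r w hr hw.
  have -> : 'i *: e + r%:C *: (x + 'i *: (b - e)) + w *: a =
      (r%:C *: x + w *: a) + 'i *: ((1 - r)%:C *: e + r%:C *: b).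
    rewrite scalerDr addrCA addrAC; congr (_ + _).
    rewrite !scalerDr !scalerN !scalerA rmorphB/= mulrBr mulr1.
    rewrite scalerBl ['i * _]mulrC -!addrA; congr (_ + _).
    by rewrite addrC.
  apply: hyp_cone_stable => //; first exact: hyp_cone_segment.
  apply: rlD; first exact: rlZ.
  by have -> : w = (Re w)%:C; [case: w hw => ? ? /= ->|exact: rlZ].
- move=> w hw; apply: hyperbolic_lower0 => //; exact: ltr01.
Qed.

(** For [p (s) = M (x + s a, .., x + s a)], the quotient [p' (0) / p (0)] is the sum of the
    [- 1 / s] over roots with [Im s < 0]. Every summand has negative imaginary part, so the
    derivative, a multiple of the mixed value, cannot vanish. *)
Lemma multilinear_gauss_lucas m M x a : sym_multilinear m.+1 M ->
  M (nseq m.+1 a) != 0 ->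
  (forall s, 0 <= Im s -> M (nseq m.+1 (x + s *: a)) != 0) ->
  M (a :: nseq m x) != 0.
Proof.
move=> hM a0 hs.
have [P [sP hP Pm P1]] := sym_multilinear_power x a hM.
have [rs hrs] := closed_field_poly_normal P.
have P0 : lead_coef P != 0.
  by rewrite lead_coef_eq0; apply: contraNneq a0 => P0; rewrite -Pm P0 coef0.
have szP : size P = m.+2.
  apply/eqP; rewrite eqn_leq sP/=; apply: contraNltn a0 => h.
  by rewrite -Pm nth_default.
have srs : size rs = m.+1.
  have := congr1 (fun x : {poly C} => size x) hrs.
  by rewrite size_scale// size_prod_XsubC szP => -[].
have rsI s : s \in rs -> Im s < 0.
  move=> srs'; rewrite ltNge; apply/negP => /hs /negP; apply; rewrite -hP.
  by rewrite hrs hornerZ horner_prod (big_rem s)//= hornerXsubC subrr mul0r mulr0.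
have rs0 s : s \in rs -> s != 0.
  by move=> /rsI; apply: contraTneq => -> /=; rewrite ltxx.
have := P1; rewrite {1}hrs coefZ deriv0_prod// mulrA -coefZ -hrs.
rewrite -horner_coef0 hP scale0r addr0 => E.
have : m.+1%:R * M (a :: nseq m x) != 0.
  rewrite /= in E; rewrite -E mulf_neq0//.
    by have := hs 0 (lexx _); rewrite scale0r addr0.
  have hI s : s \in rs -> Im (- s^-1) < 0.
    move=> /rsI; case: s => u v /= v0.
    rewrite ?mulNr ?opprK ltr_pdivrMr ?mul0r//.
    by rewrite ltr_wpDl ?sqr_ge0// exprn_even_gt0//= lt_eqF.
  have : Im (\sum_(s <- rs) - s^-1) < 0.
    case: rs srs hI {hrs rsI rs0 E} => // s rs _ hI.
    rewrite big_cons raddfD/=; apply: ltr_wnDr; last first.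
      by apply: hI; rewrite mem_head.
    rewrite big_seq raddf_sum/=; apply: sumr_le0 => u hu; apply: ltW.
    by have := hI u; rewrite /= inE hu orbT; exact.
  by apply: contraTneq => -> /=; rewrite ltxx.
by rewrite mulf_eq0 negb_or => /andP[].
Qed.

(** The roots of [s |-> M (e + s a, .., e + s a)] are real and negative, so its logarithmic
    derivative at 0 is positive, as is its value there. *)
Lemma hyperbolic_cons_gt0 m M a : hyperbolic m.+1 M -> hyp_cone m.+1 M a ->
  0 < M (a :: nseq m e).
Proof.
move=> [hM pe hM0] ca; have [ra ca0] := ca.
have [P [sP hP Pm P1]] := sym_multilinear_power e a hM.
have [rs hrs] := closed_field_poly_normal P.
have a0 := hyp_cone_neq0 ca.
have P0 : lead_coef P != 0.
  by rewrite lead_coef_eq0; apply: contraNneq a0 => P0; rewrite -Pm P0 coef0.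
have szP : size P = m.+2.
  apply/eqP; rewrite eqn_leq sP/=; apply: contraNltn a0 => h.
  by rewrite -Pm nth_default.
have srs : size rs = m.+1.
  have := congr1 (fun x : {poly C} => size x) hrs.
  by rewrite size_scale// size_prod_XsubC szP => -[].
have P00 : P.[0] = M (nseq m.+1 e) by rewrite hP scale0r addr0.
have rsI s : s \in rs -> s < 0.
  move=> srs'.
  have Ps : P.[s] = 0.
    by rewrite hrs hornerZ horner_prod (big_rem s)//= hornerXsubC subrr mul0r mulr0.
  have s0 : s != 0 by apply/eqP => s0; move: pe; rewrite -P00 -[X in _.[X]]s0 Ps ltxx.
  have : M (nseq m.+1 (a + s^-1 *: e)) = 0.
    apply/eqP; have := Ps; rewrite hP.
    have -> : e + s *: a = s *: (a + s^-1 *: e).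
      by rewrite scalerDr scalerA divff// scale1r addrC.
    rewrite sym_multilinear_nseqZ// => /eqP.
    by rewrite mulf_eq0 expf_eq0/= (negbTE s0).
  move=> Ms; have i0 : Im s^-1 = 0.
    by apply/eqP/negPn/negP => h; have := hM0 a _ ra h; rewrite Ms eqxx.
  have sr : s^-1 = (Re s^-1)%:C by case: (s^-1) i0 => ? ? /= ->.
  rewrite -invr_lt0 sr ltcR ltNge; apply/negP => /ca0.
  by rewrite -sr Ms eqxx.
have rs0 s : s \in rs -> s != 0 by move=> /rsI h; rewrite lt_eqF.
have := P1; rewrite {1}hrs coefZ deriv0_prod// mulrA -coefZ -hrs.
rewrite -horner_coef0 P00 /= => E.
have : 0 < m.+1%:R * M (a :: nseq m e).
  rewrite -E mulr_gt0//.
  case: rs srs rsI {hrs rs0 E} => // s rs _ hI.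
  rewrite big_cons; apply: ltr_wpDr; last first.
    by rewrite oppr_gt0 invr_lt0 hI// mem_head.
  rewrite big_seq; apply: sumr_ge0 => u hu.
  by rewrite oppr_ge0 invr_le0 ltW// hI// inE hu orbT.
by rewrite pmulr_rgt0// ltr0n.
Qed.

(** First half of the induction step for Garding's inequality. The lower half-plane reduces to the
    upper one by changing the signs of [x] and [t]. *)
Lemma hyperbolic_cons m M a : hyperbolic m.+1 M -> hyp_cone m.+1 M a ->
  hyperbolic m (fun l => M (a :: l)).
Proof.
move=> hypM ca; have [hM pe hM0] := hypM; have [ra ca0] := ca.
split; first exact: sym_multilinear_cons.
  exact: hyperbolic_cons_gt0.
have up x t : rl x -> 0 < Im t -> M (a :: nseq m (x + t *: e)) != 0.
  move=> rx ht; apply: multilinear_gauss_lucas => //; first exact: hyp_cone_neq0 ca.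
  by move=> s hs; exact: hyperbolic_upper.
move=> x t rx; rewrite neq_lt => /orP[] ht; last exact: up.
have rNx : rl (- x) by have := rlZ (-1) rx; rewrite rmorphN scaleN1r.
have t0 : 0 < Im (- t) by case: t ht => ? ? /= ?; rewrite oppr_gt0.
have := up (- x) (- t) rNx t0.
have -> : - x + - t *: e = -1 *: (x + t *: e) by rewrite scaleN1r opprD scaleNr.
rewrite (sym_multilinear_nseqZ _ _ (sym_multilinear_cons a hM)) mulf_eq0 negb_or.
by case/andP.
Qed.

(** Second half of the induction step: Gauss-Lucas is applied at the point [i (b + t e)], and
    homogeneity then removes the factor [i]. *)
Lemma hyp_cone_cons m M a b : hyperbolic m.+1 M -> hyp_cone m.+1 M a ->
  hyp_cone m.+1 M b -> hyp_cone m (fun l => M (a :: l)) b.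
Proof.
move=> hypM ca cb; have [hM pe hM0] := hypM; have [rb cb0] := cb.
split=> // t t0.
have cbt : hyp_cone m.+1 M (b + t%:C *: e).
  split; first by apply: rlD => //; exact: rlZ.
  by move=> u u0; rewrite -addrA -scalerDl -(rmorphD (real_complex R)) cb0// addr_ge0.
have : M (a :: nseq m ('i *: (b + t%:C *: e))) != 0.
  apply: multilinear_gauss_lucas => //; first exact: hyp_cone_neq0 ca.
  have r0 : rl 0 by have := rlZ 0 rle; rewrite scale0r.
  by move=> s hs; have := hyp_cone_upper hypM r0 ca cbt hs; rewrite add0r.
rewrite (sym_multilinear_nseqZ _ _ (sym_multilinear_cons a hM)) mulf_eq0 negb_or.
by case/andP.
Qed.

Lemma garding m M l : hyperbolic m M -> size l = m ->
  (forall a, a \in l -> hyp_cone m M a) -> 0 < M l.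
Proof.
elim: l m M => [|a l IH] [|m] M hypM //=; first by case: hypM.
move=> [sl] hl; have ca : hyp_cone m.+1 M a by apply: hl; rewrite mem_head.
apply: (IH m (fun l => M (a :: l))) => //; first exact: hyperbolic_cons.
by move=> b bl; apply: hyp_cone_cons => //; apply: hl; rewrite inE bl orbT.
Qed.

(** With [e = beta] this passes from the determinant to the [m]-th elementary symmetric function. *)
Lemma hyperbolic_cat_nseq k m M : hyperbolic (k + m) M ->
  hyperbolic m (fun l => M (nseq k e ++ l)).
Proof.
elim: k M => [|k IH] M //= hypM.
apply: (IH (fun l => M (e :: l))); apply: hyperbolic_cons => //.
exact: hyp_cone_id.
Qed.

(** In the binomial expansion of the right-hand side every term is nonnegative, and the one without
    [a] is the left-hand side. This moves vectors satisfying the closed inequalities into the open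
    cone. *)
Lemma multilinear_shift_ge m M a (t : C) : sym_multilinear m M -> 0 <= t ->
  (forall k, (k <= m)%N -> 0 <= M (nseq k a ++ nseq (m - k) e)) ->
  t ^+ m * M (nseq m e) <= M (nseq m (a + t *: e)).
Proof.
elim: m M => [|m IH] M hM t0 h; first by rewrite /= mul1r.
rewrite /= (sym_multilinearD _ _ hM) ?size_nseq//.
rewrite (sym_multilinearZ _ _ hM) ?size_nseq//.
have ha : t ^+ m * M (a :: nseq m e) <= M (a :: nseq m (a + t *: e)).
  apply: (IH (fun l => M (a :: l))) => //; first exact: sym_multilinear_cons.
  by move=> k km; have := h k.+1; rewrite ltnS subSS => /(_ km).
have he : t ^+ m * M (e :: nseq m e) <= M (e :: nseq m (a + t *: e)).
  apply: (IH (fun l => M (e :: l))) => //; first exact: sym_multilinear_cons.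
  move=> k km; have := h k (leqW km); rewrite subSn//=.
  congr (_ <= _); have [_ sym] := hM; apply: sym.
    by rewrite size_cat /= !size_nseq addnS subnKC.
  by rewrite -[_ :: nseq _ _]cat1s -[e :: _]cat1s perm_catCA.
apply: ler_wpDl; last by rewrite exprS -mulrA ler_wpM2l.
apply: le_trans ha; rewrite mulr_ge0 ?exprn_ge0//.
have := h 1%N isT; rewrite subSS subn0; exact.
Qed.

(** All arguments are shifted by [d e], which puts them in the open cone, and [d] tends to 0. The
    inequalities at all orders [k] replace membership in the closed cone, to match [m_positive]. *)
Lemma garding_closed m M l : hyperbolic m M -> size l = m ->
  (forall a, a \in l -> rl a /\ forall k, (k <= m)%N ->
     0 <= M (nseq k a ++ nseq (m - k) e)) ->
  0 <= Re (M l).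
Proof.
move=> hypM sl hl; have [hM pe hM0] := hypM.
have [P hP] : exists P : {poly C}, forall s, P.[s] = M [seq a + s *: e | a <- l].
  have [|P hP] := @sym_multilinear_poly M [seq (a, e) | a <- l].
    by rewrite size_map sl.
  by exists P => s; rewrite hP -map_comp.
have pos (d : R) : 0 < d -> 0 < P.[d%:C].
  move=> d0; rewrite hP; apply: (garding hypM); first by rewrite size_map.
  move=> _ /mapP[a al ->]; have [ra ha] := hl a al.
  split; first by apply: rlD => //; exact: rlZ.
  move=> t t0; rewrite -addrA -scalerDl -(rmorphD (real_complex R)) gt_eqF//.
  have dt : 0 < (d + t)%:C :> C by rewrite ltcR ltr_wpDr.
  apply: lt_le_trans (multilinear_shift_ge hM (ltW dt) ha).
  by rewrite mulr_gt0// exprn_gt0.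
have -> : M l = P.[0].
  rewrite hP; congr M; rewrite -[LHS]map_id; apply: eq_map => a.
  by rewrite scale0r addr0.
have [K K0 hK] := poly_lipschitz01 P.
rewrite leNgt; apply/negP => n0.
(* So small that the Lipschitz bound on [[0, 1]] cannot lift the real part from [Re P.[0] < 0] to a
   positive value. *)
pose d := Num.min 1 (- Re P.[0] / (Re K + 1) / 2).
have ReK : 0 <= Re K by move: K0; rewrite lecE/= => /andP[].
have d0 : 0 < d.
  by rewrite lt_min ltr01 !divr_gt0// ?oppr_gt0// ltr_wpDl.
have d1 : 0 <= d <= 1 by rewrite ltW//= ge_min lexx.
have h01 : 0 <= (0 : R) <= 1 by rewrite lexx ler01.
have [_] := hK 0 d h01 d1; rewrite rmorph0.
rewrite sub0r normrN (gtr0_norm d0) => h.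
have hre := pos _ d0; rewrite ltcE/= in hre; case/andP: hre => _ hre.
have : `|Re (P.[0] - P.[d%:C])| <= Re K * d.
  rewrite -lecR; apply: le_trans (normc_ge_Re _) _.
  apply: le_trans h _; rewrite rmorphM/= RRe_real//; exact: ger0_real.
rewrite raddfB/= ltr0_norm; last by rewrite subr_lt0 (lt_trans n0).
rewrite opprB => h2.
have : d <= - Re P.[0] / (Re K + 1) / 2 by rewrite ge_min lexx orbT.
rewrite ler_pdivlMr// ler_pdivlMr ?ltr_wpDl// => h3.
have : 0 < d * Re K + d by rewrite ltr_wpDl// mulr_ge0// ltW.
nra.
Qed.

End garding.

(** * Mixed discriminants *)

Section wedge_theory.
Local Open Scope complex_scope.
Variables (R : realType).
Local Notation C := R[i].
Local Notation Im := complex.Im.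
Local Notation Re := complex.Re.

Lemma hermsymmxP n (A : 'M[C]_n) :
  (A \is hermsymmx) <-> forall j k, A j k = conjc (A k j).
Proof.
rewrite is_hermitianmxE expr0 scale1r; split.
  by move=> /eqP h j k; rewrite {1}h !mxE.
by move=> h; apply/eqP/matrixP => j k; rewrite !mxE h.
Qed.

Lemma wedge_lin n l (a : C) (u v : 'M[C]_n) : (size l).+1 = n ->
  wedge (a *: u + v :: l) = a * wedge (u :: l) + wedge (v :: l).
Proof.
case: n u v l => // n u v l sl.
rewrite /wedge mulr_sumr -big_split/=; apply: eq_bigr => p _.
rewrite mulr_sumr -big_split/=; apply: eq_bigr => q _.
rewrite !big_ord_recl/= !mxE; set x := \prod_(_ < _) _; set y := _ * _ ^+ q.
by rewrite mulrDl mulrDr; congr (_ + _); rewrite -mulrA mulrCA.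
Qed.

(** Reordering the factors reindexes both permutations by the same one, so the two signs cancel. *)
Lemma wedge_perm n (l l' : seq 'M[C]_n) : size l = n -> perm_eq l l' ->
  wedge l = wedge l'.
Proof.
move=> sl pll'; have sl' : size l' == n by rewrite -(perm_size pll') sl.
have [s hs] := @tuple_permP _ n l (Tuple sl') pll'.
have hn (i : 'I_n) : nth 0 l i = nth 0 l' (s i).
  by rewrite hs -tnth_nth tnth_mktuple (tnth_nth 0).
rewrite /wedge (reindex_inj (mulgI s)) /=; apply: eq_bigr => p _.
rewrite (reindex_inj (mulgI s)) /=; apply: eq_bigr => q _.
have sg (b c d : bool) :
    (-1) ^+ (b (+) c) * (-1) ^+ (b (+) d) = (-1) ^+ c * (-1) ^+ d :> C.
  by case: b; case: c; case: d; rewrite /= ?expr0 ?expr1; ring.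
rewrite !odd_permM sg; congr (_ * _).
rewrite [RHS](reindex_inj (@perm_inj _ s)); apply: eq_bigr => i _.
by rewrite hn !permM.
Qed.

Lemma wedge_sym_multilinear n : @sym_multilinear R 'M[C]_n n (@wedge R n).
Proof.
by split=> [l sl a u v|l l' sl]; [exact: wedge_lin|exact: wedge_perm].
Qed.

(** A kernel vector [v] would make the real number given by the Hermitian form [x] at [v] equal to
    [- t |v| ^ 2]. *)
Lemma det_hermitian_shift n (x : 'M[C]_n) (t : C) : x \is hermsymmx ->
  Im t != 0 -> \det (x + t%:M) != 0.
Proof.
move=> /hermsymmxP hx t0; apply/negP => /det0P[v v0 hv].
pose w : 'cV[C]_n := \col_i conjc (v 0 i).
pose N := \sum_i `|v 0 i| ^+ 2.
have N0 : 0 < N.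
  rewrite lt_neqAle sumr_ge0 ?andbT; last by move=> i _; rewrite exprn_ge0.
  apply: contraNneq v0 => /esym/eqP; rewrite psumr_eq0; last by move=> i _; rewrite exprn_ge0.
  move=> /allP h; apply/eqP/rowP => i; rewrite mxE; apply/eqP.
  by have := h i (mem_index_enum _); rewrite /= expf_eq0/= normr_eq0.
have hN : (v *m w) 0 0 = N.
  by rewrite mxE; apply: eq_bigr => i _; rewrite !mxE sqr_normc.
have E : (v *m x *m w) 0 0 = - t * N.
  have : v *m (x + t%:M) *m w = 0 by rewrite hv mul0mx.
  rewrite mulmxDr mulmxDl => /matrixP/(_ 0 0).
  rewrite mul_mx_scalar -scalemxAl 3!mxE hN [RHS]mxE => /eqP.
  by rewrite addr_eq0 mulNr => /eqP.
have Ereal : conjc ((v *m x *m w) 0 0) = (v *m x *m w) 0 0.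
  rewrite -[in RHS]mulmxA !mxE rmorph_sum/=.
  apply: eq_bigr => i _; rewrite !mxE rmorphM/= conjcK mulrC; congr (_ * _).
  rewrite rmorph_sum/=; apply: eq_bigr => j _.
  by rewrite !mxE rmorphM/= -hx mulrC.
have : Im ((v *m x *m w) 0 0) = 0.
  by move: Ereal; case: ((v *m x *m w) 0 0) => a b /= []; lra.
rewrite E; have NR : N = (Re N)%:C by rewrite RRe_real// gtr0_real.
move/eqP; rewrite NR; case: t t0 {hv E} => a b /= b0.
rewrite mulr0 add0r mulNr oppr_eq0 mulf_eq0 (negbTE b0)/= => /eqP Re0.
by move: N0; rewrite NR Re0 ltxx.
Qed.

Lemma hermsymmxD n (A B : 'M[C]_n) : A \is hermsymmx -> B \is hermsymmx ->
  A + B \is hermsymmx.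
Proof.
move=> /hermsymmxP hA /hermsymmxP hB; apply/hermsymmxP => j k.
by rewrite !mxE rmorphD/= -hA -hB.
Qed.

Lemma hermsymmxZ n (a : R) (A : 'M[C]_n) : A \is hermsymmx ->
  a%:C *: A \is hermsymmx.
Proof.
move=> /hermsymmxP hA; apply/hermsymmxP => j k.
rewrite !mxE hA; case: (A k j) => u v; apply/eqP.
by rewrite eq_complex /=; apply/andP; split; apply/eqP; ring.
Qed.

Lemma hermsymmx_scalar n (a : R) : ((a%:C)%:M : 'M[C]_n) \is hermsymmx.
Proof.
apply/hermsymmxP => j k; rewrite !mxE eq_sym.
by case: eqP => _; rewrite ?mulr1n ?mulr0n /=; apply/eqP; rewrite eq_complex/= oppr0 !eqxx.
Qed.

Lemma hermsymmx_beta n : beta R n \is hermsymmx.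
Proof.
by rewrite betaE -(rmorph_nat (real_complex R) 2); exact: hermsymmx_scalar.
Qed.

Lemma wedge_hyperbolic n :
  hyperbolic (fun A => A \is hermsymmx) (beta R n) n (@wedge R n).
Proof.
split; first exact: wedge_sym_multilinear.
  by rewrite wedge_nseq betaE det_scalar mulr_gt0 ?ltr0n ?fact_gt0// exprn_gt0.
move=> x t hx t0; rewrite wedge_nseq mulf_neq0 ?pnatr_eq0 -?lt0n ?fact_gt0//.
rewrite betaE scale_scalar_mx; apply: det_hermitian_shift => //.
by rewrite mulr_natr raddfMn/= mulrn_eq0.
Qed.

(** Garding's inequality for the form obtained from [wedge] by fixing [n - m] factors equal to
    [beta]. *)
Lemma wedge_m_positive n m (l : seq 'M[C]_n) : (m <= n)%N -> size l = m ->
  (forall A, A \in l -> m_positive m A) ->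
  0 <= Re (wedge (l ++ nseq (n - m) (beta R n))).
Proof.
move=> mn sl hl.
have h : hyperbolic (fun A : 'M[C]_n => A \is hermsymmx) (beta R n)
    ((n - m) + m) (@wedge R n).
  by rewrite subnK//; exact: wedge_hyperbolic.
have hyp := @hyperbolic_cat_nseq R 'M[C]_n _ _ (@hermsymmxD n) (@hermsymmxZ n)
  (hermsymmx_beta n) (n - m) m _ h.
have cat_sym s : size s = m ->
    wedge (nseq (n - m) (beta R n) ++ s) = wedge (s ++ nseq (n - m) (beta R n)).
  move=> ss; apply: wedge_perm; last by rewrite perm_catC.
  by rewrite size_cat size_nseq ss subnK.
rewrite -cat_sym//.
apply: (garding_closed (@hermsymmxD n) (@hermsymmxZ n) (hermsymmx_beta n) hyp sl).
move=> A /hl[hA posA]; split=> // k km.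
rewrite cat_sym ?size_cat ?size_nseq ?subnKC//.
rewrite -catA -nseqD addnC addnBA// subnK//.
(* [m_positive] starts at order 1; order 0 is the positivity of [beta ^ n]. *)
case: k km => [|k] km; last exact: posA.
rewrite subn0 /= wedge_nseq betaE det_scalar.
by rewrite mulr_ge0 ?ler0n ?exprn_ge0.
Qed.

(** The conjugate sits on the row index because the derivative of [|z| ^ 2] in [z_j] is the
    conjugate of [z_j], and that in the conjugate of [z_k] is [z_k]. *)
Definition rank1 n (v : 'I_n -> C) : 'M[C]_n := \matrix_(j, k) (conjc (v j) * v k).

(** Exchanging the first two values of [p] changes its sign but not the product, since
    [P a b * P c d = P c b * P a d] for a matrix of rank one. *)
Lemma wedge_rank1_rank1 n (v : 'I_n -> C) l : (size l).+2 = n ->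
  wedge (rank1 v :: rank1 v :: l) = 0.
Proof.
case: n v l => [//|[//|n]] v l sl.
set P := rank1 v.
suff E : wedge (P :: P :: l) = - wedge (P :: P :: l).
  by apply/eqP; have := E => /eqP; rewrite -subr_eq0 opprK -mulr2n mulrn_eq0.
rewrite {1}/wedge (reindex_inj (mulgI (tperm 0 1))) /= /wedge -sumrN.
apply: eq_bigr => p _; rewrite -sumrN; apply: eq_bigr => q _.
rewrite odd_permM odd_tperm /= signrN !mulNr; congr (- (_ * _)).
rewrite !big_ord_recl/= !mxE !permM tpermL.
have -> : lift ord0 ord0 = 1 :> 'I_n.+2 by apply/val_inj.
rewrite tpermR !mulrA; congr (_ * _); first by ring.
apply: eq_bigr => i _; rewrite permM tpermD//.
Qed.

(** The identity factors force [p] and [q] to agree on all slots but one, hence everywhere. *)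
Lemma wedge_rank1_id n (v : 'I_n -> C) :
  (0 < n)%N -> wedge (rank1 v :: nseq n.-1 1%:M) = n`!%:R / n%:R * \tr (rank1 v).
Proof.
case: n v => // n v _; set P := rank1 v.
have -> : wedge (P :: nseq n.+1.-1 1%:M) = \sum_(p : 'S_n.+1) P (p ord0) (p ord0).
  apply: eq_bigr => p _; rewrite (bigD1 p)//= [X in _ + X]big1 => [|q qp].
    rewrite addr0 -signr_addb addbb mul1r big_ord_recl/= big1 ?mulr1// => i _.
    by rewrite nth_nseq ltn_ord mxE eqxx.
  rewrite big_ord_recl/=.
  have [i hi] : exists i : 'I_n, p (lift ord0 i) != q (lift ord0 i).
    apply/existsP; apply: contraNT qp => /existsPn h.
    have h1 (i : 'I_n) : p (lift ord0 i) = q (lift ord0 i).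
      by apply/eqP; have := h i; rewrite negbK.
    apply/eqP/permP => j; case: (unliftP ord0 j) => [i ->|->]; first by rewrite h1.
    pose k := (p^-1)%g (q ord0); have pk : p k = q ord0 by rewrite permKV.
    case: (unliftP ord0 k) => [i ki|k0]; last by rewrite -pk k0.
    by move: pk; rewrite ki h1 => /perm_inj /eqP; rewrite eq_sym -[_ == _]/(false).
  rewrite (bigD1 i)//= nth_nseq ltn_ord [1%:M _ _]mxE (negbTE hi) mulr0n mul0r !mulr0.
  by [].
(* Every slot contributes the same sum; adding over all slots produces the trace once for each
   permutation. *)
have h i : \sum_(p : 'S_n.+1) P (p ord0) (p ord0) =
           \sum_(p : 'S_n.+1) P (p i) (p i).
  rewrite (reindex_inj (mulgI (tperm ord0 i))) /=.
  by apply: eq_bigr => p _; rewrite !permM tpermL.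
have : n.+1%:R * (\sum_(p : 'S_n.+1) P (p ord0) (p ord0)) = (n.+1)`!%:R * \tr P.
  transitivity (\sum_(i < n.+1) \sum_(p : 'S_n.+1) P (p i) (p i)).
    rewrite -(eq_bigr _ (fun i _ => h i)).
    by rewrite sumr_const card_ord mulr_natl.
  rewrite exchange_big/= -card_Sn -sum1_card natr_sum mulr_suml.
  apply: eq_bigr => p _; rewrite mul1r /mxtrace.
  by rewrite [RHS](reindex_inj (@perm_inj _ p)).
by move=> E; rewrite mulrAC -E mulrC mulKf// pnatr_eq0.
Qed.

Definition coef_prod (l : seq (C * C)) : C := \prod_(p <- l) p.1.
(** Together with [coef_prod], the derivative and the value at [x = 0] of the product of the
    [p.1 + x p.2]. *)
Fixpoint coef_der (l : seq (C * C)) : C :=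
  if l is p :: l' then p.2 * coef_prod l' + p.1 * coef_der l' else 0.

(* Products with two rank one factors vanish, hence the expansion is affine in
   [b] up to first order. *)
Lemma wedge_id_rank1 n (v : 'I_n -> C) (l : seq (C * C)) : size l = n ->
  (0 < n)%N ->
  wedge [seq p.1 *: 1%:M + p.2 *: rank1 v | p <- l] =
  n`!%:R * (coef_prod l + n%:R^-1 * \tr (rank1 v) * coef_der l).
Proof.
move=> sl n0; set P := rank1 v; pose f (p : C * C) := p.1 *: 1%:M + p.2 *: P.
have hM := @wedge_sym_multilinear n.
pose I := 1%:M : 'M[C]_n.
have mid j s A : (j + (size s).+1)%N = n ->
    wedge (nseq j I ++ A :: s) = wedge (A :: nseq j I ++ s).
  move=> sj; apply: wedge_perm; first by rewrite size_cat/= size_nseq.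
  by rewrite -[A :: s]cat1s -[A :: _ ++ _]cat1s perm_catCA.
have hs j s : size (nseq j I ++ map f s) = (j + size s)%N.
  by rewrite size_cat size_nseq size_map.
have f1 p s : (size s).+1 = n ->
    wedge (f p :: s) = p.1 * wedge (I :: s) + p.2 * wedge (P :: s).
  move=> ss; rewrite /f (sym_multilinearD _ _ hM)//.
  by rewrite !(sym_multilinearZ _ _ hM).
(* Once one factor [P] is present, each remaining factor contributes only its identity part. *)
have hP j s : (j + (size s).+1)%N = n ->
    wedge (P :: nseq j I ++ map f s) = coef_prod s * wedge (P :: nseq n.-1 I).
  elim: s j => [|p s IH] j sj.
    have -> : n.-1 = j by rewrite -sj addn1.
    by rewrite /= cats0 /coef_prod big_nil mul1r.
  have -> : wedge (P :: nseq j I ++ map f (p :: s)) =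
            wedge (f p :: P :: nseq j I ++ map f s).
    apply: wedge_perm.
      by rewrite /= size_cat/= size_nseq size_map; move: sj; rewrite /= !addnS.
    apply/seq.permP => b; rewrite /= !count_cat/=.
    by rewrite (addnCA (count b _)) addnCA.
  rewrite f1; last by rewrite /= hs; move: sj; rewrite /= !addnS.
  rewrite [X in _ + X](_ : _ = 0) ?addr0; last first.
    rewrite [X in _ * X](_ : _ = 0) ?mulr0//.
    have [s2|] := eqVneq (size (nseq j I ++ map f s)).+2 n; first exact: wedge_rank1_rank1.
    by rewrite hs; move: sj; rewrite /= !addnS => /eqP ->.
  rewrite /coef_prod big_cons -mulrA; congr (_ * _).
  rewrite -/(coef_prod s) -(IH j.+1) ?addSnnS//.
  apply: wedge_perm; first by rewrite /= hs; move: sj; rewrite /= !addnS.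
  by rewrite -cat1s -[P :: _]cat1s perm_catCA.
(* The [j] leading identities stand for the factors already expanded. *)
have hW s j : (j + size s)%N = n -> wedge (nseq j I ++ map f s) =
    n`!%:R * coef_prod s + wedge (P :: nseq n.-1 I) * coef_der s.
  elim: s j => [|p s IH] j sj.
    rewrite /= cats0 /coef_prod big_nil mulr1 mulr0 addr0.
    have -> : j = n by move: sj; rewrite addn0.
    by rewrite wedge_nseq det1 mulr1.
  rewrite /= mid ?size_map// f1; last by rewrite hs; move: sj; rewrite /= !addnS.
  rewrite hP// -[I :: _]/(nseq j.+1 I ++ _) IH ?addSnnS//.
  rewrite /coef_prod big_cons; ring.
have := hW l 0%N sl; rewrite /= => ->.
rewrite wedge_rank1_id// mulrDr; congr (_ + _).
by rewrite -!mulrA.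
Qed.

End wedge_theory.

(** * Lebesgue measure on row vectors *)

Section lebesgue_rV.
Variable R : realType.
Implicit Types N : nat.

Lemma ball_rVP N (x y : 'rV[R]_N) (e : R) : 0 < e ->
  ball x e y <-> forall i, `|x 0 i - y 0 i| < e.
Proof.
move=> e0; split=> [[_ h] i|h]; first exact: (h 0 i).
by split=> // i j; rewrite ord1; exact: h.
Qed.

Lemma coord_le_norm N (x : 'rV[R]_N) i : `|x 0 i| <= `|x|.
Proof.
rewrite [leRHS]/Num.Def.normr /= mx_normrE; apply/bigmax_geP; right => /=.
by exists (0, i).
Qed.

Lemma measurable_preimage_tnth N (i : 'I_N) (A : set R) :
  measurable (A : set (measurableTypeR R)) ->
  measurable [set t : N.-tuple (measurableTypeR R) | A (tnth t i)].
Proof. by move=> mA; rewrite -[X in measurable X]setTI; exact: measurable_tnth. Qed.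

Lemma measurable_preimage_ball N (c : 'rV[R]_N) (e : R) :
  measurable (@row_of_tuple R N @^-1` ball c e).
Proof.
have [e0|e0] := ltP 0 e; last first.
  rewrite (_ : _ @^-1` _ = set0)//; apply/seteqP; split=> // t /= -[].
  by rewrite ltNge e0.
rewrite (_ : _ @^-1` _ = \bigcap_(i in [set: 'I_N])
    [set t | (ball (c 0 i) e : set R) (tnth t i)]); last first.
  apply/seteqP; split=> t /=.
    by move=> /(ball_rVP _ _ e0) h i _ /=; have := h i; rewrite mxE.
  by move=> h; apply/(ball_rVP _ _ e0) => i; have := h i I; rewrite /= mxE.
apply: fin_bigcap_measurable => // i _; apply: measurable_preimage_tnth.
exact: measurable_ball.
Qed.

(** The measurable sets of tuples come from the coordinates, so an open set is written as a
    countable union of balls with rational centre and radius, enumerated through [pickle]. *)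
Lemma measurable_preimage_open N (U : set 'rV[R]_N) : open U ->
  measurable (@row_of_tuple R N @^-1` U).
Proof.
move=> oU.
pose B (cq : 'rV[rat]_N * rat) := ball (map_mx ratr cq.1 : 'rV[R]_N) (ratr cq.2).
pose F k : set 'rV[R]_N := if @choice.unpickle ('rV[rat]_N * rat)%type k is Some cq then
  if `[< B cq `<=` U >] then B cq else set0 else set0.
suff -> : U = \bigcup_k F k.
  rewrite preimage_bigcup; apply: bigcup_measurable => k _; rewrite /F.
  case: choice.unpickle => [cq|]; last by rewrite preimage_set0.
  case: asboolP => _; last by rewrite preimage_set0.
  exact: measurable_preimage_ball.
apply/seteqP; split=> [x Ux|x [k _]]; last first.
  by rewrite /F; case: choice.unpickle => // cq; case: asboolP => // /[apply].
have /nbhs_ballP[e /= e0 eU] : nbhs x U by exact: open_nbhs_nbhs.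
(* A ball of radius [q] whose rational centre is within [q] of [x] contains [x] and stays within
   [2 q < e] of it. *)
have [q qP] : exists q : rat, 0 < (ratr q : R) < e / 2.
  have /rat_in_itvoo[q] : 0 < e / 2 by rewrite divr_gt0.
  by rewrite in_itv/= => h; exists q.
have /andP[q0 qe] := qP.
have /choice[c hc] : forall i, exists c : rat, `|x 0 i - ratr c| < ratr q :> R.
  move=> i; have /rat_in_itvoo[c] : x 0 i < x 0 i + ratr q by rewrite ltrDl.
  rewrite in_itv/= => /andP[h1 h2]; exists c.
  by rewrite distrC gtr0_norm ?subr_gt0// ltrBlDl.
pose cq := (\row_i c i, q).
have Bx : B cq x.
  by apply/ball_rVP => // i; rewrite !mxE distrC; exact: hc.
exists (choice.pickle cq) => //; rewrite /F choice.pickleK; case: asboolP => //.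
case=> y /(ball_rVP _ _ q0) By; apply: eU; apply/ball_rVP => // i.
have /(ball_rVP _ _ q0) Bxi := Bx.
have := By i; have := Bxi i; move: (map_mx _ _ _ _) => a h1 h2.
have -> : x 0 i - y 0 i = (a - y 0 i) - (a - x 0 i) by ring.
rewrite (le_lt_trans (ler_normB _ _))//.
by move: h1 h2 qe; lra.
Qed.

Lemma measurable_continuous_on N (D : set 'rV[R]_N) (f : 'rV[R]_N -> R) :
  open D -> (forall x, D x -> {for x, continuous f}) ->
  measurable_fun (@row_of_tuple R N @^-1` D) (f \o @row_of_tuple R N).
Proof.
move=> oD cf mD; apply: (measurability _ (RGenOInfty.measurableE R)); last exact: mD.
move=> /= _ [_ [a ->] <-].
rewrite -[X in measurable X]/(@row_of_tuple R N @^-1` (D `&` f @^-1` [set` `]a, +oo[])).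
apply: measurable_preimage_open.
rewrite openE => x [Dx /= fx]; rewrite in_itv/= andbT in fx.
apply: filterI; first exact: open_nbhs_nbhs.
have : nbhs (f x) [set` `]a, +oo[].
  by apply: open_nbhs_nbhs; split; [exact: interval_open|rewrite /= in_itv/= fx].
by move=> /(cf _ Dx).
Qed.

Lemma measurable_continuous N (f : 'rV[R]_N -> R) : continuous f ->
  measurable_fun setT (f \o @row_of_tuple R N).
Proof.
move=> cf; rewrite -(preimage_setT (@row_of_tuple R N)).
by apply: measurable_continuous_on => // *; [exact: openT|exact: cf].
Qed.

Definition cube N (c : 'rV[R]_N) (r : R) : set (N.-tuple (measurableTypeR R)) :=
  [set t | forall i, (`[c 0 i - r, c 0 i + r]%classic : set R) (tnth t i)].

Lemma measurable_cube N c r : measurable (@cube N c r).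
Proof.
rewrite (_ : cube c r = \bigcap_(i in [set: 'I_N])
    [set t | (`[c 0 i - r, c 0 i + r]%classic : set R) (tnth t i)]); last first.
  by apply/seteqP; split=> t h i; [move=> _; exact: h|exact: (h i I)].
by apply: fin_bigcap_measurable => // i _; exact: measurable_preimage_tnth.
Qed.

Lemma lebesgue_cube N (c : 'rV[R]_N) r : 0 <= r ->
  lebesgue_tuple R N (cube c r) = ((2 * r) ^+ N)%:E.
Proof.
move=> r0; rewrite /cube (@lebesgue_tuple_box R N (fun i => `[c 0 i - r, c 0 i + r]%classic))//.
rewrite (eq_bigr (fun=> (2 * r)%:E)).
  by rewrite prodEFin prodr_const card_ord.
move=> i _; rewrite lebesgue_measure_itv/= lte_fin -EFinB.
have -> : c 0 i + r - (c 0 i - r) = 2 * r by ring.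
case: ifPn => //; rewrite -leNgt => h; congr (_%:E); move: h r0; lra.
Qed.

Lemma cubeP N (c : 'rV[R]_N) r t :
  cube c r t <-> forall i, `|row_of_tuple t 0 i - c 0 i| <= r.
Proof.
split=> h i; have := h i; rewrite /= in_itv/= mxE ler_distl//.
Qed.

Lemma le_norm_cube N (r : R) t : 0 <= r -> `|row_of_tuple t| <= r -> @cube N 0 r t.
Proof.
move=> r0 h; apply/cubeP => i; rewrite [X in _ - X]mxE subr0.
exact: le_trans (coord_le_norm _ _) h.
Qed.

Definition compact_supp N (f : 'rV[R]_N -> R) :=
  exists2 r : R, 0 < r & forall x, r < `|x| -> f x = 0.

Lemma bounded_cube N (f : 'rV[R]_N -> R) (r : R) : continuous f ->
  exists2 M : R, 0 <= M & forall x, `|x| <= r -> `|f x| <= M.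
Proof.
move=> cf; have cK : compact [set x : 'rV[R]_N | `|x| <= r].
  apply: bounded_closed_compact.
    by exists r; split; [exact: num_real|move=> M rM x /= /le_trans; apply; exact: ltW].
  rewrite (_ : [set _ | _] = (fun x : 'rV[R]_N => `|x|) @^-1` [set y | y <= r])//.
  by apply: preimage_closed; [move=> x _; exact: norm_continuous|exact: closed_le].
have : compact (f @` [set x : 'rV[R]_N | `|x| <= r]).
  by apply: continuous_compact => //; exact: continuous_subspaceT.
move=> /compact_bounded[M [Mr hM]]; exists (`|M| + 1); first by rewrite addr_ge0.
by move=> x xr; apply: hM; [rewrite ltr_pwDr// ler_norm|exists x].
Qed.

Lemma integrable_compact_supp N (f : 'rV[R]_N -> R) :
  continuous f -> compact_supp f ->
  (lebesgue_tuple R N).-integrable setT (EFin \o (f \o @row_of_tuple R N)).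
Proof.
move=> cf [r r0 hr]; have [M M0 hM] := bounded_cube r cf.
have -> : EFin \o (f \o @row_of_tuple R N) = (EFin \o (f \o @row_of_tuple R N)) \_ (cube 0 r).
  apply/funext => t; rewrite patchE; case: ifPn => // /negP h /=.
  rewrite hr// ltNge; apply/negP => h2; apply: h; apply/mem_set.
  exact: (le_norm_cube (ltW r0)).
have mC : measurable (@cube N 0 r) := measurable_cube 0 r.
apply: (integrable_mkcond _ mC).1.
apply: (@measurable_bounded_integrable _ _ _ (lebesgue_tuple R N) (f \o @row_of_tuple R N) (cube 0 r) mC).
- have h := @lebesgue_cube N 0 r (ltW r0).
  by apply: (@eq_ind_r _ _ (fun x => (x < +oo)%E) _ _ h); exact: ltry.
- by apply: measurable_funTS; exact: measurable_continuous.
- exists M; split; first exact: num_real.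
  move=> M' MM' t /cubeP ht /=; apply: le_trans (ltW MM'); apply: hM.
  rewrite [leLHS]/Num.Def.normr /= mx_normrE; apply: bigmax_le; first exact: ltW.
  by move=> [i j] _ /=; rewrite ord1; have := ht j; rewrite !mxE subr0.
Qed.

(** The two difference quotients coincide, so derivatives pass to affine slices with no
    differentiability assumption. *)
Lemma derive_affine (U V : normedModType R) (L : U -> V) (f : V -> R) u v x :
  (forall h : R, L (h *: u + x) = h *: v + L x) ->
  (derivable (f \o L) x u <-> derivable f (L x) v) /\
  'D_u (f \o L) x = 'D_v f (L x).
Proof.
move=> hL; rewrite /derivable /derive /=.
under eq_fun do rewrite hL.
by [].
Qed.

Definition consr N (x : R) (y : 'rV[R]_N) : 'rV[R]_N.+1 :=
  \row_i (if unlift ord0 i is Some j then y 0 j else x).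

Lemma row_of_tuple_cons N x (t : N.-tuple (measurableTypeR R)) :
  row_of_tuple (cons_pair (x, t)) = consr x (row_of_tuple t).
Proof.
apply/rowP => i; rewrite !mxE; case: unliftP => [j|] ->; last by [].
by rewrite mxE /cons_pair tnthS.
Qed.

Lemma consr0 N x (y : 'rV[R]_N) : consr x y 0 ord0 = x.
Proof. by rewrite mxE unlift_none. Qed.

Lemma consrS N x (y : 'rV[R]_N) j : consr x y 0 (lift ord0 j) = y 0 j.
Proof. by rewrite mxE liftK. Qed.

Lemma consr_affine0 N (y : 'rV[R]_N) (x h : R) :
  consr (h *: (1 : R) + x) y = h *: delta_mx 0 ord0 + consr x y.
Proof.
apply/rowP => i; rewrite !mxE; case: unliftP => [j|] ->.
  by rewrite eqxx -[lift _ _ == _](eq_sym) (negbTE (neq_lift _ _)) andbF mulr0 add0r.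
by rewrite !eqxx.
Qed.

Lemma consr_affineS N (j : 'I_N) (x : R) (y : 'rV[R]_N) (h : R) :
  consr x (h *: delta_mx 0 j + y) = h *: delta_mx 0 (lift ord0 j) + consr x y.
Proof.
apply/rowP => i; rewrite !mxE; case: unliftP => [k|] ->; rewrite ?mxE.
  by rewrite (inj_eq (@lift_inj _ ord0)).
by rewrite (negbTE (neq_lift _ _)) andbF mulr0 add0r.
Qed.

Lemma continuous_consrl N (y : 'rV[R]_N) : continuous (fun x => consr x y).
Proof.
move=> x A /nbhs_ballP[e /= e0 eA].
apply: (@filterS _ (nbhs (x : R^o)) _ [set z | `|x - z| < e]); last by exists e.
move=> z h; apply: eA; apply/ball_rVP => // i; rewrite !mxE.
by case: unliftP => [k|] _ //; rewrite subrr normr0.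
Qed.

Lemma continuous_consrr N (x : R) : continuous (@consr N x).
Proof.
move=> y A /nbhs_ballP[e /= e0 eA].
apply: filterS (nbhsx_ballx y e e0) => z /(ball_rVP _ _ e0) h; apply: eA.
apply/ball_rVP => // i; rewrite !mxE; case: unliftP => [k|] _; first exact: h.
by rewrite subrr normr0.
Qed.

Lemma integral_lebesgue_cons N (f : 'rV[R]_N.+1 -> R) :
  continuous f -> compact_supp f ->
  (lebesgue_measure \x lebesgue_tuple R N)%E.-integrable setT
    (fun p => (f (consr p.1 (row_of_tuple p.2)))%:E) /\
  (\int[lebesgue_tuple R N.+1]_t (f (row_of_tuple t))%:E =
  \int[lebesgue_measure \x lebesgue_tuple R N]_p
    (f (consr p.1 (row_of_tuple p.2)))%:E)%E.
Proof.
move=> cf sf; have intf := integrable_compact_supp cf sf.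
have E : (fun p : measurableTypeR R * N.-tuple (measurableTypeR R) =>
    (f (consr p.1 (row_of_tuple p.2)))%:E) =
    (EFin \o (f \o @row_of_tuple R N.+1)) \o (@cons_pair R N).
  by apply/funext => -[x t] /=; rewrite row_of_tuple_cons.
have /measurable_EFinP mf := measurable_continuous cf.
have intc : (lebesgue_measure \x lebesgue_tuple R N)%E.-integrable setT
    ((EFin \o (f \o @row_of_tuple R N.+1)) \o (@cons_pair R N)).
  apply/integrableP; split.
    exact: (measurableT_comp mf (@measurable_cons_pair R N)).
  case/integrableP: intf => _; rewrite [lebesgue_tuple _ _]/= /lebesgue_step.
  rewrite ge0_integral_pushforward//; first exact: measurable_cons_pair.
  exact: measurableT_comp.
rewrite E; split=> //.
rewrite /= /lebesgue_step integral_pushforward//; exact: measurable_cons_pair.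
Qed.

Lemma integral_derive1_compact_supp (f df : R -> R) (r : R) : 0 < r ->
  continuous df -> (forall x : R, is_derive x 1 f (df x)) ->
  (forall x : R, r < `|x| -> f x = 0) ->
  (\int[lebesgue_measure]_x (df x)%:E = 0)%E.
Proof.
move=> r0 cdf hf f0.
have df0 x : r < `|x| -> df x = 0.
  move=> rx; have [_ <-] := hf x; rewrite (near_eq_derive (g := cst 0)) ?derive_cst//.
  near=> z; apply: f0; near: z.
  have : open [set z : R | r < `|z|].
    rewrite (_ : [set _ | _] = Num.norm @^-1` [set y | r < y])//.
    by apply: open_comp; [move=> y _; exact: norm_continuous|exact: open_gt].
  by move=> oU; apply: (open_nbhs_nbhs (A := [set z : R | r < `|z|])); split.
have cf x : {for x, continuous f}.
  have [d _] := hf x.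
  exact/differentiable_continuous/derivable1_diffP.
(* Strictly beyond [r], so that [f] vanishes at both endpoints. *)
pose a := r + 1.
transitivity (\int[lebesgue_measure]_(x in `[(- a)%R, a%R]) (df x)%:E)%E.
  rewrite [RHS]integral_mkcond; apply: eq_integral => x _.
  rewrite patchE; case: ifPn => // /negP h; rewrite df0// ltNge; apply/negP => h2.
  apply: h; rewrite inE/= in_itv/=.
  by rewrite -ler_norml (le_trans h2)// /a lerDl.
rewrite (@continuous_FTC2 _ df f).
- by rewrite !f0 ?subee//= ?normrN ger0_norm ?/a; move: r0; lra.
- by rewrite /a; move: r0; lra.
- exact: continuous_subspaceT.
- split.
  + by move=> x _; have [] := hf x.
  + exact/cvg_at_right_filter/cf.
  + exact/cvg_at_left_filter/cf.
- by move=> x _; rewrite derive1E; have [] := hf x.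
Unshelve. all: by end_near. Qed.

(** By Fubini the first coordinate is split off. If it is the one differentiated, the inner integral
    vanishes by the fundamental theorem of calculus; otherwise the induction hypothesis applies on
    each slice. *)
Lemma integral_partial N (i : 'I_N) (f : 'rV[R]_N -> R) :
  (forall x, derivable f x (delta_mx 0 i)) -> compact_supp f ->
  continuous (fun x => 'D_(delta_mx 0 i) f x) ->
  compact_supp (fun x => 'D_(delta_mx 0 i) f x) ->
  (\int[lebesgue_tuple R N]_t ('D_(delta_mx 0 i) f (row_of_tuple t))%:E = 0)%E.
Proof.
elim: N i f => [[]//|N IH] i f df [r r0 fr] cdf sdf.
have [intp ->] := integral_lebesgue_cons cdf sdf.
have norm_consr x (y : 'rV[R]_N) : `|x| <= `|consr x y| /\ `|y| <= `|consr x y|.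
  split; first by have := coord_le_norm (consr x y) ord0; rewrite consr0.
  rewrite [leLHS]/Num.Def.normr /= mx_normrE; apply: bigmax_le => // -[k j] _ /=.
  by rewrite ord1 -(consrS x y j); exact: coord_le_norm.
case: (unliftP ord0 i) df cdf sdf intp => [j|] -> df cdf sdf intp.
- rewrite -integral12_prod_meas1//=; apply: integral0_eq => x _.
  rewrite /fubini_F /=.
  have E (y : 'rV[R]_N) := @derive_affine _ _ (consr x) f _ _ y (consr_affineS j x y).
  have Ed : (fun y : 'rV[R]_N => 'D_(delta_mx 0 (lift ord0 j)) f (consr x y)) =
      (fun y => 'D_(delta_mx 0 j) (f \o consr x) y).
    by apply/funext => y; rewrite (E y).2.
  under eq_integral do rewrite -(E _).2.
  apply: (IH j (f \o consr x)).
  + by move=> y; apply/(E y).1.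
  + exists r => // y ry /=; apply: fr; apply: lt_le_trans ry _.
    exact: (norm_consr x y).2.
  + rewrite -Ed => y.
    by move=> A /cdf /(@continuous_consrr _ x y).
  + rewrite -Ed; case: sdf => s s0 hs; exists s => // y sy; apply: hs.
    exact: lt_le_trans sy (norm_consr x y).2.
- rewrite -integral21_prod_meas1//=; apply: integral0_eq => t _.
  rewrite /fubini_G /=; set y := row_of_tuple t.
  have E (x : R) := @derive_affine _ _ (fun x => consr x y) f _ _ x (consr_affine0 y x).
  apply: (@integral_derive1_compact_supp (f \o (fun x => consr x y)) _ r r0).
  + by move=> x A /cdf /(@continuous_consrl _ y x).
  + move=> x; apply: DeriveDef; first exact/(E x).1.
    by rewrite (E x).2.
  + move=> x rx /=; apply: fr; apply: lt_le_trans rx _.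
    exact: (norm_consr x y).1.
Qed.

End lebesgue_rV.

(** * Integration by parts *)

Section green.
Variable R : realType.
Implicit Types N : nat.

Definition C1_on N (D : set 'rV[R]_N) (f : 'rV[R]_N -> R) :=
  forall x, D x -> {for x, continuous f} /\ forall i : 'I_N,
    derivable f x (delta_mx 0 i) /\
    {for x, continuous (fun y => 'D_(delta_mx 0 i) f y)}.

Lemma class_C_C1 N k (D : set 'rV[R]_N) f : class_C k.+1 D f -> C1_on D f.
Proof.
move=> h x Dx; have [h1 h2] := h [::] x Dx; split; first exact: h1.
by move=> i; split; [exact: h2|exact: (h [:: i] x Dx).1].
Qed.

Lemma class_C_partial_C1 N (D : set 'rV[R]_N) f j : class_C 2 D f ->
  C1_on D (fun x => 'D_(delta_mx 0 j) f x).
Proof.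
move=> h x Dx; split; first exact: (h [:: j] x Dx).1.
move=> i; split; first exact: (h [:: j] x Dx).2.
exact: (h [:: i; j] x Dx).1.
Qed.

(** With [S] closed inside [D], a product with such an [f] is globally regular although the other
    factor is regular only on [D]. *)
Definition vanish_off N (S : set 'rV[R]_N) (f : 'rV[R]_N -> R) :=
  forall x, ~ S x -> f x = 0.

Lemma vanish_off_near N (S : set 'rV[R]_N) f x : closed S -> vanish_off S f ->
  ~ S x -> \forall y \near x, 0 = f y.
Proof.
move=> cS fS Sx; have : nbhs x (~` S).
  by apply: open_nbhs_nbhs; split=> //; exact: closed_openC.
by apply: filterS => y /fS ->.
Qed.

Lemma vanish_off_derive N (S : set 'rV[R]_N) f v : closed S -> vanish_off S f ->
  vanish_off S (fun x => 'D_v f x).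
Proof.
move=> cS fS x Sx; rewrite -(near_eq_derive (f := cst 0)) ?derive_cst//.
exact: vanish_off_near Sx.
Qed.

Lemma continuous_vanish_off N (D S : set 'rV[R]_N) f : closed S -> S `<=` D ->
  vanish_off S f -> (forall x, D x -> {for x, continuous f}) -> continuous f.
Proof.
move=> cS SD fS cf x; have [Dx|Dx] := pselect (D x); first exact: cf.
have Sx : ~ S x by move=> /SD.
apply: (near_cst_continuous (0 : R)).
by apply: filterS (vanish_off_near cS fS Sx) => y <-.
Qed.

Lemma compact_supp_vanish_off N (S : set 'rV[R]_N) f : compact S ->
  vanish_off S f -> compact_supp f.
Proof.
move=> /compact_bounded[M [Mr hM]] fS; exists (`|M| + 1).
  by rewrite ltr_wpDl.
move=> x hx; apply: fS => Sx; move: hx; rewrite ltNge => /negP; apply.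
by apply: hM => //; rewrite ltr_pwDr// ler_norm.
Qed.

Lemma vanish_offM N (S : set 'rV[R]_N) (w : 'rV[R]_N -> R) f : vanish_off S f ->
  vanish_off S (fun x => w x * f x).
Proof. by move=> fS x Sx; rewrite fS// mulr0. Qed.

Lemma continuousM_vanish_off N (D S : set 'rV[R]_N) (w f : 'rV[R]_N -> R) :
  closed S -> S `<=` D -> vanish_off S f ->
  (forall x, D x -> {for x, continuous w}) ->
  (forall x, D x -> {for x, continuous f}) -> continuous (fun x => w x * f x).
Proof.
move=> cS SD fS cw cf; apply: (continuous_vanish_off cS SD).
  exact: vanish_offM.
by move=> x Dx; apply: (@continuousM R _ w f x); [exact: cw|exact: cf].
Qed.

Lemma integral_partialM N (D S : set 'rV[R]_N) (w f : 'rV[R]_N -> R) (i : 'I_N) :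
  compact S -> closed S -> S `<=` D -> vanish_off S f -> C1_on D w -> C1_on D f ->
  (\int[lebesgue_tuple R N]_t (w (row_of_tuple t) * 'D_(delta_mx 0 i) f (row_of_tuple t)
    + 'D_(delta_mx 0 i) w (row_of_tuple t) * f (row_of_tuple t))%:E = 0)%E.
Proof.
move=> kS cS SD fS w1 f1.
have dS := vanish_off_derive (delta_mx 0 i) cS fS.
have D1 x : is_derive x (delta_mx 0 i) (fun x => w x * f x)
    (w x * 'D_(delta_mx 0 i) f x + 'D_(delta_mx 0 i) w x * f x).
  have [Dx|Dx] := pselect (D x).
    have [_ /(_ i)[dw _]] := w1 x Dx; have [_ /(_ i)[df _]] := f1 x Dx.
    apply: DeriveDef; first exact: (derivableM dw df).
    by rewrite (deriveM dw df) [X in _ + X]mulrC.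
  have Sx : ~ S x by move=> /SD.
  rewrite fS// dS// !mulr0 addr0.
  apply: near_eq_is_derive (is_derive_cst (0 : R) x (delta_mx 0 i)).
  have h := vanish_off_near cS (vanish_offM w fS) Sx.
  by apply: filterS h => y <-.
have E : (fun x => w x * 'D_(delta_mx 0 i) f x + 'D_(delta_mx 0 i) w x * f x) =
    (fun x => 'D_(delta_mx 0 i) (fun x => w x * f x) x).
  by apply/funext => x; have [_ ->] := D1 x.
under eq_integral => t _ do rewrite [X in X%:E](congr1 (@^~ (row_of_tuple t)) E).
apply: integral_partial.
- by move=> x; have [] := D1 x.
- exact: compact_supp_vanish_off kS (vanish_offM w fS).
- rewrite -E => x; apply: (@continuousD R R _ (fun x => w x * 'D_(delta_mx 0 i) f x)
    (fun x => 'D_(delta_mx 0 i) w x * f x) x).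
    apply: (continuousM_vanish_off cS SD dS) => y Dy; first by have [] := w1 y Dy.
    by have [_ /(_ i)[]] := f1 y Dy.
  apply: (continuousM_vanish_off cS SD fS) => y Dy; last by have [] := f1 y Dy.
  by have [_ /(_ i)[]] := w1 y Dy.
- rewrite -E; apply: compact_supp_vanish_off kS _ => x Sx.
  by rewrite fS// dS// !mulr0 addr0.
Qed.

(** Continuity and compact support are bundled in, since they give the integrability that linear
    combinations need. *)
Definition null_integral N (f : 'rV[R]_N -> R) :=
  [/\ continuous f, compact_supp f &
   (\int[lebesgue_tuple R N]_t (f (row_of_tuple t))%:E = 0)%E].

Lemma null_integral0 N : null_integral (fun _ : 'rV[R]_N => 0).
Proof.
split; first by move=> x; exact: cst_continuous.
  by exists 1.
by rewrite integral0.
Qed.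

Lemma null_integralZD N (a : R) (f g : 'rV[R]_N -> R) :
  null_integral f -> null_integral g -> null_integral (fun x => a * f x + g x).
Proof.
move=> [cf sf f0] [cg sg g0].
have intf := integrable_compact_supp cf sf.
have intg := integrable_compact_supp cg sg.
split.
- move=> x; apply: (@continuousD R R _ (fun x => a * f x) g x); last exact: cg.
  by apply: (@continuousM R _ (fun=> a) f x); [exact: cst_continuous|exact: cf].
- have [r r0 hr] := sf; have [s s0 hs] := sg; exists (Num.max r s).
    by rewrite lt_max r0.
  by move=> x; rewrite gt_max => /andP[rx sx]; rewrite hr// hs// mulr0 addr0.
- under eq_integral do rewrite EFinD EFinM.
  rewrite integralD//=.
    by rewrite integralZl// f0 mule0 add0e.
  exact: (integrableZl measurableT a intf).
Qed.

Lemma null_integral_sum N (I : Type) (r : seq I) (a : I -> R)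
    (f : I -> 'rV[R]_N -> R) : (forall i, null_integral (f i)) ->
  null_integral (fun x => \sum_(i <- r) a i * f i x).
Proof.
move=> h; elim: r => [|i r IH].
  rewrite (_ : (fun _ => _) = (fun=> 0)); first exact: null_integral0.
  by apply/funext => x; rewrite big_nil.
rewrite (_ : (fun _ => _) = (fun x => a i * f i x + \sum_(i <- r) a i * f i x)).
  exact: null_integralZD.
by apply/funext => x; rewrite big_cons.
Qed.

(** By [wedge_diffop], wedging [ddc f] with constant forms gives an operator of this kind. *)
Definition diffop N (c : 'I_N -> 'I_N -> R) (f : 'rV[R]_N -> R) (x : 'rV[R]_N) : R :=
  \sum_i \sum_j c i j * partials [:: i; j] f x.

Lemma continuous_sumr N (I : Type) (r : seq I) (f : I -> 'rV[R]_N -> R) x :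
  (forall i, {for x, continuous (f i)}) ->
  {for x, continuous (fun y => \sum_(i <- r) f i y)}.
Proof.
move=> cf; elim: r => [|i r IH].
  rewrite (_ : (fun _ => _) = (fun=> 0)); first exact: cst_continuous.
  by apply/funext => y; rewrite big_nil.
rewrite (_ : (fun _ => _) = (fun y => f i y + \sum_(i <- r) f i y)).
  by apply: (@continuousD R R _ (f i) (fun y => \sum_(i <- r) f i y) x); first exact: cf.
by apply/funext => y; rewrite big_cons.
Qed.

Lemma diffop_continuous N c (D : set 'rV[R]_N) f x : class_C 2 D f -> D x ->
  {for x, continuous (diffop c f)}.
Proof.
move=> Cf Dx; apply: continuous_sumr => i; apply: continuous_sumr => j.
apply: (@continuousM R _ (fun=> c i j) (partials [:: i; j] f) x).
  exact: cst_continuous.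
exact: (Cf [:: i; j] x Dx).1.
Qed.

(** Two integrations by parts reverse the order of the partial derivatives; the explicit Hessians of
    radial functions supply this symmetry. *)
Definition sym_hess N (D : set 'rV[R]_N) (f : 'rV[R]_N -> R) :=
  forall x i j, D x -> partials [:: i; j] f x = partials [:: j; i] f x.

(** The integrand is the difference of the [i]-th derivative of [w D_j phi] and the [j]-th
    derivative of [phi D_i w]; the mixed first-order terms cancel. *)
Lemma null_integral_green2 N (D : set 'rV[R]_N) (w phi : 'rV[R]_N -> R) i j :
  class_C 2 D w -> test_function D phi ->
  null_integral (fun x => w x * partials [:: i; j] phi x
                        - phi x * partials [:: j; i] w x).
Proof.
move=> Cw [Cphi kS SD _]; set S := closure _ in kS SD.
have cS : closed S by exact: closed_closure.
have pS : vanish_off S phi.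
  move=> x Sx; apply/eqP/negPn/negP => h; apply: Sx.
  by apply: subset_closure.
have C2phi : class_C 2 D phi by move=> s x _; exact: Cphi.
have w1 := class_C_C1 Cw; have p1 := class_C_C1 C2phi.
have wi1 := class_C_partial_C1 i Cw; have pj1 := class_C_partial_C1 j C2phi.
have pjS := vanish_off_derive (delta_mx 0 j) cS pS.
have h1 := integral_partialM i kS cS SD pjS w1 pj1.
have h2 := integral_partialM j kS cS SD pS wi1 p1.
have dS (f : 'rV[R]_N -> R) k : vanish_off S f -> vanish_off S (fun x => 'D_(delta_mx 0 k) f x).
  exact: vanish_off_derive.
set f1 := (fun x => w x * 'D_(delta_mx 0 i) (fun x => 'D_(delta_mx 0 j) phi x) x
    + 'D_(delta_mx 0 i) w x * 'D_(delta_mx 0 j) phi x).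
set f2 := (fun x => 'D_(delta_mx 0 i) w x * 'D_(delta_mx 0 j) phi x
    + 'D_(delta_mx 0 j) (fun x => 'D_(delta_mx 0 i) w x) x * phi x).
have cont (g k : 'rV[R]_N -> R) : vanish_off S k ->
    (forall x, D x -> {for x, continuous g}) ->
    (forall x, D x -> {for x, continuous k}) -> continuous (fun x => g x * k x).
  by move=> kS' cg ck; exact: (continuousM_vanish_off cS SD kS').
have contD (g k : 'rV[R]_N -> R) : continuous g -> continuous k ->
    continuous (fun x => g x + k x).
  by move=> cg ck x; exact: (@continuousD R R _ g k x (cg x) (ck x)).
have n1 : null_integral f1.
  split=> //; last first.
    by apply: compact_supp_vanish_off kS _ => x Sx; rewrite /f1 (dS _ i pjS)// pjS// !mulr0 addr0.
  apply: contD.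
    apply: (cont w _ (dS _ i pjS)) => y Dy; first by have [] := w1 y Dy.
    by have [_ /(_ i)[]] := pj1 y Dy.
  apply: (cont _ _ pjS) => y Dy; first by have [_ /(_ i)[]] := w1 y Dy.
  by have [] := pj1 y Dy.
have n2 : null_integral f2.
  split=> //; last first.
    by apply: compact_supp_vanish_off kS _ => x Sx; rewrite /f2 pjS// pS// !mulr0 addr0.
  apply: contD.
    apply: (cont _ _ pjS) => y Dy; first by have [_ /(_ i)[]] := w1 y Dy.
    by have [] := pj1 y Dy.
  apply: (cont _ _ pS) => y Dy; first by have [_ /(_ j)[]] := wi1 y Dy.
  by have [] := p1 y Dy.
have -> : (fun x => w x * partials [:: i; j] phi x - phi x * partials [:: j; i] w x) =
    (fun x => (-1) * f2 x + f1 x).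
  apply/funext => x; rewrite /f1 /f2 /=.
  set a := 'D_ _ w x; set b := 'D_ _ phi x; set c := phi x; set d := w x.
  ring.
exact: null_integralZD.
Qed.

End green.

(** * Weak positivity *)

Section weak_positivity.
Variable R : realType.
Implicit Types N : nat.

Lemma lintegral_vanish_off N (D : set 'rV[R]_N) (f : 'rV[R]_N -> R) :
  vanish_off D f -> lintegral D (EFin \o f) =
  (\int[lebesgue_tuple R N]_t (f (row_of_tuple t))%:E)%E.
Proof.
move=> fD; rewrite /lintegral integral_mkcond; apply: eq_integral => t _.
rewrite patchE; case: ifPn => // /negP h /=; rewrite fD// => Dt; apply: h.
exact/mem_set.
Qed.

Lemma test_function_supp N (D : set 'rV[R]_N) phi : test_function D phi ->
  exists S : set 'rV[R]_N, [/\ compact S, closed S, S `<=` D & vanish_off S phi].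
Proof.
move=> [_ kS SD _]; exists (closure [set x | phi x != 0]); split=> //.
  exact: closed_closure.
move=> x Sx; apply/eqP/negPn/negP => h; apply: Sx.
by apply: subset_closure.
Qed.

Lemma vanish_off_diffop N (S : set 'rV[R]_N) c f : closed S -> vanish_off S f ->
  vanish_off S (diffop c f).
Proof.
move=> cS fS x Sx; rewrite /diffop big1// => i _; rewrite big1// => j _.
have h1 := vanish_off_derive (delta_mx 0 j) cS fS.
have h2 := vanish_off_derive (delta_mx 0 i) cS h1.
by rewrite /= h2// mulr0.
Qed.

(** Formal self-adjointness of a constant-coefficient operator without lower-order terms. The
    regularity of the new integrand is returned as well, for the strict inequality below. *)
Lemma lintegral_diffop N (D : set 'rV[R]_N) (c : 'I_N -> 'I_N -> R)
    (w phi : 'rV[R]_N -> R) :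
  class_C 2 D w -> sym_hess D w -> test_function D phi ->
  lintegral D (fun z => ((w z)%:E * (diffop c phi z)%:E)%E) =
    (\int[lebesgue_tuple R N]_t
      (phi (row_of_tuple t) * diffop c w (row_of_tuple t))%:E)%E /\
  continuous (fun x => phi x * diffop c w x) /\
  compact_supp (fun x => phi x * diffop c w x).
Proof.
move=> Cw sw tphi; have [S [kS cS SD pS]] := test_function_supp tphi.
have [Cphi _ _ _] := tphi.
have C2phi : class_C 2 setT phi by exact: Cphi.
pose f1 x := w x * diffop c phi x; pose f2 x := diffop c w x * phi x.
have f2E : (fun x => phi x * diffop c w x) = f2.
  by apply/funext => x; rewrite mulrC.
have f1S : vanish_off S f1 by apply: vanish_offM; exact: vanish_off_diffop.
have f2S : vanish_off S f2 by exact: vanish_offM.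
have cf1 : continuous f1.
  apply: (continuousM_vanish_off cS SD (vanish_off_diffop c cS pS)) => x Dx.
    exact: (Cw [::] x Dx).1.
  exact: diffop_continuous C2phi I.
have cf2 : continuous f2.
  apply: (continuousM_vanish_off cS SD pS) => x Dx.
    exact: diffop_continuous Cw Dx.
  exact: (C2phi [::] x I).1.
have sf1 := compact_supp_vanish_off kS f1S.
have sf2 := compact_supp_vanish_off kS f2S.
rewrite f2E; split; last by split.
rewrite -[X in lintegral D X]/(EFin \o f1) lintegral_vanish_off; last first.
  by move=> x Dx; apply: f1S => /SD.
pose n := (fun x => \sum_(ij : 'I_N * 'I_N) c ij.1 ij.2 *
  (w x * partials [:: ij.1; ij.2] phi x - phi x * partials [:: ij.2; ij.1] w x)).
have [_ _ n0] : null_integral n.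
  by apply: null_integral_sum => -[i j]; exact: null_integral_green2 Cw tphi.
have nE : n = (fun x => f1 x - f2 x).
  apply/funext => x; rewrite /n /f1 /f2.
  under eq_bigr do rewrite mulrBr.
  rewrite sumrB; congr (_ - _).
    rewrite /diffop mulr_sumr.
    rewrite -(pair_bigA _ (fun i j => c i j * (w x * partials [:: i; j] phi x)))/=.
    apply: eq_bigr => i _; rewrite mulr_sumr; apply: eq_bigr => j _.
    by rewrite mulrCA.
  have [Dx|Dx] := pselect (D x); last first.
    rewrite pS ?mulr0; last by move=> /SD.
    by rewrite big1// => ij _; rewrite mul0r mulr0.
  rewrite /diffop mulr_suml.
  rewrite -(pair_bigA _ (fun i j => c i j * (phi x * partials [:: j; i] w x)))/=.
  apply: eq_bigr => i _; rewrite mulr_suml; apply: eq_bigr => j _.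
  by have := sw x j i Dx; rewrite /= => ->; rewrite mulrA mulrAC.
have i1 := integrable_compact_supp cf1 sf1.
have i2 := integrable_compact_supp cf2 sf2.
have B := integralB measurableT i1 i2.
have E : (\int[lebesgue_tuple R N]_t (EFin \o (f1 \o @row_of_tuple R N)) t
    - \int[lebesgue_tuple R N]_t (EFin \o (f2 \o @row_of_tuple R N)) t = 0)%E.
  by rewrite -B -n0 nE.
have fin2 := integrable_fin_num measurableT i2.
rewrite -[LHS](subeK _ fin2) E add0e; apply: eq_integral => t _ /=.
by rewrite /f2 mulrC.
Qed.

Lemma diffop_weak_ge0 N (D : set 'rV[R]_N) (c : 'I_N -> 'I_N -> R)
    (w phi : 'rV[R]_N -> R) :
  class_C 2 D w -> sym_hess D w -> (forall x, D x -> 0 <= diffop c w x) ->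
  test_function D phi ->
  (0 <= lintegral D (fun z => (w z)%:E * (diffop c phi z)%:E))%E.
Proof.
move=> Cw sw pw tphi; have [S [kS cS SD pS]] := test_function_supp tphi.
rewrite (lintegral_diffop c Cw sw tphi).1; apply: integral_ge0 => t _.
rewrite lee_fin; set x := row_of_tuple t.
have [Dx|Dx] := pselect (D x); last by rewrite pS ?mul0r// => /SD.
by rewrite mulr_ge0// ?pw//; case: tphi.
Qed.

Lemma diffop_weak_lt0 N (D : set 'rV[R]_N) (c : 'I_N -> 'I_N -> R)
    (w phi : 'rV[R]_N -> R) x0 :
  class_C 2 D w -> sym_hess D w -> test_function D phi ->
  (forall x, phi x * diffop c w x <= 0) -> phi x0 * diffop c w x0 < 0 ->
  (lintegral D (fun z => (w z)%:E * (diffop c phi z)%:E) < 0)%E.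
Proof.
move=> Cw sw tphi pw p0; have [-> [cg sg]] := lintegral_diffop c Cw sw tphi.
set g := (fun x => phi x * diffop c w x) in cg sg pw p0 *.
(* By continuity the integrand stays below this negative level on a cube around [x0], whose measure
   is positive; elsewhere it is at most 0. *)
pose d := g x0 / 2.
have d0 : d < 0 by rewrite ltr_pdivrMr// mul0r.
have : nbhs x0 (g @^-1` [set y | y < d]).
  apply: cg; apply: open_nbhs_nbhs; split; first exact: open_lt.
  by rewrite /= /d; move: p0; rewrite -/(g x0); lra.
move=> /nbhs_ballP[r /= r0 hr].
have mC := measurable_cube x0 (r / 2).
have r20 : 0 < r / 2 by rewrite divr_gt0.
have cubeE := @lebesgue_cube R N x0 (r / 2) (ltW r20).
have Cfin : (lebesgue_tuple R N (cube x0 (r / 2)) < +oo)%E.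
  by rewrite -ge0_fin_numE// cubeE.
have intd : (lebesgue_tuple R N).-integrable setT ((EFin \o cst d) \_ (cube x0 (r / 2))).
  apply: (integrable_mkcond _ mC).1.
  apply: measurable_bounded_integrable => //.
  exact: bounded_cst.
apply: (@le_lt_trans _ _ (\int[lebesgue_tuple R N]_t ((EFin \o cst d) \_ (cube x0 (r / 2))) t)%E).
  apply: le_integral => //; first exact: (integrable_compact_supp cg sg).
  move=> t _; rewrite patchE; case: ifPn => [/set_mem /cubeP ht|_]; last first.
    by rewrite lee_fin; exact: pw.
  rewrite lee_fin; apply/ltW/hr/ball_rVP => // i.
  by rewrite distrC; apply: le_lt_trans (ht i) _; rewrite ltr_pdivrMr// ltr_pMr// ltr1n.
rewrite -integral_mkcond.
have -> : (\int[lebesgue_tuple R N]_(t in cube x0 (r / 2)) (EFin \o cst d) t)%E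
   = (d%:E * lebesgue_tuple R N (cube x0 (r / 2)))%E by exact: (integral_cst _ mC d%:E).
rewrite cubeE -EFinM lte_fin nmulr_rlt0// exprn_gt0// mulr_gt0//.
Qed.

End weak_positivity.

(** * The second derivative at an interior maximum *)

Section maximum_principle.
Variable R : realType.
Implicit Types N : nat.

(** As [f' (0) = 0], a positive second derivative would make [f'] positive just to the right of 0,
    and the mean value theorem would give [f (h) > f (0)]. *)
Lemma second_derivative_at_max (f : R -> R) (r : R) : 0 < r ->
  (forall t, `|t| < r -> derivable f t 1 /\ f t <= f 0) ->
  derivable (fun t => 'D_1 f t) 0 1 -> 'D_1 (fun t => 'D_1 f t) 0 <= 0.
Proof.
move=> r0 hf df; rewrite leNgt; apply/negP => p0.
have in_r t : t \in `]-r, r[ -> `|t| < r by rewrite in_itv/= -ltr_norml.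
have f0 : 'D_1 f 0 = 0.
  have [||||_ ->//] := @derive1_at_max _ f (- r) r 0.
  - by move: r0; lra.
  - by move=> t /in_r /hf[].
  - by rewrite in_itv/= r0 oppr_lt0 r0.
  - by move=> t /in_r /hf[].
have : \forall h \near 0^', 0 < h^-1 *: ('D_1 f (h *: 1 + 0) - 'D_1 f 0).
  have /cvgr_gt := df; exact.
rewrite f0; move=> /nbhs_ballP[d /= d0 hd].
have pos h : 0 < h < d -> 0 < 'D_1 f h.
  move=> /andP[h0 hlt]; have := hd h; rewrite /ball/= sub0r normrN gtr0_norm//.
  move=> /(_ hlt (lt0r_neq0 h0)); rewrite addr0 subr0 /GRing.scale/= mulr1.
  by rewrite pmulr_rgt0// invr_gt0.
pose h := Num.min d r / 2.
have h0 : 0 < h by rewrite divr_gt0// lt_min d0.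
have hd' : h < d.
  by rewrite /h ltr_pdivrMr// (le_lt_trans (_ : _ <= d))// ?ge_min ?lexx// ltr_pMr// ltr1n.
have hr : h < r.
  by rewrite /h ltr_pdivrMr// (le_lt_trans (_ : _ <= r))// ?ge_min ?lexx ?orbT// ltr_pMr// ltr1n.
have fin t : 0 <= t <= h -> `|t| < r.
  by move=> /andP[t0 th]; rewrite ger0_norm// (le_lt_trans th).
have [t||c] := @MVT _ f (fun t => 'D_1 f t) 0 h h0.
- rewrite in_itv/= => /andP[t0 th].
  have t0h : 0 <= t <= h by rewrite !ltW.
  have [dt _] := hf t (fin t t0h); exact: DeriveDef.
- apply: derivable_within_continuous => t; rewrite in_itv/= => th.
  by have [] := hf t (fin t th).
- rewrite in_itv/= => /andP[c0 ch] E.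
  have h0h : 0 <= h <= h by rewrite lexx ltW.
  have := (hf h (fin h h0h)).2.
  rewrite -subr_le0 E subr0 leNgt mulr_gt0// pos// c0/=.
  exact: lt_trans ch hd'.
Qed.

End maximum_principle.

(** * The maximum principle *)

Section maximum_principle.
Variable R : realType.
Implicit Types N : nat.

(** Without a maximum the sets where [g < g z], for [z] in [K], would cover [K]; in a finite
    subcover the point with the largest value lies in none of them. *)
Lemma usc_compact_max (T : ptopologicalType) (K : set T) (g : T -> \bar R) :
  K !=set0 -> compact K -> (forall x, K x -> (g x < +oo)%E) ->
  (forall x (c : R), K x -> (g x < c%:E)%E -> \forall y \near x, K y -> (g y < c%:E)%E) ->
  exists2 x, K x & forall y, K y -> (g y <= g x)%E.
Proof.
move=> [x0 Kx0] cK goo usc; apply: contrapT => nomax.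
have {}nomax x : K x -> exists2 z, K z & (g x < g z)%E.
  move=> Kx; apply: contrapT => h; apply: nomax; exists x => // y Ky.
  by rewrite leNgt; apply/negP => xy; apply: h; exists y.
have uscE x z : K x -> K z -> (g x < g z)%E -> \forall y \near x, K y -> (g y < g z)%E.
  move=> Kx Kz; have := goo _ Kz; case E : (g z) => [r| |]// _ xz; first exact: usc.
  by move: xz; rewrite ltNge leNye.
pose U z := interior [set y | K y -> (g y < g z)%E].
rewrite compact_cover in cK.
have [|x Kx|D' D'K cov] := cK T K U.
- by move=> z _; exact: open_interior.
- by have [z Kz xz] := nomax x Kx; exists z => //; exact: uscE.
suff [z zD' hz] : exists2 z, z \in D' & forall y, y \in D' -> (g y <= g z)%E.
  have Kz : K z by have := D'K z zD'; rewrite inE.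
  have [y /= yD' /interior_subset /(_ Kz)] := cov z Kz.
  by rewrite ltNge hz.
have [a aD' _] := cov x0 Kx0.
have aD : a \in (D' : seq T) by [].
suff [z zs hz] : exists2 z, z \in (D' : seq T) & forall y, y \in (D' : seq T) -> (g y <= g z)%E.
  by exists z.
move: aD; elim: (D' : seq T) {aD'} a => // b s IH a _.
have [s0|[c cs]] : s = [::] \/ exists c, c \in s.
  by case: s {IH} => [|c s]; [left|right; exists c; rewrite mem_head].
  by exists b; [rewrite mem_head|move=> y; rewrite s0 inE => /eqP ->].
have [z zs hz] := IH c cs.
have [bz|zb] := leP (g b) (g z).
  by exists z; [rewrite inE zs orbT|move=> y; rewrite inE => /predU1P[->//|/hz]].
exists b; [by rewrite mem_head|move=> y; rewrite inE => /predU1P[->//|/hz hy]].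
exact: le_trans hy (ltW zb).
Qed.

Lemma partial2_le0_at_max N (f : 'rV[R]_N -> R) x (i : 'I_N) :
  (\forall y \near x, derivable f y (delta_mx 0 i) /\ f y <= f x) ->
  derivable (partials [:: i] f) x (delta_mx 0 i) ->
  partials [:: i; i] f x <= 0.
Proof.
move=> /nbhs_ballP[r /= r0 hr] df.
pose L (t : R) : 'rV[R]_N := t *: delta_mx 0 i + x.
have LE (t h : R) : L (h *: (1 : R) + t) = h *: delta_mx 0 i + L t.
  by rewrite /L -[h *: 1]/(h * 1) mulr1 scalerDl addrA.
have L0 : L 0 = x by rewrite /L scale0r add0r.
have E1 (f' : 'rV[R]_N -> R) t := @derive_affine R R^o _ L f' 1 (delta_mx 0 i) t (LE t).
have D1 : (fun t : R => 'D_1 (f \o L) t) = (partials [:: i] f) \o L.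
  by apply/funext => t; rewrite (E1 f t).2.
have E2 := E1 (partials [:: i] f) 0.
rewrite L0 in E2; rewrite -[X in X <= 0]/('D_(delta_mx 0 i) (partials [:: i] f) x).
have e : 'D_1 (fun t : R => 'D_1 (f \o L) t) 0 = 'D_(delta_mx 0 i) (partials [:: i] f) x.
  by rewrite D1; exact: E2.2.
rewrite -e; apply: (@second_derivative_at_max R (f \o L) r r0); last first.
  by rewrite D1; apply/E2.1.
move=> t tr; have : ball x r (L t).
  apply/ball_rVP => // j; rewrite !mxE opprD addrCA subrr addr0 normrN mulr_natr.
  by case: andP => _; rewrite ?mulr1n ?mulr0n ?normr0.
by move=> /hr[dt ft]; split; [apply/(E1 f t).1|rewrite /= L0].
Qed.

Lemma partials1_sqr N (j : 'I_N) :
  partials [:: j] (fun y : 'rV[R]_N => enorm y ^+ 2) = (fun y => 2 * y 0 j) /\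
  forall x, derivable (fun y : 'rV[R]_N => enorm y ^+ 2) x (delta_mx 0 j).
Proof.
have E : (fun y : 'rV[R]_N => enorm y ^+ 2) =
    \sum_(k < N) ((fun y : 'rV[R]_N => y 0 k) ^+ 2).
  apply/funext => y; rewrite fct_sumE /enorm sqr_sqrtr//.
  by apply: sumr_ge0 => k _; exact: sqr_ge0.
rewrite E; split; last first.
  by move=> x; exact: ex_derive.
apply/funext => y; rewrite /= derive_val (bigD1 j)//= big1 ?addr0.
  by rewrite !mxE !eqxx expr1 /GRing.scale/= mulr1.
by move=> k kj; rewrite mxE (negbTE kj) andbF scaler0.
Qed.

Lemma sqr_enorm N (x : 'rV[R]_N) : enorm x ^+ 2 = \sum_i x 0 i ^+ 2.
Proof. by rewrite /enorm sqr_sqrtr// sumr_ge0// => i _; rewrite sqr_ge0. Qed.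

Lemma continuous_sqr_enorm N : continuous (fun x : 'rV[R]_N => enorm x ^+ 2).
Proof.
have -> : (fun x : 'rV[R]_N => enorm x ^+ 2) = (fun x => \sum_i x 0 i ^+ 2).
  by apply/funext => x; rewrite sqr_enorm.
move=> x; apply: continuous_sumr => i.
rewrite (_ : (fun _ => _) = (fun y : 'rV[R]_N => y 0 i * y 0 i)).
  by apply: continuousM; exact: coord_continuous.
by apply/funext.
Qed.

Lemma subharmonic_locally_C2 N (D : set 'rV[R]_N) v : (0 < N)%N -> usc_on D v ->
  (forall x, D x -> v x = -oo%E \/ exists U w, [/\ open U, U x, class_C 2 U w,
     (forall y, U y -> v y = (w y)%:E) & 0 <= \sum_i partials [:: i; i] w x]) ->
  subharmonic D v.
Proof.
move=> N0 usc hv; split=> // K h cK KD ch [Ch harm] bd x0 Kx0.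
have voo x : D x -> (v x < +oo)%E.
  by move=> /hv[->//|[U [w [_ Ux _ /(_ _ Ux) -> _]]]]; rewrite ltry.
rewrite leNgt; apply/negP => h0.
have [r0 vx0] : exists r0, v x0 = r0%:E.
  have := voo x0 (KD _ Kx0); case E : (v x0) => [r| |]// _; first by exists r.
  by move: h0; rewrite E ltNge leNye.
pose q (x : 'rV[R]_N) : R := enorm x ^+ 2.
have q0 x : 0 <= q x by exact: sqr_ge0.
have [B B0 hB] : exists2 B : R, 0 < B & forall x, K x -> q x < B.
  have cq : {within K, continuous q} by exact/continuous_subspaceT/continuous_sqr_enorm.
  have /compact_bounded[M [Mr hM]] := continuous_compact cq cK.
  exists (`|M| + 2); first by rewrite ltr_wpDl.
  move=> x Kx; have : `|q x| <= `|M| + 1.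
    by apply: hM; [rewrite ltr_pwDr// ler_norm|exists x].
  rewrite (ger0_norm (q0 x)) => H; apply: le_lt_trans H _.
  by rewrite ltrD2l ltr1n.
pose d := r0 - h x0.
have d0 : 0 < d by rewrite subr_gt0 -lte_fin -vx0.
(* Keeps [ep |x| ^ 2] below [d], the excess of [v] over [h] at [x0], on all of [K]. *)
pose ep := d / (2 * B).
have ep0 : 0 < ep by rewrite divr_gt0// mulr_gt0.
pose s x := ep * q x - h x.
have cs : {within K, continuous s}.
  have cq : {within K, continuous q} by exact/continuous_subspaceT/continuous_sqr_enorm.
  move: cq ch => /subspace_continuousP cq /subspace_continuousP ch'.
  apply/subspace_continuousP => x Kx.
  exact: cvgB (cvgM (cvg_cst _) (cq x Kx)) (ch' x Kx).
pose g x := (v x + (s x)%:E)%E.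
have [||x1 Kx1 gmax] := @usc_compact_max _ K g (ex_intro _ _ Kx0) cK.
- move=> x Kx; rewrite /g; have := voo x (KD _ Kx).
  by case: (v x) => [r| |]// _; rewrite ?ltry.
- move=> x c Kx gx.
  have [c1 [vc1 c1c]] : exists c1 : R, (v x < c1%:E)%E /\ c1 + s x < c.
    move: gx; rewrite /g; have := voo x (KD _ Kx).
    case: (v x) => [r| |]// _; rewrite -?EFinD ?lte_fin => rc.
      by exists ((r + (c - s x)) / 2); rewrite lte_fin; split; move: rc; lra.
    by exists (c - s x - 1); rewrite ltNyr; split=> //; lra.
  have near1 := usc x c1 (KD _ Kx) vc1.
  have /subspace_continuousP/(_ x Kx) cs' := cs.
  have near2 : \forall y \near x, K y -> s y < c - c1.
    have : nbhs (s x) [set y | y < c - c1].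
      by apply: open_nbhs_nbhs; split; [exact: open_lt|move: c1c; rewrite /=; lra].
    by move=> /cs'; rewrite /within/=.
  apply: filterS2 near1 near2 => y h1 h2 Ky.
  have := h1 (KD _ Ky); have := h2 Ky; have := voo y (KD _ Ky).
  rewrite /g; case: (v y) => [t| |]// _.
    by rewrite -EFinD !lte_fin; lra.
  by move=> _ _; rewrite addNye ltNyr.
have gx0 : g x0 = (d + ep * q x0)%:E.
  by rewrite /g vx0 -EFinD /d /s; congr (_%:E); ring.
have epB x : K x -> ep * q x < d.
  move=> Kx; apply: (@lt_le_trans _ _ (ep * B)); first by rewrite ltr_pM2l// hB.
  by rewrite /ep invfM mulrA divfK ?gt_eqF// ler_pdivrMr// ler_peMr ?ler1n// ltW.
(* On the boundary [v <= h], so the perturbed function is less than [d], which does not exceed its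
   value at [x0]. *)
have x1int : K° x1.
  apply: contrapT => nK; have := gmax x0 Kx0; rewrite gx0 /g => h1.
  have h2 := bd x1 Kx1 nK; have h3 := epB x1 Kx1.
  move: h1 h2; have := voo x1 (KD _ Kx1); rewrite /s.
  case: (v x1) => [t| |]// _; rewrite -?EFinD ?lee_fin.
    by have := mulr_ge0 (ltW ep0) (q0 x0); move: h3; lra.
have [vx1|[U [w [oU Ux1 Cw vU lap]]]] := hv x1 (KD _ Kx1).
  by have := gmax x0 Kx0; rewrite gx0 /g vx1 addNye leeNy_eq.
pose f x := w x + (ep * q x - h x).
have oK : open K° by exact: open_interior.
have nearUK : \forall y \near x1, U y /\ K° y.
  by apply: filterI; exact: open_nbhs_nbhs.
have D1 i y : U y -> K° y -> is_derive y (delta_mx 0 i) f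
    (partials [:: i] w y + (ep * (2 * y 0 i) - partials [:: i] h y)).
  move=> Uy Ky.
  have dw : is_derive y (delta_mx 0 i) w (partials [:: i] w y).
    by apply: DeriveDef => //; exact: (Cw [::] y Uy).2.
  have dh : is_derive y (delta_mx 0 i) h (partials [:: i] h y).
    by apply: DeriveDef => //; exact: (Ch [::] y Ky).2.
  have dq : is_derive y (delta_mx 0 i) q (2 * y 0 i).
    have [E dq] := @partials1_sqr N i.
    by apply: DeriveDef; [exact: dq|rewrite -[RHS](congr1 (@^~ y) E)].
  exact: is_deriveD dw (is_deriveB (is_deriveZ ep dq) dh).
have D2 i : is_derive x1 (delta_mx 0 i) (partials [:: i] f)
    (partials [:: i; i] w x1 + (ep * 2 - partials [:: i; i] h x1)).
  have dw : is_derive x1 (delta_mx 0 i) (partials [:: i] w) (partials [:: i; i] w x1).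
    by apply: DeriveDef => //; exact: (Cw [:: i] x1 Ux1).2.
  have dh : is_derive x1 (delta_mx 0 i) (partials [:: i] h) (partials [:: i; i] h x1).
    by apply: DeriveDef => //; exact: (Ch [:: i] x1 x1int).2.
  have dc : is_derive x1 (delta_mx 0 i) (fun y : 'rV[R]_N => ep * (2 * y 0 i)) (ep * 2).
    have := is_deriveZ ep (is_deriveZ 2 (is_derive_coord i x1 (delta_mx 0 i))).
    by rewrite mxE !eqxx /GRing.scale/= mulr1.
  apply: near_eq_is_derive (is_deriveD dw (is_deriveB dc dh)).
  apply: filterS nearUK => y [Uy Ky]; have [_ e] := D1 i y Uy Ky.
  exact: esym e.
have le0 i : partials [:: i; i] w x1 + (ep * 2 - partials [:: i; i] h x1) <= 0.
  have [d2 d2E] := D2 i; rewrite -d2E; apply: partial2_le0_at_max => //.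
  apply: filterS nearUK => y [Uy Ky]; split; first by have [] := D1 i y Uy Ky.
  have := gmax y (interior_subset Ky).
  by rewrite /g (vU y Uy) (vU x1 Ux1) -!EFinD lee_fin.
(* This sum is the Laplacian of [w] plus [2 ep N], as [h] is harmonic, hence positive. *)
have : \sum_i (partials [:: i; i] w x1 + (ep * 2 - partials [:: i; i] h x1)) <= 0.
  exact: sumr_le0.
rewrite big_split/= sumrB (harm x1 x1int) subr0 sumr_const card_ord leNgt.
by rewrite ltr_wpDl// pmulrn_lgt0// mulr_gt0.
Qed.

End maximum_principle.

(** * Bump functions *)

Section bump.
Variable R : realType.
Implicit Types N : nat.

(** Restriction to the line through [x] in the direction [v] reduces this to one variable, so [g]
    need only have the directional derivative. *)
Lemma is_derive_chain N (f : R -> R) (g : 'rV[R]_N -> R) x v (a b : R) :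
  is_derive (g x) 1 f a -> is_derive x v g b -> is_derive x v (f \o g) (a * b).
Proof.
move=> hf [dg eg]; pose L (t : R) : 'rV[R]_N := t *: v + x.
have LE (t h : R) : L (h *: (1 : R) + t) = h *: v + L t.
  by rewrite /L -[h *: 1]/(h * 1) mulr1 scalerDl addrA.
have L0 : L 0 = x by rewrite /L scale0r add0r.
have E1 := @derive_affine R R^o _ L g 1 v 0 (LE 0).
have E2 := @derive_affine R R^o _ L (f \o g) 1 v 0 (LE 0).
rewrite L0 in E1 E2.
have dgL : is_derive (0 : R) 1 (g \o L) b.
  by apply: DeriveDef; [exact/E1.1|rewrite E1.2].
have hf' : is_derive ((g \o L) 0) 1 f a by rewrite /= L0.
have [d e] := is_derive1_comp hf' dgL.
by apply: DeriveDef; [exact/E2.1|rewrite -E2.2].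
Qed.

Lemma expR_ge_pow (n : nat) (y : R) : 0 <= y -> y ^+ n <= n%:R ^+ n * expR y.
Proof.
move=> y0; case: n => [|n]; first by rewrite !expr0 mul1r -[X in X <= _]expR0 ler_expR.
have -> : expR y = expR (y / n.+1%:R) ^+ n.+1.
  by rewrite -expRM_natl mulrC divfK.
rewrite -exprMn; apply: lerXn2r; rewrite ?nnegrE ?mulr_ge0 ?expR_ge0//.
rewrite -ler_pdivrMl// mulrC; apply: le_trans (expR_ge1Dx _).
by rewrite lerDr.
Qed.

(** The powers of [1 / t] make the family closed under derivation up to linear combinations; [k = 0]
    is the classical flat function. *)
Definition flat k (t : R) : R := if 0 < t then t^-1 ^+ k * expR (- t^-1) else 0.

(** Bounds the right difference quotient at 0, through [expR_ge_pow] at [1 / t] with exponent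
    [k + 2]. *)
Lemma flat_le k (t : R) : 0 < t -> t^-1 * flat k t <= k.+2%:R ^+ k.+2 * t.
Proof.
move=> t0; rewrite /flat t0 mulrA -exprS.
have ti0 : 0 <= t^-1 by rewrite invr_ge0 ltW.
have h := expR_ge_pow k.+2 ti0; rewrite expRN ler_pdivrMr ?expR_gt0//.
rewrite mulrAC -ler_pdivrMr//; apply: le_trans h.
by rewrite [in leRHS]exprS mulrC.
Qed.

Lemma is_derive_flat k (t : R) :
  is_derive t 1 (flat k) (flat k.+2 t - k%:R * flat k.+1 t).
Proof.
have [t0|t0|t0] := ltgtP t 0.
- have near0 : \forall y \near t, (cst 0 : R -> R) y = flat k y.
    have : nbhs t [set y | y < 0] by apply: open_nbhs_nbhs; split=> //; exact: open_lt.
    by apply: filterS => y /= y0; rewrite /flat ltNge ltW.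
  apply: near_eq_is_derive near0 _; rewrite /flat !ltNge (ltW t0)/= mulr0 subrr.
  exact: is_derive_cst.
- have near0 : \forall y \near t, y^-1 ^+ k * expR (- y^-1) = flat k y.
    have : nbhs t [set y | 0 < y] by apply: open_nbhs_nbhs; split=> //; exact: open_gt.
    by apply: filterS => y /= y0; rewrite /flat y0.
  apply: near_eq_is_derive near0 _; rewrite /flat !t0.
  have tn0 : t != 0 by rewrite gt_eqF.
  have d1 : is_derive t 1 (fun y : R => y^-1) (- t ^- 2).
    have h := @is_deriveV R id t 1 1 tn0 (is_derive_id t 1).
    by apply: is_derive_eq h _; rewrite /GRing.scale/= mulr1.
  have d2 := is_derive1_comp (is_derive_expR _) (is_deriveN d1).
  have d3 := is_deriveM (is_deriveX k d1) d2.
  have E : (fun y : R => y^-1 ^+ k * expR (- y^-1)) =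
      (fun y : R => y^-1) ^+ k * (expR \o - (fun y : R => y^-1)).
    by apply/funext => y; rewrite /= mulrfctE exprfctE.
  rewrite E; apply: is_derive_eq d3 _.
  rewrite /= /GRing.scale/= opprK -exprVn.
  rewrite exprfctE -[(- _) t]/(- t^-1); set X := expR _; set y := t^-1.
  by case: k {E} => [|k]; rewrite /= ?exprS; ring.
- rewrite t0; have -> : flat k.+2 0 - k%:R * flat k.+1 0 = 0.
    by rewrite /flat ltxx mulr0 subrr.
  suff h : (fun h : R => h^-1 *: (flat k (h *: 1 + 0) - flat k 0)) @ 0^' --> (0 : R).
    by apply: DeriveDef; [apply/cvg_ex; exists 0|exact/cvg_lim].
  apply/cvgrPdist_le => e e0.
  pose K : R := k.+2%:R ^+ k.+2; have K0 : 0 < K by rewrite exprn_gt0.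
  apply/nbhs_ballP; exists (e / K) => /=; first by rewrite divr_gt0.
  move=> h; rewrite /ball/= sub0r normrN => he _.
  rewrite sub0r normrN addr0 /GRing.scale/= mulr1 {2}/flat ltxx subr0.
  have [h0|h0] := ltP 0 h; last by rewrite /flat ltNge h0/= mulr0 normr0 ltW.
  rewrite ger0_norm; last first.
    by rewrite mulr_ge0 ?invr_ge0 ?ltW// /flat h0 mulr_gt0 ?expR_gt0// exprn_gt0// invr_gt0.
  apply: le_trans (flat_le k h0) _; rewrite -/K mulrC -ler_pdivlMr//.
  by move: he; rewrite gtr0_norm// => /ltW.
Qed.

Lemma flat_ge0 k t : 0 <= flat k t.
Proof.
rewrite /flat; case: ifPn => // t0.
by rewrite mulr_ge0 ?expR_ge0// exprn_ge0// invr_ge0 ltW.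
Qed.

Lemma continuousB_fun (T : topologicalType) (f g : T -> R) x :
  {for x, continuous f} -> {for x, continuous g} ->
  {for x, continuous (fun y => f y - g y)}.
Proof. by move=> cf cg; exact: cvgB cf cg. Qed.

(** * A class of functions closed under partial derivatives *)

Section bump_class.
Variables (N : nat) (c : 'rV[R]_N) (r : R).

(** Here [r] plays the role of the square of a Euclidean radius. *)
Definition bump_arg (x : 'rV[R]_N) : R := r - \sum_i (x 0 i - c 0 i) ^+ 2.

(** A syntactic class stable under partial derivatives and made of continuous functions: smoothness
    of every order follows by structural induction. *)
Inductive bump_fun : ('rV[R]_N -> R) -> Prop :=
| bump_cst a : bump_fun (fun=> a)
| bump_coord i : bump_fun (fun x => x 0 i)
| bump_flat k : bump_fun (fun x => flat k (bump_arg x))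
| bump_add f g : bump_fun f -> bump_fun g -> bump_fun (fun x => f x + g x)
| bump_mul f g : bump_fun f -> bump_fun g -> bump_fun (fun x => f x * g x).

Lemma is_derive_bump_arg x (i : 'I_N) :
  is_derive x (delta_mx 0 i) bump_arg (- 2 * (x 0 i - c 0 i)).
Proof.
have -> : bump_arg = (cst r) - \sum_(k < N) ((fun y : 'rV[R]_N => y 0 k - c 0 k) ^+ 2).
  by apply/funext => y; rewrite /bump_arg fctE fct_sumE.
have dk k : is_derive x (delta_mx 0 i) (fun y : 'rV[R]_N => y 0 k - c 0 k) ((i == k)%:R).
  have := is_deriveB (is_derive_coord k x (delta_mx 0 i)) (is_derive_cst (c 0 k) x (delta_mx 0 i)).
  by rewrite mxE eqxx/= subr0 eq_sym.
apply: is_derive_eq.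
rewrite sub0r (bigD1 i)//= big1 ?addr0.
  by rewrite eqxx expr1 /GRing.scale/= mulr1 mulNr mulr_natl.
by move=> k ki; rewrite eq_sym (negbTE ki) scaler0.
Qed.

Lemma bump_fun_derive f (i : 'I_N) : bump_fun f ->
  exists2 g, bump_fun g & forall x, is_derive x (delta_mx 0 i) f (g x).
Proof.
elim=> {f} [a|j|k|f g _ [f' hf' df] _ [g' hg' dg]|f g hf [f' hf' df] hg [g' hg' dg]].
- by exists (fun=> 0) => [|x]; [exact: bump_cst|exact: is_derive_cst].
- exists (fun=> (delta_mx 0 i : 'rV[R]_N) 0 j) => [|x]; first exact: bump_cst.
  exact: is_derive_coord.
- exists (fun x => (flat k.+2 (bump_arg x) + (- k%:R) * flat k.+1 (bump_arg x))
      * ((- 2) * (x 0 i + - c 0 i))) => [|x].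
    apply: bump_mul; [apply: bump_add|apply: bump_mul].
    + exact: bump_flat.
    + by apply: bump_mul; [exact: bump_cst|exact: bump_flat].
    + exact: bump_cst.
    + by apply: bump_add; [exact: bump_coord|exact: bump_cst].
  rewrite mulNr.
  exact: is_derive_chain (is_derive_flat k _) (is_derive_bump_arg x i).
- exists (fun x => f' x + g' x) => [|x]; first exact: bump_add.
  exact: is_deriveD.
- exists (fun x => f x * g' x + g x * f' x) => [|x].
    by apply: bump_add; exact: bump_mul.
  exact: is_deriveM.
Qed.

Lemma bump_fun_continuous f : bump_fun f -> continuous f.
Proof.
elim=> {f} [a|j|k|f g _ cf _ cg|f g hf cf hg cg] x.
- exact: cst_continuous.
- exact: coord_continuous.
- have cflat : {for bump_arg x, continuous (flat k)}.
    have [d _] := is_derive_flat k (bump_arg x).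
    exact/differentiable_continuous/derivable1_diffP.
  have carg : {for x, continuous (fun y : 'rV[R]_N => r - \sum_i (y 0 i - c 0 i) ^+ 2)}.
    apply: continuousB_fun; first exact: cst_continuous.
    apply: continuous_sumr => i.
    have ci : {for x, continuous (fun y : 'rV[R]_N => y 0 i - c 0 i)}.
      by apply: continuousB_fun; [exact: coord_continuous|exact: cst_continuous].
    exact: (@continuousM R _ (fun y : 'rV[R]_N => y 0 i - c 0 i) _ x ci ci).
  by move=> A /cflat /carg.
- exact: (@continuousD R R _ f g x (cf x) (cg x)).
- exact: (@continuousM R _ f g x (cf x) (cg x)).
Qed.

Lemma bump_fun_partials f (s : seq 'I_N) : bump_fun f -> bump_fun (partials s f).
Proof.
move=> hf; elim: s => //= i s hs; have [g hg dg] := bump_fun_derive i hs.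
rewrite (_ : (fun x => _) = g)//; apply/funext => x.
by have [_ ->] := dg x.
Qed.

Lemma bump_fun_class_C f k : bump_fun f -> class_C k setT f.
Proof.
move=> hf s x _; have hs := bump_fun_partials s hf; split=> _.
  exact: bump_fun_continuous.
by move=> i; have [g _ dg] := bump_fun_derive i hs; have [] := dg x.
Qed.

End bump_class.

Lemma closed_ball_rV N (c : 'rV[R]_N) (r : R) :
  closed [set x : 'rV[R]_N | `|x - c| <= r] /\ compact [set x : 'rV[R]_N | `|x - c| <= r].
Proof.
have cl : closed [set x : 'rV[R]_N | `|x - c| <= r].
  rewrite (_ : [set _ | _] = (fun x : 'rV[R]_N => `|x - c|) @^-1` [set y | y <= r])//.
  apply: preimage_closed; last exact: closed_le.
  move=> x _; have cid : {for x, continuous (fun y : 'rV[R]_N => y)} by move=> A.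
  have cc : {for x, continuous (fun _ : 'rV[R]_N => c)} by exact: cst_continuous.
  exact: cvg_norm (cvgB cid cc).
split=> //; apply: bounded_closed_compact => //.
exists (r + `|c|); split; first exact: num_real.
move=> M hM x /= xr; apply: le_trans (ltW hM).
by rewrite -[x in `|x|](subrK c) (le_trans (ler_normD _ _))// lerD2r.
Qed.

Lemma exists_bump N (D : set 'rV[R]_N) (c : 'rV[R]_N) (r : R) : 0 < r ->
  ball c r `<=` D ->
  exists phi, [/\ test_function D phi, 0 < phi c & forall x, phi x != 0 -> ball c r x].
Proof.
(* Half the radius, so that the closed support remains inside the open ball; the Euclidean ball lies
   in the sup-norm ball of the same radius. *)
move=> r0 BD; pose phi x := flat 0 (@bump_arg N c ((r / 2) ^+ 2) x).
have r20 : 0 < r / 2 by rewrite divr_gt0.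
have phiB x : phi x != 0 -> `|x - c| <= r / 2.
  rewrite /phi /flat; case: ifPn => [h _|_]; last by rewrite eqxx.
  rewrite [leLHS]/Num.Def.normr /= mx_normrE; apply: bigmax_le; first exact: ltW.
  move=> [k j] _ /=; rewrite ord1 !mxE -[leRHS]ger0_norm ?(ltW r20)//.
  rewrite -ler_sqr ?nnegrE//= !real_normK ?num_real//.
  move: h; rewrite subr_gt0 => /ltW; apply: le_trans.
  by rewrite (bigD1 j)//= lerDl sumr_ge0// => i _; exact: sqr_ge0.
have [clB cB] := closed_ball_rV c (r / 2).
have sub : closure [set x | phi x != 0] `<=` [set x : 'rV[R]_N | `|x - c| <= r / 2].
  by move=> x hx; apply: clB; apply: (closure_subset _ hx) => y; exact: phiB.
have subB (x : 'rV[R]_N) : `|x - c| <= r / 2 -> ball c r x.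
  move=> h; rewrite -ball_normE /ball_/= distrC (le_lt_trans h)//.
  by rewrite ltr_pdivrMr// ltr_pMr// ltr1n.
exists phi; split.
- split.
  + by move=> k; apply: (@bump_fun_class_C N c ((r / 2) ^+ 2)); exact: bump_flat.
  + by apply: (subclosed_compact _ cB sub); exact: closed_closure.
  + by move=> x /sub /subB /BD.
  + by move=> x; exact: flat_ge0.
- rewrite /phi /flat /bump_arg big1 ?subr0; last by move=> i _; rewrite subrr expr0n.
  by rewrite exprn_gt0// expr0 mul1r expR_gt0.
- by move=> x /phiB /subB.
Qed.

End bump.

(** * Integrability of a pole *)

Section pole.
Variable R : realType.
Implicit Types N : nat.

Lemma lebesgue_tuple_point N (x : 'rV[R]_N) : (0 < N)%N ->
  lebesgue_tuple R N (@row_of_tuple R N @^-1` [set x]) = 0%E /\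
  measurable (@row_of_tuple R N @^-1` [set x]).
Proof.
move=> N0; have -> : @row_of_tuple R N @^-1` [set x] = cube x 0.
  apply/seteqP; split=> t.
    by move=> /= <-; apply/cubeP => i; rewrite subrr normr0.
  move=> /cubeP h; apply/rowP => i; apply/eqP.
  by rewrite -subr_eq0 -normr_le0; exact: h.
split; last exact: measurable_cube.
by rewrite lebesgue_cube// mulr0 expr0n gtn_eqF.
Qed.

Lemma ae_neq_point N (x : 'rV[R]_N) (P : N.-tuple (measurableTypeR R) -> Prop) :
  (0 < N)%N -> (forall t, row_of_tuple t <> x -> P t) ->
  {ae lebesgue_tuple R N, forall t, P t}.
Proof.
move=> N0 h; have [m0 mm] := lebesgue_tuple_point x N0.
exists (@row_of_tuple R N @^-1` [set x]); split=> // t /= nP.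
by apply: contrapT => nx; apply: nP; exact: h.
Qed.

Lemma norm_le_cube N (r : R) t : 0 <= r -> (@cube R N 0 r t) <-> `|row_of_tuple t| <= r.
Proof.
move=> r0; split; last exact: le_norm_cube.
move=> /cubeP ht; rewrite [leLHS]/Num.Def.normr /= mx_normrE; apply: bigmax_le => //.
by move=> [i j] _ /=; rewrite ord1; have := ht j; rewrite [X in _ - X]mxE subr0.
Qed.

Lemma dyadic_bracket (y : R) : 0 < y <= 1 ->
  exists k : nat, (2 ^+ k.+1)^-1 < y <= (2 ^+ k)^-1.
Proof.
move=> /andP[y0 y1].
have ex : exists k : nat, (2 ^+ k.+1)^-1 < y.
  exists (Num.truncn y^-1); rewrite invf_plt ?posrE ?exprn_gt0//.
  apply: (@lt_trans _ _ (Num.truncn y^-1).+1%:R); first exact: truncnS_gt.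
  by rewrite -natrX ltr_nat ltn_expl.
exists (ex_minn ex); case: ex_minnP => k hk kmin; rewrite hk/=.
case: k hk kmin => [|k] hk kmin; first by rewrite expr0 invr1.
by rewrite leNgt; apply/negP => /kmin; rewrite ltnn.
Qed.

(** Dyadic majorant of [|x| ^ (1 - N)]: for [|x|] between [2 ^ - (k + 1)] and [2 ^ - k], the [k]-th
    term alone suffices. *)
Definition pole_term N (k : nat) (t : N.-tuple (measurableTypeR R)) : \bar R :=
  ((2 ^+ k.+1) ^+ N.-1 * \1_(cube 0 (2 ^+ k)^-1) t)%:E.

Definition pole_series N t := (\sum_(k <oo) @pole_term N k t)%E.

Lemma pole_term_ge0 N k t : (0 <= @pole_term N k t)%E.
Proof. by rewrite lee_fin mulr_ge0// !exprn_ge0. Qed.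

Lemma measurable_pole_term N k : measurable_fun setT (@pole_term N k).
Proof.
apply/measurable_EFinP; apply: measurable_funM; first exact: measurable_cst.
by apply: measurable_indic; exact: measurable_cube.
Qed.

Lemma integral_pole_series N : (0 < N)%N ->
  (\int[lebesgue_tuple R N]_t pole_series t < +oo)%E.
Proof.
move=> N0; rewrite integral_nneseries//; last 2 first.
- by move=> k; exact: measurable_pole_term.
- by move=> k t _; exact: pole_term_ge0.
(* The [k]-th term integrates to [(2 ^ (k + 1)) ^ (N - 1) (2 * 2 ^ - k) ^ N = 4 ^ N / 2 ^ (k + 1)],
   a geometric series with sum [4 ^ N]. *)
apply: (@le_lt_trans _ _ (4 ^+ N)%:E); last by rewrite ltry.
have K0 : 0 <= 4 ^+ N :> R by rewrite exprn_ge0.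
apply: le_trans (@epsilon_trick0 R (4 ^+ N) xpredT K0).
apply: lee_nneseries => [k _ _|k _].
  by apply: integral_ge0 => t _; exact: pole_term_ge0.
rewrite (@integralZl_indic _ _ _ _ _ measurableT (fun=> cube 0 (2 ^+ k)^-1)); last 2 first.
- by move=> h; exfalso; move: h; rewrite ltNge !exprn_ge0.
- exact: measurable_cube.
rewrite integral_indic//; last exact: measurable_cube.
rewrite setIT [X in (_ * X)%E](_ : _ = ((2 * (2 ^+ k)^-1) ^+ N)%:E); last first.
  by apply: lebesgue_cube; rewrite invr_ge0 exprn_ge0.
rewrite -EFinM lee_fin.
rewrite natrX le_eqVlt; apply/orP; left; apply/eqP.
rewrite exprMn exprVn.
case: N N0 {K0} => // N _; rewrite /= (_ : 4 = 2 * 2 :> R); last by rewrite -natrM.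
have h2 : 2 ^+ k != 0 :> R by rewrite expf_neq0.
rewrite !exprMn !exprS !exprMn; field.
by rewrite !expf_neq0.
Qed.

Lemma pole_series_ge N t (k : nat) : (@pole_term N k t <= pole_series t)%E.
Proof.
have h := @nneseries_lim_ge R (fun k => @pole_term N k t) xpredT 0 k.+1
  (fun n _ _ => pole_term_ge0 n t).
apply: le_trans h; rewrite big_nat_recr//= leeDr// sume_ge0// => i _.
exact: pole_term_ge0.
Qed.

Lemma pole_seriesP N t : let x := @row_of_tuple R N t in `|x| <= 1 ->
  (x = 0 -> pole_series t = +oo%E) /\
  (((`|x|^-1) ^+ N.-1)%:E <= pole_series t)%E.
Proof.
move=> x x1.
have c0 : x = 0 -> pole_series t = +oo%E.
  move=> x0; apply/eq_infty => r.
  have h := @nneseries_lim_ge R (fun k => @pole_term N k t) xpredT 0 (Num.truncn r).+1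
    (fun n _ _ => pole_term_ge0 n t).
  apply: le_trans h.
  apply: (@le_trans _ _ (\sum_(0 <= i < (Num.truncn r).+1) 1%:E)%E); last first.
    apply: lee_sum => i _; rewrite /pole_term lee_fin indicE mem_set ?mulr1.
      by rewrite -exprM exprn_ege1// ler1n.
    apply/norm_le_cube; first by rewrite invr_ge0 exprn_ge0.
    by rewrite -/x x0 normr0 invr_ge0 exprn_ge0.
  rewrite sumEFin lee_fin sumr_const_nat subn0.
  have [r0|r0] := leP 0 r; last by apply: (le_trans (ltW r0)); rewrite mulrn_wge0.
  exact/ltW/truncnS_gt.
split=> //.
have [x0|xn0] := eqVneq x 0; first by rewrite c0// leey.
have xgt : 0 < `|x| by rewrite normr_gt0.
have [|k /andP[k1 k2]] := @dyadic_bracket `|x|; first by rewrite xgt.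
apply: le_trans (pole_series_ge t k).
rewrite /pole_term lee_fin indicE mem_set ?mulr1; last first.
  by apply/norm_le_cube; rewrite ?invr_ge0 ?exprn_ge0.
apply: lerXn2r; rewrite ?nnegrE ?invr_ge0 ?exprn_ge0//.
by rewrite invf_ple ?posrE ?exprn_gt0// ltW.
Qed.

Lemma integrable_pole N (D : set 'rV[R]_N) (u : 'rV[R]_N -> \bar R) (C : R) :
  (0 < N)%N -> 0 < C -> measurable (@row_of_tuple R N @^-1` D) ->
  measurable_fun (@row_of_tuple R N @^-1` D) (u \o @row_of_tuple R N) ->
  (forall x, D x -> `|x| <= 1) ->
  (forall x, D x -> x <> 0 -> (`|u x| <= (C * (`|x|^-1) ^+ N.-1)%:E)%E) ->
  lintegrable D u.
Proof.
move=> N0 C0 mD mu D1 hu; apply/integrableP; split=> //.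
have mps : measurable_fun setT (@pole_series N).
  apply: (@ge0_emeasurable_sum _ _ _ setT (@pole_term N) xpredT).
    by move=> k t _ _; exact: pole_term_ge0.
  by move=> k _; exact: measurable_pole_term.
have ps0 t : (0 <= @pole_series N t)%E.
  by apply: nneseries_ge0 => k _ _; exact: pole_term_ge0.
apply: (@le_lt_trans _ _ (\int[lebesgue_tuple R N]_(t in @row_of_tuple R N @^-1` D)
   (C%:E * pole_series t))%E).
  apply: ge0_le_integral => //.
  - exact: measurableT_comp.
  - by apply: measurable_funeM; exact: measurable_funTS.
  - move=> t Dt /=; have [h1 h2] := pole_seriesP (D1 _ Dt).
    have [x0|/eqP x0] := eqVneq (row_of_tuple t) 0.
      by rewrite h1// gt0_muley ?leey// lte_fin.
    apply: le_trans (hu _ Dt x0) _; rewrite EFinM; apply: lee_wpmul2l => //.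
    by rewrite lee_fin ltW.
rewrite ge0_integralZl//; last 2 first.
- exact: measurable_funTS.
- by rewrite lee_fin ltW.
rewrite lte_mul_pinfty//; first by rewrite lee_fin ltW.
apply: le_lt_trans (integral_pole_series N0).
exact: ge0_subset_integral.
Qed.

End pole.

(** * Radial functions *)

Section radial.
Variable R : realType.
Implicit Types N : nat.

Definition C2_on (J : set R) (F F1 F2 : R -> R) :=
  [/\ open J, forall s, J s -> is_derive s 1 F (F1 s),
     forall s, J s -> is_derive s 1 F1 (F2 s) &
     forall s, J s -> {for s, continuous F2}].

(** The shift [d] is 0 for the function itself and positive for its regularizations. *)
Definition radial N (F : R -> R) (d : R) (z : 'rV[R]_N) : R := F (enorm z ^+ 2 + d).

Definition radial_dom N (J : set R) (d : R) : set 'rV[R]_N :=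
  [set z | J (enorm z ^+ 2 + d)].

Lemma continuous_shift_sqr N (d : R) :
  continuous (fun z : 'rV[R]_N => enorm z ^+ 2 + d).
Proof.
move=> z; apply: (@continuousD R R _ (fun z : 'rV[R]_N => enorm z ^+ 2) (fun=> d) z).
  exact: continuous_sqr_enorm.
exact: cst_continuous.
Qed.

Lemma open_radial_dom N J d : open J -> open (@radial_dom N J d).
Proof.
move=> oJ; apply: (@open_comp _ _ (fun z : 'rV[R]_N => enorm z ^+ 2 + d)) => //.
by move=> z _; exact: continuous_shift_sqr.
Qed.

Lemma is_derive_shift_sqr N (d : R) (z : 'rV[R]_N) i :
  is_derive z (delta_mx 0 i) (fun y : 'rV[R]_N => enorm y ^+ 2 + d) (2 * z 0 i).
Proof.
have [E dq] := @partials1_sqr R N i.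
have dq' : is_derive z (delta_mx 0 i) (fun y : 'rV[R]_N => enorm y ^+ 2) (2 * z 0 i).
  by apply: DeriveDef; [exact: dq|exact: (congr1 (@^~ z) E)].
by have := is_deriveD dq' (is_derive_cst d z (delta_mx 0 i)); rewrite addr0.
Qed.

Lemma continuousM_fun (T : topologicalType) (f g : T -> R) x :
  {for x, continuous f} -> {for x, continuous g} ->
  {for x, continuous (fun y => f y * g y)}.
Proof. by move=> cf cg; exact: cvgM cf cg. Qed.

Lemma continuousD_fun (T : topologicalType) (f g : T -> R) x :
  {for x, continuous f} -> {for x, continuous g} ->
  {for x, continuous (fun y => f y + g y)}.
Proof. by move=> cf cg; exact: cvgD cf cg. Qed.

Lemma continuous_cst_fun (T : topologicalType) (a : R) (x : T) :
  {for x, continuous (fun _ : T => a)}.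
Proof. exact: cst_continuous. Qed.

Section derivatives.
Variables (N : nat) (J : set R) (F F1 F2 : R -> R) (d : R).
Hypothesis FC2 : C2_on J F F1 F2.
Let D := @radial_dom N J d.
Let q (z : 'rV[R]_N) := enorm z ^+ 2 + d.

Lemma is_derive_radial (z : 'rV[R]_N) i : D z ->
  is_derive z (delta_mx 0 i) (radial F d) (F1 (q z) * (2 * z 0 i)).
Proof.
move=> Dz; have [_ dF _ _] := FC2.
exact: is_derive_chain (dF _ Dz) (is_derive_shift_sqr d z i).
Qed.

Lemma is_derive_radial2 (z : 'rV[R]_N) i j : D z ->
  is_derive z (delta_mx 0 i) (partials [:: j] (radial F d))
    (F2 (q z) * (4 * (z 0 i * z 0 j)) + F1 (q z) * (2 *+ (i == j))).
Proof.
move=> Dz; have [oJ dF dF1 _] := FC2.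
have d1 : is_derive z (delta_mx 0 i) (fun y : 'rV[R]_N => F1 (q y)) (F2 (q z) * (2 * z 0 i)).
  exact: is_derive_chain (dF1 _ Dz) (is_derive_shift_sqr d z i).
have d2 : is_derive z (delta_mx 0 i) (fun y : 'rV[R]_N => 2 * y 0 j) (2 *+ (i == j)).
  have := is_deriveZ 2 (is_derive_coord j z (delta_mx 0 i)).
  rewrite mxE eqxx/= /GRing.scale/= eq_sym mulr_natr; exact.
have near1 : \forall y \near z, F1 (q y) * (2 * y 0 j) = partials [:: j] (radial F d) y.
  have : nbhs z D by apply: open_nbhs_nbhs; split=> //; exact: open_radial_dom.
  by apply: filterS => y Dy; have [_ e] := is_derive_radial j Dy; exact: esym e.
apply: near_eq_is_derive near1 _.
apply: is_derive_eq (is_deriveM d1 d2) _.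
by rewrite /GRing.scale/=; ring.
Qed.

Lemma radial_hess (z : 'rV[R]_N) i j : D z -> partials [:: i; j] (radial F d) z =
  F2 (q z) * (4 * (z 0 i * z 0 j)) + F1 (q z) * (2 *+ (i == j)).
Proof. by move=> /(is_derive_radial2 i j)[]. Qed.

Lemma sym_hess_radial : sym_hess D (radial F d).
Proof.
by move=> z i j Dz; rewrite !radial_hess// [z 0 i * _]mulrC eq_sym.
Qed.

Lemma continuous_comp_sqr (G : R -> R) (z : 'rV[R]_N) : {for q z, continuous G} ->
  {for z, continuous (fun y : 'rV[R]_N => G (q y))}.
Proof. by move=> cG A /cG /(@continuous_shift_sqr _ _ z). Qed.

Lemma is_derive_continuous (G : R -> R) (s dG : R) : is_derive s 1 G dG ->
  {for s, continuous G}.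
Proof. by move=> [h _]; exact/differentiable_continuous/derivable1_diffP. Qed.

Lemma class_C_radial : class_C 2 D (radial F d).
Proof.
have [oJ dF dF1 cF2] := FC2.
have coordc (z : 'rV[R]_N) i : {for z, continuous (fun y : 'rV[R]_N => y 0 i)}.
  exact: coord_continuous.
have near_cont (f g : 'rV[R]_N -> R) (z : 'rV[R]_N) : D z ->
    (forall y, D y -> g y = f y) ->
    {for z, continuous g} -> {for z, continuous f}.
  move=> Dz fg cg.
  have H : \forall y \near z, g y = f y.
    have : nbhs z D by apply: open_nbhs_nbhs; split=> //; exact: open_radial_dom.
    by apply: filterS => y Dy; rewrite fg.
  move: cg; rewrite /prop_for /continuous_at fg// => cg.
  by apply: cvg_trans cg; exact: near_eq_cvg H.
move=> [|j [|i [|? ?]]] z Dz; split=> // _.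
- exact: (continuous_comp_sqr (is_derive_continuous (dF _ Dz))).
- by move=> i; have [] := is_derive_radial i Dz.
- apply: (near_cont _ (fun y => F1 (q y) * (2 * y 0 j)) _ Dz).
    by move=> y Dy; have [_ e] := is_derive_radial j Dy; exact: esym e.
  apply: (@continuousM_fun 'rV[R]_N (fun y => F1 (q y)) (fun y => 2 * y 0 j)); last first.
    exact: cvgM (cvg_cst _) (coordc z j).
  exact: (continuous_comp_sqr (is_derive_continuous (dF1 _ Dz))).
- by move=> i; have [] := is_derive_radial2 i j Dz.
- apply: (near_cont _ (fun z => F2 (q z) * (4 * (z 0 j * z 0 i))
      + F1 (q z) * (2 *+ (j == i))) _ Dz).
    by move=> y Dy; rewrite radial_hess.
  apply: (@continuousD_fun 'rV[R]_N (fun z => F2 (q z) * (4 * (z 0 j * z 0 i)))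
     (fun z => F1 (q z) * (2 *+ (j == i)))).
    apply: (@continuousM_fun 'rV[R]_N (fun y => F2 (q y)) (fun y => 4 * (y 0 j * y 0 i))).
      exact: (continuous_comp_sqr (cF2 _ Dz)).
    apply: (@continuousM_fun 'rV[R]_N (fun=> 4) (fun y => y 0 j * y 0 i)).
      exact: continuous_cst_fun.
    exact: cvgM (coordc z j) (coordc z i).
  apply: (@continuousM_fun 'rV[R]_N (fun y => F1 (q y)) (fun=> 2 *+ (j == i))).
    exact: (continuous_comp_sqr (is_derive_continuous (dF1 _ Dz))).
  exact: continuous_cst_fun.
Qed.

Lemma laplacian_radial (z : 'rV[R]_N) : D z ->
  \sum_i partials [:: i; i] (radial F d) z =
  4 * (F2 (q z) * enorm z ^+ 2) + 2 * N%:R * F1 (q z).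
Proof.
move=> Dz; under eq_bigr do rewrite radial_hess// eqxx mulr1n.
rewrite big_split/= sumr_const card_ord sqr_enorm; congr (_ + _).
  by rewrite !mulr_sumr; apply: eq_bigr => i _; rewrite expr2; ring.
by rewrite -mulr_natl; ring.
Qed.

End derivatives.

Lemma class_CS N k (D D' : set 'rV[R]_N) f : D' `<=` D -> class_C k D f ->
  class_C k D' f.
Proof. by move=> DD h s x /DD; exact: h. Qed.

End radial.

(** * Wedge products as second-order operators, and m-positivity of radial Hessians *)

Section wedge_diffop.
Local Open Scope complex_scope.
Variable R : realType.
Local Notation C := R[i].
Local Notation Im := complex.Im.
Local Notation Re := complex.Re.
Variable n : nat.

Definition zcoord (z : 'rV[R]_(n + n)) (j : 'I_n) : C :=
  z 0 (re_idx j) +i* z 0 (im_idx j).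

Lemma tr_rank1_zcoord z : \tr (rank1 (zcoord z)) = (enorm z ^+ 2)%:C.
Proof.
rewrite sqr_enorm big_split_ord/= /mxtrace -big_split rmorph_sum/=.
apply: eq_bigr => j _; rewrite mxE /zcoord; apply/eqP; rewrite eq_complex/=.
by apply/andP; split; apply/eqP; rewrite /re_idx /im_idx; ring.
Qed.

Lemma ddc_radial (J : set R) F F1 F2 d (z : 'rV[R]_(n + n)) : C2_on J F F1 F2 ->
  radial_dom J d z ->
  ddc (radial F d) z = (2 * F1 (enorm z ^+ 2 + d))%:C *: 1%:M
    + (2 * F2 (enorm z ^+ 2 + d))%:C *: rank1 (zcoord z).
Proof.
move=> FC Dz; apply/matrixP => j k; rewrite !mxE !(radial_hess FC)//.
rewrite !(inj_eq (@lshift_inj _ _), inj_eq (@rshift_inj _ _)).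
rewrite eq_lrshift eq_rlshift !mulr0n !mulr0 !addr0 /zcoord.
set A := F1 _; set B := F2 _; set x := z 0 (re_idx j); set y := z 0 (im_idx j).
set x' := z 0 (re_idx k); set y' := z 0 (im_idx k).
by case: (j == k); apply/eqP; rewrite eq_complex/=; apply/andP; split; apply/eqP;
  rewrite ?mulr1n ?mulr0n/=; field.
Qed.

Lemma wedge_sum (I : finType) (a : I -> C) (A : I -> 'M[C]_n) l :
  (size l).+1 = n -> wedge (\sum_i a i *: A i :: l) = \sum_i a i * wedge (A i :: l).
Proof.
move=> sl; elim/big_rec2: _ => [|i x u _ <-]; last by rewrite wedge_lin.
exact: sym_multilinear0 (@wedge_sym_multilinear R n) sl.
Qed.

Lemma wedge_delta (A : 'M[C]_n) l : (size l).+1 = n ->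
  wedge (A :: l) = \sum_j \sum_k A j k * wedge (delta_mx j k :: l).
Proof.
move=> sl; rewrite [in LHS](matrix_sum_delta A) pair_bigA/= wedge_sum//.
by rewrite pair_bigA.
Qed.

(** Real coefficients of [f |-> Re (wedge (ddc f :: l))] in the coordinates [x_j], [y_j]. The factor
    [1 / 2] is the 2 of [ddc] times the [1 / 4] of [complex_hessian]; the mixed entries come from
    the product of two imaginary parts. *)
Definition wedge_coef (l : seq 'M[C]_n) (u v : 'I_(n + n)) : R :=
  match fintype.split u, fintype.split v with
  | inl j, inl k | inr j, inr k => Re (wedge (delta_mx j k :: l)) / 2
  | inl j, inr k => - Im (wedge (delta_mx j k :: l)) / 2
  | inr j, inl k => Im (wedge (delta_mx j k :: l)) / 2
  end.

Lemma Re_sum (I : finType) (F : I -> C) : Re (\sum_i F i) = \sum_i Re (F i).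
Proof. by elim/big_rec2: _ => // i x y _ <-; case: (F i) => ? ?; case: y. Qed.

Lemma wedge_diffop l (f : 'rV[R]_(n + n) -> R) z : (size l).+1 = n ->
  Re (wedge (ddc f z :: l)) = diffop (wedge_coef l) f z.
Proof.
move=> sl; rewrite wedge_delta// /diffop big_split_ord/=.
have splitl j : fintype.split (lshift n j : 'I_(n + n)) = inl j by exact: (unsplitK (inl j)).
have splitr j : fintype.split (rshift n j : 'I_(n + n)) = inr j by exact: (unsplitK (inr j)).
rewrite Re_sum -big_split; apply: eq_bigr => j _.
rewrite Re_sum [X in _ = X + _]big_split_ord [X in _ = _ + X]big_split_ord.
rewrite -[X in _ = X + _]big_split -[X in _ = _ + X]big_split -[RHS]big_split.
apply: eq_bigr => k _.
rewrite /wedge_coef !splitl !splitr !mxE /re_idx /im_idx.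
case: (wedge _) => x y /=.
move: ('D_(delta_mx 0 (lshift n j)) ('D_(delta_mx 0 (lshift n k)) f) z)
  ('D_(delta_mx 0 (rshift n j)) ('D_(delta_mx 0 (rshift n k)) f) z)
  ('D_(delta_mx 0 (lshift n j)) ('D_(delta_mx 0 (rshift n k)) f) z)
  ('D_(delta_mx 0 (rshift n j)) ('D_(delta_mx 0 (lshift n k)) f) z) => P1 P2 P3 P4.
by field.
Qed.

Lemma coef_prod_nseq i (p : C * C) : coef_prod (nseq i p) = p.1 ^+ i.
Proof. by rewrite /coef_prod big_nseq iter_mulr_1. Qed.

Lemma coef_prod_cat (l l' : seq (C * C)) :
  coef_prod (l ++ l') = coef_prod l * coef_prod l'.
Proof. by rewrite /coef_prod big_cat. Qed.

Lemma coef_der_cat (l l' : seq (C * C)) :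
  coef_der (l ++ l') = coef_der l * coef_prod l' + coef_prod l * coef_der l'.
Proof.
elim: l => [|p l IH] /=; first by rewrite /coef_prod big_nil mul0r add0r mul1r.
by rewrite IH coef_prod_cat /coef_prod big_cons; ring.
Qed.

Lemma coef_der_nseq i (p : C * C) :
  coef_der (nseq i p) = i%:R * p.1 ^+ i.-1 * p.2.
Proof.
elim: i => [|[|i] IH]; first by rewrite /= !mul0r.
  by rewrite /= /coef_prod big_nil expr0 mulr0 addr0 !mulr1 mul1r.
have -> : coef_der (nseq i.+2 p) =
  p.2 * coef_prod (nseq i.+1 p) + p.1 * coef_der (nseq i.+1 p) by [].
rewrite IH coef_prod_nseq /= -[in RHS]natr1 !exprS; ring.
Qed.

(** At order [k] the wedge product is a nonnegative multiple of [n a + k b |z| ^ 2]. This is affine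
    in [k]: nonnegative at every order if [b |z| ^ 2 >= 0], and otherwise smallest at [k = m]. *)
Lemma m_positive_rank1 m (a b : R) z : (m <= n)%N -> (0 < n)%N -> 0 <= a ->
  0 <= n%:R * a + m%:R * (b * enorm z ^+ 2) ->
  m_positive m (a%:C *: 1%:M + b%:C *: rank1 (zcoord z)).
Proof.
move=> mn n0 a0 hab; split.
  apply: hermsymmxD; apply: hermsymmxZ; apply/hermsymmxP => j k.
    by rewrite !mxE eq_sym; case: eqP => _; rewrite ?conjc1 ?conjc0.
  rewrite !mxE /zcoord; apply/eqP; rewrite eq_complex/=.
  by apply/andP; split; apply/eqP; ring.
case=> [|k] // km.
pose ab := nseq k.+1 (a%:C, b%:C) ++ nseq (n - k.+1) (2, 0 : C).
have -> : nseq k.+1 (a%:C *: 1%:M + b%:C *: rank1 (zcoord z)) ++ nseq (n - k.+1) (beta R n)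
    = [seq p.1 *: 1%:M + p.2 *: rank1 (zcoord z) | p <- ab].
  rewrite map_cat !map_nseq; congr (_ ++ nseq _ _).
  by rewrite betaE /= scale0r addr0 scalemx1.
have kn : (k.+1 <= n)%N by apply: leq_trans mn.
rewrite wedge_id_rank1//; last by rewrite size_cat !size_nseq subnKC.
rewrite coef_prod_cat coef_der_cat !coef_prod_nseq !coef_der_nseq /= !mulr0 addr0 tr_rank1_zcoord.
rewrite -[2]/(2%:R) -!(rmorph_nat (real_complex R)) -!(rmorphXn (real_complex R)).
rewrite -(fmorphV (real_complex R)) -!(rmorphM (real_complex R)) -(rmorphD (real_complex R)).
rewrite -(rmorphM (real_complex R)) ler0c mulr_ge0// ?ler0n//.
set T := 2%:R ^+ _; have T0 : 0 <= T by rewrite exprn_ge0.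
have -> : a ^+ k.+1 * T + n%:R^-1 * enorm z ^+ 2 * (k.+1%:R * a ^+ k * b * T) =
    n%:R^-1 * (a ^+ k * T * (n%:R * a + k.+1%:R * (b * enorm z ^+ 2))).
  rewrite exprS; field.
  by rewrite pnatr_eq0 -lt0n.
rewrite mulr_ge0 ?invr_ge0 ?ler0n// mulr_ge0// ?mulr_ge0 ?exprn_ge0//.
have [b0|b0] := leP 0 (b * enorm z ^+ 2).
  by rewrite addr_ge0// mulr_ge0.
apply: le_trans hab _; rewrite lerD2l; apply: ler_wnM2r; first exact: ltW.
by rewrite ler_nat; exact: km.
Qed.

End wedge_diffop.

(** * Radial m-subharmonic functions *)

Section restriction.
Variable R : realType.

Lemma test_functionS N (D D' : set 'rV[R]_N) phi : D' `<=` D ->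
  test_function D' phi -> test_function D phi.
Proof. by move=> DD [h1 h2 h3 h4]; split=> //; exact: subset_trans DD. Qed.

Lemma lintegral_restrict N (D D' : set 'rV[R]_N) (f g : 'rV[R]_N -> \bar R) :
  D' `<=` D -> (forall x, D' x -> f x = g x) ->
  (forall x, D x -> ~ D' x -> f x = 0%E) -> lintegral D f = lintegral D' g.
Proof.
move=> DD fg f0; rewrite /lintegral [LHS]integral_mkcond [RHS]integral_mkcond.
apply: eq_integral => t _; rewrite !patchE.
have [Dt|Dt] := pselect (D (row_of_tuple t)); last first.
  rewrite memNset// memNset// => /DD; exact: Dt.
rewrite mem_set//; have [Dt'|Dt'] := pselect (D' (row_of_tuple t)).
  by rewrite mem_set// fg.
by rewrite memNset// f0.
Qed.

(** A test function on [D'] is one on [D], and its second-order expressions vanish off its support,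
    so the integrals over [D] and [D'] agree. *)
Lemma m_subharmonic_restrict n m (D D' : set 'rV[R]_(n + n)) u v :
  (0 < m)%N -> (m <= n)%N -> D' `<=` D -> (forall x, D' x -> u x = v x) ->
  m_subharmonic m D u -> m_subharmonic m D' v.
Proof.
move=> m0 mn DD uv [uoo ui [usc usub] uw]; split.
- by move=> z Dz; rewrite -uv// uoo//; exact: DD.
- move=> K cK KD; have := ui K cK (subset_trans KD DD).
  apply: eq_integrable => //; last first.
    by move=> t /set_mem /= /KD Dt; rewrite uv.
  rewrite -[X in measurable X]setCK preimage_setC; apply: measurableC.
  apply: measurable_preimage_open; apply: closed_openC.
  exact: compact_closed.
- split.
    move=> x c Dx; rewrite -uv// => uc; have := usc x c (DD _ Dx) uc.
    by apply: filterS => y h Dy; rewrite -uv//; apply: h; exact: DD.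
  move=> K h cK KD ch hh bd x Kx; rewrite -uv; last exact: KD.
  apply: (usub K h cK (subset_trans KD DD) ch hh _ x Kx) => y Ky nKy.
  by rewrite uv; [exact: bd|exact: KD].
- move=> alpha sa ha phi tphi.
  rewrite -(@lintegral_restrict _ D D' (fun z => u z *
     (complex.Re (wedge (ddc phi z :: alpha ++ nseq (n - m) (beta R n))))%:E)%E)//.
  + exact: (uw alpha sa ha phi (test_functionS DD tphi)).
  + by move=> x Dx; rewrite uv.
  + have [S [kS cS SD pS]] := test_function_supp tphi.
    move=> x Dx Dx'; rewrite wedge_diffop; last first.
      by rewrite size_cat size_nseq sa -addSn prednK// subnKC.
    by rewrite (vanish_off_diffop _ cS pS) ?mule0// => /SD.
Qed.

End restriction.

Section radial_m_subharmonic.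
Local Open Scope complex_scope.
Variables (R : realType) (n m : nat).
Hypotheses (m_gt0 : (0 < m)%N) (m_le_n : (m <= n)%N).

Let n_gt0 : (0 < n)%N. Proof. exact: leq_trans m_le_n. Qed.

(** The hypothesis carries [s F2 s] with [s = |z| ^ 2 + d], whereas the Hessian produces
    [|z| ^ 2 F2 s]. When [F2 s < 0] the smaller factor helps, and otherwise the term is nonnegative:
    the shift preserves m-positivity. *)
Lemma m_positive_radial (J : set R) F F1 F2 d (z : 'rV[R]_(n + n)) :
  C2_on J F F1 F2 -> radial_dom J d z -> 0 <= d ->
  (forall s, J s -> 0 <= F1 s) ->
  (forall s, J s -> 0 <= n%:R * F1 s + m%:R * (s * F2 s)) ->
  m_positive m (ddc (radial F d) z).
Proof.
move=> FC Dz d0 h1 h2; rewrite (ddc_radial FC Dz); apply: m_positive_rank1 => //.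
  by rewrite mulr_ge0// h1.
set s := enorm z ^+ 2 + d; have qs : enorm z ^+ 2 <= s by rewrite lerDl.
have q0 : 0 <= enorm z ^+ 2 by exact: sqr_ge0.
rewrite (_ : _ + _ = 2 * (n%:R * F1 s + m%:R * (F2 s * enorm z ^+ 2))); last by ring.
rewrite mulr_ge0//.
have [F20|F20] := leP 0 (F2 s).
  by rewrite addr_ge0// mulr_ge0// ?h1// mulr_ge0.
apply: le_trans (h2 s Dz) _; rewrite lerD2l ler_wpM2l// mulrC.
by apply: ler_wnM2l => //; exact: ltW.
Qed.

Lemma size_wedge_tail (alpha : seq 'M[R[i]]_n) : size alpha = m.-1 ->
  (size (alpha ++ nseq (n - m) (beta R n))).+1 = n.
Proof. by move=> sa; rewrite size_cat size_nseq sa -addSn prednK// subnKC. Qed.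

Lemma weak_ge0_C2 (D : set 'rV[R]_(n + n)) w (alpha : seq 'M[R[i]]_n) phi :
  class_C 2 D w -> sym_hess D w -> (forall z, D z -> m_positive m (ddc w z)) ->
  size alpha = m.-1 -> (forall A, A \in alpha -> m_positive m A) ->
  test_function D phi ->
  (0 <= lintegral D (fun z => (w z)%:E *
     (complex.Re (wedge (ddc phi z :: alpha ++ nseq (n - m) (beta R n))))%:E))%E.
Proof.
move=> Cw sw pw sa ha tphi; have st := size_wedge_tail sa.
rewrite (_ : (fun z => _) = (fun z => (w z)%:E *
   (diffop (wedge_coef (alpha ++ nseq (n - m) (beta R n))) phi z)%:E)%E); last first.
  by apply/funext => z; rewrite wedge_diffop.
apply: diffop_weak_ge0 => // z Dz; rewrite -wedge_diffop// -cat_cons.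
apply: wedge_m_positive => //; first by rewrite /= sa prednK.
by move=> A; rewrite inE => /predU1P[->|]; [exact: pw|exact: ha].
Qed.

Lemma enorm_eq0 N (z : 'rV[R]_N) : (enorm z == 0) = (z == 0).
Proof.
rewrite -[LHS](@expf_eq0 _ _ 2)/= sqr_enorm psumr_eq0; last by move=> i _; exact: sqr_ge0.
apply/allP/eqP => [h|-> i _]; last by rewrite /= mxE expr0n/= eqxx.
by apply/rowP => i; have := h i (mem_index_enum _); rewrite /= expf_eq0/= mxE => /eqP.
Qed.

Lemma norm_le_enorm N (z : 'rV[R]_N) : `|z| <= enorm z.
Proof.
rewrite [leLHS]/Num.Def.normr /= mx_normrE; apply: bigmax_le => [|[k j] _ /=].
  exact: sqrtr_ge0.
rewrite ord1 -sqrtr_sqr ler_sqrt// ?sumr_ge0// => [|i _]; last exact: sqr_ge0.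
by rewrite (bigD1 j)//= lerDl sumr_ge0// => i _; exact: sqr_ge0.
Qed.

(** * Extension of a radial function across the origin *)

Section extension.
Variables (F F1 F2 : R -> R) (s0 C : R).
Let J : set R := `]0, s0[%classic.
Hypothesis s0_01 : 0 < s0 <= 1.
Hypothesis FC : C2_on J F F1 F2.
Hypothesis F1_ge0 : forall s, J s -> 0 <= F1 s.
Hypothesis F12_ge0 : forall s, J s -> 0 <= n%:R * F1 s + m%:R * (s * F2 s).
Hypothesis F_le0 : forall s, J s -> F s <= 0.
Hypothesis C_gt0 : 0 < C.
Hypothesis F_bound : forall s, J s -> `|F s| <= C * ((Num.sqrt s)^-1) ^+ (n + n).-1.
Hypothesis F_ninfty : forall M, exists2 s1, 0 < s1 & forall s, 0 < s < s1 -> F s < M.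
Variable e : R.
Hypothesis e_gt0 : 0 < e.
(** Half of the interval [J] is left free for the shifts [d <= s0 / 2]. *)
Hypothesis e_s0 : e ^+ 2 <= s0 / 2.

Definition radial_ext (z : 'rV[R]_(n + n)) : \bar R :=
  if z == 0 then -oo%E else (radial F 0 z)%:E.

Let s0_gt0 : 0 < s0. Proof. by case/andP: s0_01. Qed.

Let sq_lt (z : 'rV[R]_(n + n)) : eball e z -> enorm z ^+ 2 < s0 / 2.
Proof.
move=> ze; apply: lt_le_trans e_s0.
by rewrite ltr_pXn2r// ?nnegrE ?sqrtr_ge0// ltW.
Qed.

Let dom0 (z : 'rV[R]_(n + n)) : eball e z -> z <> 0 -> radial_dom J 0 z.
Proof.
move=> ze z0; rewrite /radial_dom/= addr0 /J/= in_itv/=; apply/andP; split.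
  by rewrite exprn_gt0// lt_neqAle sqrtr_ge0 andbT eq_sym enorm_eq0; apply/eqP.
by apply: lt_trans (sq_lt ze) _; move: s0_gt0; lra.
Qed.

Let domd (z : 'rV[R]_(n + n)) d : eball e z -> 0 < d <= s0 / 2 -> radial_dom J d z.
Proof.
move=> ze /andP[d0 ds]; rewrite /radial_dom/= /J/= in_itv/=; apply/andP; split.
  by rewrite ltr_wpDl// sqr_ge0.
by have := sq_lt ze; move: ds; lra.
Qed.

Let F_mono a b : J a -> J b -> a <= b -> F a <= F b.
Proof.
rewrite /J /= !in_itv/= => /andP[a0 as0] /andP[b0 bs0] ab.
have [_ dF _ _] := FC.
have JJ x : x \in `[a, b] -> J x.
  rewrite in_itv/= => /andP[ax xb]; rewrite /J/= in_itv/=.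
  by rewrite (lt_le_trans a0 ax) (le_lt_trans xb bs0).
have h1 x : x \in `]a, b[ -> is_derive x 1 F (F1 x).
  by move=> xab; apply: dF; apply: JJ; exact: subset_itv_oo_cc xab.
have h2 : {within `[a, b], continuous F}.
  by apply: derivable_within_continuous => y yab; have [] := dF _ (JJ _ yab).
have [c cab E] := MVT_segment ab h1 h2.
by rewrite -subr_ge0 E mulr_ge0 ?subr_ge0// F1_ge0//; exact: JJ.
Qed.

Let class_C_ext : class_C 2 (radial_dom J 0) (@radial R (n + n) F 0).
Proof. exact: class_C_radial FC. Qed.

Let oJ : open J. Proof. by case: FC. Qed.

Lemma open_eball : open (@eball R (n + n) e).
Proof.
rewrite (_ : eball _ = @radial_dom R (n + n) [set s | s < e ^+ 2] 0).
  by apply: open_radial_dom; exact: open_lt.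
apply/seteqP; split=> z; rewrite /radial_dom /eball/= addr0.
  by move=> h; rewrite ltr_pXn2r// ?nnegrE ?sqrtr_ge0// ltW.
by rewrite ltr_pXn2r// ?nnegrE ?sqrtr_ge0// ltW.
Qed.

Lemma radial_ext_lintegrable : lintegrable (@eball R (n + n) e) radial_ext.
Proof.
have mB := measurable_preimage_open open_eball.
apply: (@integrable_pole _ _ _ _ C) => //.
- by rewrite addn_gt0 n_gt0.
(* Measurability is glued from the origin, where the function is [-oo], and its complement, where it
   is continuous. *)
- have [_ m0] := @lebesgue_tuple_point R (n + n) 0 (ltn_addr _ n_gt0).
  set P := _ @^-1` _ in mB *; set Z := _ @^-1` [set 0] in m0.
  rewrite -(setUIDK P Z); apply/measurable_funU; [exact: measurableI|exact: measurableD|split].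
    apply: (eq_measurable_fun (cst -oo%E)); last exact: measurable_cst.
    by move=> t /set_mem[_ /= t0]; rewrite /radial_ext t0 eqxx.
  apply: (eq_measurable_fun (EFin \o (radial F 0 \o @row_of_tuple R (n + n)))).
    by move=> t /set_mem[_ /= t0]; rewrite /radial_ext; case: eqP.
  apply/measurable_EFinP.
  apply: (@measurable_funS _ _ _ _ (@row_of_tuple R (n + n) @^-1` (@radial_dom R (n + n) J 0))).
  + by apply: measurable_preimage_open; exact: open_radial_dom.
  + by move=> t [Pt t0]; exact: dom0.
  + apply: measurable_continuous_on; first exact: open_radial_dom.
    by move=> x Dx; exact: (class_C_ext [::] Dx).1.
- move=> z ze; apply: le_trans (norm_le_enorm z) _.
  have : enorm z ^+ 2 <= 1 by have := sq_lt ze; case/andP: s0_01; lra.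
  by rewrite -[X in _ <= X](expr1n _ 2) ler_pXn2r ?nnegrE ?sqrtr_ge0.
- move=> z ze z0; rewrite /radial_ext; case: eqP => // _.
  have Dz := dom0 ze z0; rewrite abse_EFin lee_fin.
  apply: le_trans (F_bound Dz) _; rewrite ler_pM2l//.
  have ez : 0 < `|z| by rewrite normr_gt0; apply/eqP.
  apply: lerXn2r; rewrite ?nnegrE ?invr_ge0 ?sqrtr_ge0//.
  rewrite addr0 sqrtr_sqr ger0_norm ?sqrtr_ge0//.
  rewrite lef_pV2 ?posrE//; first exact: norm_le_enorm.
  exact: lt_le_trans ez (norm_le_enorm z).
Qed.

Lemma radial_ext_usc : usc_on (@eball R (n + n) e) radial_ext.
Proof.
move=> x c ex; rewrite /radial_ext; case: eqP => [->|x0] hc.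
  have [s1 s10 hs1] := F_ninfty c.
  have : nbhs (0 : 'rV[R]_(n + n)) (radial_dom [set s | s < s1] 0).
    apply: open_nbhs_nbhs; split; first by apply: open_radial_dom; exact: open_lt.
    by rewrite /radial_dom/= addr0 (eqP (_ : enorm 0 == 0)) ?expr0n// enorm_eq0.
  apply: filterS => y; rewrite /radial_dom/= => ys ey.
  case: eqP => [_|y0]; first by rewrite ltNyr.
  rewrite lte_fin; apply: hs1; rewrite ys andbT.
  by have := dom0 ey y0; rewrite /radial_dom /J/= in_itv/= => /andP[].
have cF := (@class_C_ext [::] x (dom0 ex x0)).1 isT.
have : nbhs (radial F 0 x) [set y | y < c].
  by apply: open_nbhs_nbhs; split; [exact: open_lt|rewrite /= -lte_fin].
move=> /cF h.
apply: (filterS _ (h : nbhs x (radial F 0 @^-1` [set y | y < c]))) => y /= yc ey.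
by case: eqP => // _; rewrite ltNyr.
Qed.

Lemma radial_ext_subharmonic : subharmonic (@eball R (n + n) e) radial_ext.
Proof.
apply: subharmonic_locally_C2; first by rewrite addn_gt0 n_gt0.
  exact: radial_ext_usc.
move=> x ex; have [->|/eqP x0] := eqVneq x 0.
  by left; rewrite /radial_ext eqxx.
right; have Dx := dom0 ex x0.
exists (radial_dom J 0), (radial F 0); split=> //.
- exact: open_radial_dom.
- move=> y; rewrite /radial_ext; case: eqP => // ->.
  rewrite /radial_dom/= addr0 /J/= (eqP (_ : enorm 0 == 0)) ?enorm_eq0//.
  by rewrite expr0n in_itv/= ltxx.
- rewrite (laplacian_radial FC Dx) addr0.
  rewrite /radial_dom/= addr0 in Dx.
  set s := enorm x ^+ 2 in Dx *.
  have h1 := F1_ge0 Dx; have h2 := F12_ge0 Dx.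
  have s_gt0 : 0 < s by move: Dx; rewrite /J/= in_itv/= => /andP[].
  (* The real dimension [2 n] makes the Laplacian four times the case [m = 1] of the hypothesis; for
     negative [s F2 s] the hypothesis is stronger as [m >= 1]. *)
  rewrite natrD (_ : _ + _ = 4 * (n%:R * F1 s + s * F2 s)); last by ring.
  rewrite mulr_ge0//; have [F20|F20] := leP 0 (s * F2 s).
    by rewrite addr_ge0// mulr_ge0.
  apply: le_trans h2 _; rewrite lerD2l -[leRHS]mul1r; apply: ler_wnM2r; first exact: ltW.
  by rewrite ler1n.
Qed.

Lemma radial_ext_weak (alpha : seq 'M[R[i]]_n) phi : size alpha = m.-1 ->
  (forall A, A \in alpha -> m_positive m A) ->
  test_function (@eball R (n + n) e) phi ->
  (0 <= lintegral (@eball R (n + n) e) (fun z => radial_ext z *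
     (complex.Re (wedge (ddc phi z :: alpha ++ nseq (n - m) (beta R n))))%:E))%E.
Proof.
move=> sa ha tphi; have st := size_wedge_tail sa.
pose D := @eball R (n + n) e; pose P := @row_of_tuple R (n + n) @^-1` D.
pose T := diffop (wedge_coef (alpha ++ nseq (n - m) (beta R n))) phi.
have TE z : complex.Re (wedge (ddc phi z :: alpha ++ nseq (n - m) (beta R n))) = T z.
  by rewrite wedge_diffop.
under [X in lintegral _ X]eq_fun do rewrite TE.
have [S [kS cS SD pS]] := test_function_supp tphi.
have [Cphi _ _ _] := tphi.
have cT : continuous T by move=> x; exact: (@diffop_continuous R _ _ setT phi x (Cphi 2%N) I).
have sT : compact_supp T by exact: compact_supp_vanish_off kS (vanish_off_diffop _ cS pS).
have [M M0 hM] : exists2 M : R, 0 <= M & forall x, `|T x| <= M.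
  have [r r0 hr] := sT; have [M M0 hM] := bounded_cube r cT; exists M => // x.
  by have [xr|xr] := leP `|x| r; [exact: hM|rewrite hr// normr0].
have mP : measurable P by apply: measurable_preimage_open; exact: open_eball.
(* Shifts tending to 0 that keep the argument of [F] inside [J] on the whole ball, the origin
   included. *)
pose dl (k : nat) : R := s0 / 2 * harmonic k.
have dl_in k : 0 < dl k <= s0 / 2.
  rewrite /dl /harmonic; apply/andP; split; first by rewrite mulr_gt0 ?divr_gt0// invr_gt0.
  apply: ler_piMr; first by rewrite divr_ge0// ltW.
  by rewrite invf_le1// ler1n.
pose f_ (k : nat) (t : (n + n).-tuple (measurableTypeR R)) : \bar R :=
  ((radial F (dl k) (row_of_tuple t))%:E * (T (row_of_tuple t))%:E)%E.
pose f (t : (n + n).-tuple (measurableTypeR R)) : \bar R :=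
  (radial_ext (row_of_tuple t) * (T (row_of_tuple t))%:E)%E.
pose g (t : (n + n).-tuple (measurableTypeR R)) : \bar R :=
  (M%:E * (abse \o (radial_ext \o @row_of_tuple R (n + n))) t)%E.
have Cd k : class_C 2 D (@radial R (n + n) F (dl k)).
  have h := @class_C_radial R (n + n) J F F1 F2 (dl k) FC.
  by apply: class_CS h => z ze; apply: domd => //; exact: dl_in.
have fk0 k : (0 <= \int[lebesgue_tuple R (n + n)]_(t in P) f_ k t)%E.
  have := @weak_ge0_C2 D (radial F (dl k)) alpha phi (Cd k) _ _ sa ha tphi.
  under [X in lintegral _ X]eq_fun do rewrite TE.
  apply.
    by move=> z i j ze; apply: (sym_hess_radial FC); exact: domd.
  move=> z ze; apply: (m_positive_radial FC) => //; first exact: domd.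
  by case/andP: (dl_in k) => /ltW.
have mT : measurable_fun P (EFin \o (T \o @row_of_tuple R (n + n))).
  by apply/measurable_EFinP/measurable_funTS; exact: measurable_continuous.
have intv := radial_ext_lintegrable.
have [] := @dominated_convergence _ _ _ (lebesgue_tuple R (n + n)) P mP f_ f g.
- move=> k; apply: emeasurable_funM => //; apply/measurable_EFinP.
  apply: (measurable_continuous_on open_eball) => x ex.
  exact: (Cd k [::] x ex).1.
- by apply: emeasurable_funM => //; case/integrableP: intv.
- apply: (@ae_neq_point _ _ 0); first by rewrite addn_gt0 n_gt0.
  move=> t t0 Pt; rewrite /f_ /f /radial_ext; case: eqP => // _.
  rewrite -EFinM; apply: cvg_EFin; first by apply: nearW.
  have -> : (fine \o (fun k => ((radial F (dl k) (row_of_tuple t))%:E *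
      (T (row_of_tuple t))%:E)%E)) = (fun k => radial F (dl k) (row_of_tuple t) * T (row_of_tuple t)).
    by apply/funext.
  apply: cvgM; last exact: cvg_cst.
  have cF : {for enorm (row_of_tuple t) ^+ 2 + 0, continuous F}.
    have [_ dF _ _] := FC.
    exact: is_derive_continuous (dF _ (dom0 Pt t0)).
  apply: (@cvg_comp _ _ _ (fun k => enorm (row_of_tuple t) ^+ 2 + dl k) F); last exact: cF.
  apply: cvgD; first exact: cvg_cst.
  rewrite -[X in _ --> X](mulr0 (s0 / 2)); apply: cvgM; first exact: cvg_cst.
  exact: cvg_harmonic.
- exact: (integrableZl mP M (integrable_abse intv)).
- apply: (@ae_neq_point _ _ 0); first by rewrite addn_gt0 n_gt0.
  move=> t t0 k Pt; rewrite /f_ /g /= /radial_ext; case: eqP => // _.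
  rewrite lee_fin normrM mulrC.
  apply: ler_pM => //.
  (* [F] is nonpositive and nondecreasing, so the shifted value lies between [F s] and 0. *)
  have J0 := dom0 Pt t0; have J1 := domd Pt (dl_in k).
  rewrite !ler0_norm ?F_le0// lerN2; apply: F_mono => //.
  by rewrite lerD2l; case/andP: (dl_in k) => /ltW.
move=> _ _ cvgf; rewrite /lintegral -/D -/P.
rewrite -(cvg_lim _ cvgf)//; apply: lime_ge; first by apply/cvg_ex; eexists; exact: cvgf.
exact: nearW.
Qed.

Lemma radial_ext_m_subharmonic : m_subharmonic m (@eball R (n + n) e) radial_ext.
Proof.
split.
- by move=> z _; rewrite /radial_ext; case: eqP => // _; rewrite ?ltry.
- move=> K cK KD; apply: integrableS radial_ext_lintegrable => //.
  + exact: measurable_preimage_open open_eball.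
  + rewrite -[X in measurable X]setCK preimage_setC; apply: measurableC.
    apply: measurable_preimage_open; apply: closed_openC.
    exact: compact_closed.
  + by move=> t /KD.
- exact: radial_ext_subharmonic.
- move=> alpha sa ha phi tphi; exact: radial_ext_weak.
Qed.

End extension.
End radial_m_subharmonic.

(** * Asymptotics of the logarithmic family *)

Section asymptotics.
Variable R : realType.

(** At [y = 1 / L] with [L = - ln s], the derivative of [a L - g ln L] in [L]. *)
Definition slope (a g y : R) : R := a - g * y.

(** For [c = (n - m) / m] this carries the sign of [n F' + m s F''], by [Flog_convexity]. *)
Definition convexity (c a g y : R) : R :=
  (c - slope a g y) * slope a g y - g * y ^+ 2.

Lemma norm_mul_small (g eta : R) : 0 < eta -> exists2 y0 : R, 0 < y0 <= 1 &
  forall y, 0 < y <= y0 -> `|g * y| <= eta /\ `|g * y ^+ 2| <= eta.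
Proof.
move=> eta0; have g1 : 0 < `|g| + 1 by rewrite ltr_wpDl.
exists (Num.min 1 (eta / (`|g| + 1))).
  by rewrite lt_min ltr01 divr_gt0//= ge_min lexx.
move=> y /andP[y0]; rewrite le_min => /andP[y1].
rewrite ler_pdivlMr// => yg.
have h : `|g * y| <= eta.
  rewrite normrM (gtr0_norm y0); apply: le_trans yg; rewrite mulrC.
  by rewrite ler_pM2l// lerDl.
split=> //; rewrite expr2 mulrA normrM (gtr0_norm y0).
by apply: le_trans h; rewrite ler_piMr.
Qed.

Lemma convexity_ge0 (c a g : R) : 0 < c ->
  (0 < a < c) \/ (a = c /\ 0 <= g) \/ (a = 0 /\ g <= 0) ->
  exists2 y0 : R, 0 < y0 <= 1 & forall y, 0 < y <= y0 ->
    0 <= slope a g y /\ 0 <= convexity c a g y.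
Proof.
move=> c0 [/andP[a0 ac]|[[-> g0]|[-> g0]]]; rewrite /convexity /slope.
(* The first two bounds keep each factor above half its limit; the third is the product of these
   halves and controls [g y ^ 2]. *)
- pose eta := Num.min (a / 2) (Num.min ((c - a) / 2) (a * (c - a) / 4)).
  have ca0 : 0 < c - a by rewrite subr_gt0.
  have eta0 : 0 < eta by rewrite /eta !lt_min !divr_gt0// mulr_gt0.
  have [y0 hy0 h] := norm_mul_small g eta0; exists y0 => // y hy.
  have [h1 h2] := h y hy; move: h1 h2; rewrite !ler_norml => /andP[h1 h2] /andP[h3 h4].
  have e1 : eta <= a / 2 by rewrite ge_min lexx.
  have e2 : eta <= (c - a) / 2 by rewrite /eta !ge_min lexx orbT.
  have e3 : eta <= a * (c - a) / 4 by rewrite /eta !ge_min lexx !orbT.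
  have w1 : a / 2 <= a - g * y by lra.
  have w2 : (c - a) / 2 <= c - (a - g * y) by lra.
  split; first by apply: le_trans w1; rewrite divr_ge0// ltW.
  have p1 : 0 <= a / 2 by rewrite divr_ge0// ltW.
  have p2 : 0 <= (c - a) / 2 by rewrite divr_ge0// ltW.
  have := ler_pM p2 p1 w2 w1.
  by nra.
- have g1 : 0 < g + 1 by rewrite ltr_wpDl.
  exists (Num.min 1 (c / (g + 1))).
    by rewrite lt_min ltr01 divr_gt0//= ge_min lexx.
  move=> y /andP[y0]; rewrite le_min => /andP[y1]; rewrite ler_pdivlMr// => yg.
  have gy : 0 <= g * y by rewrite mulr_ge0// ltW.
  have yg' : g * y + y <= c by move: yg; rewrite mulrDr mulr1 mulrC.
  split; first by lra.
  rewrite (_ : _ - _ = (g * y) * (c - (g * y + y))); last by ring.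
  by rewrite mulr_ge0// subr_ge0.
- have [y0 hy0 h] := norm_mul_small g c0; exists y0 => // y /andP[yp yy0].
  have [|h1 _] := h y; first by rewrite yp.
  move: h1; rewrite ler_norml => /andP[h1 h2].
  have gy : g * y <= 0 by rewrite mulr_le0_ge0// ltW.
  split; first by lra.
  rewrite (_ : _ - _ = (- (g * y)) * (c + g * y + y)); last by ring.
  by rewrite mulr_ge0//; lra.
Qed.

(** The last two cases also have a negative slope, that is [F' < 0]; as [convexity] is negative
    there too, one test form serves all four cases. *)
Lemma convexity_lt0 (c a g : R) : 0 < c ->
  c < a \/ (a = c /\ g < 0) \/ (a = 0 /\ 0 < g) \/ a < 0 ->
  exists2 y0 : R, 0 < y0 <= 1 & forall y, 0 < y <= y0 -> convexity c a g y < 0.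
Proof.
move=> c0 [ca|[[-> g0]|[[-> g0]|a0]]]; rewrite /convexity /slope.
- pose eta := Num.min (a / 2) (Num.min ((a - c) / 2) (a * (a - c) / 8)).
  have a0 : 0 < a by exact: lt_trans ca.
  have ca0 : 0 < a - c by rewrite subr_gt0.
  have aca : 0 < a * (a - c) by rewrite mulr_gt0.
  have eta0 : 0 < eta by rewrite /eta !lt_min !divr_gt0.
  have [y0 hy0 h] := norm_mul_small g eta0; exists y0 => // y hy.
  have [h1 h2] := h y hy; move: h1 h2; rewrite !ler_norml => /andP[h1 h2] /andP[h3 h4].
  have e1 : eta <= a / 2 by rewrite ge_min lexx.
  have e2 : eta <= (a - c) / 2 by rewrite /eta !ge_min lexx orbT.
  have e3 : eta <= a * (a - c) / 8 by rewrite /eta !ge_min lexx !orbT.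
  have w1 : a / 2 <= a - g * y by lra.
  have w2 : (a - c) / 2 <= (a - g * y) - c by lra.
  have p1 : 0 <= a / 2 by rewrite divr_ge0// ltW.
  have p2 : 0 <= (a - c) / 2 by rewrite divr_ge0// ltW.
  have := ler_pM p2 p1 w2 w1.
  by nra.
- have g1 : 0 < `|g + 1| + 1 by rewrite ltr_wpDl.
  have [y0 hy0 h] := norm_mul_small (g + 1) (divr_gt0 c0 (ltr0Sn R 1)).
  exists y0 => // y hy; have [h1 _] := h y hy.
  have yp : 0 < y by case/andP: hy.
  move: h1; rewrite ler_norml => /andP[_ h1].
  rewrite (_ : _ - _ = (g * y) * (c - (g + 1) * y)); last by ring.
  by rewrite nmulr_rlt0 ?nmulr_rlt0//; lra.
- exists 1; first by rewrite ltr01 lexx.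
  move=> y /andP[y0 _].
  rewrite (_ : _ - _ = - ((g * y) * (c + g * y + y))); last by ring.
  by rewrite oppr_lt0 !mulr_gt0// !addr_gt0// mulr_gt0.
(* The slope [w] is at most [a / 2 < 0], so [(c - w) w <= c w <= c a / 2], which outweighs
   [g y ^ 2]. *)
- pose eta := Num.min (- a / 2) (- (c * a) / 8).
  have ca0 : 0 < - (c * a) by rewrite oppr_gt0 pmulr_rlt0.
  have eta0 : 0 < eta by rewrite /eta lt_min !divr_gt0// oppr_gt0.
  have [y0 hy0 h] := norm_mul_small g eta0; exists y0 => // y hy.
  have [h1 h2] := h y hy; move: h1 h2; rewrite !ler_norml => /andP[h1 h2] /andP[h3 h4].
  have e1 : eta <= - a / 2 by rewrite ge_min lexx.
  have e2 : eta <= - (c * a) / 8 by rewrite /eta ge_min lexx orbT.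
  have w1 : a - g * y <= a / 2 by lra.
  by nra.
Qed.

Lemma ln_le_linear (k eta : R) : 0 <= k -> 0 < eta -> exists2 K : R, 0 <= K &
  forall x, 0 < x -> k * ln x <= eta * x + K.
Proof.
(* From [ln (x / p) <= x / p], with [eta x = (k + 1) (x / p)]; the added 1 keeps [p] positive when
   [k = 0]. *)
move=> k0 eta0; pose p := (k + 1) / eta.
have p0 : 0 < p by rewrite divr_gt0// ltr_wpDl.
exists (k * `|ln p|); first by rewrite mulr_ge0.
move=> x x0; have xp : 0 < x / p by rewrite divr_gt0.
have -> : ln x = ln (x / p) + ln p by rewrite -lnM ?posrE// divfK// gt_eqF.
rewrite mulrDr lerD//; last by rewrite ler_wpM2l// ler_norm.
have h : k * ln (x / p) <= k * (x / p) by rewrite ler_wpM2l// ltW// ln_sublinear.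
apply: le_trans h _.
have -> : eta * x = (k + 1) * (x / p).
  have k1 : k + 1 != 0 by rewrite gt_eqF// ltr_wpDl.
  by rewrite /p; field; rewrite k1 gt_eqF.
by rewrite ler_wpM2r ?ler_wpDr// ?lerDl// ltW.
Qed.

(** The logarithm of [s ^ - a (- ln s) ^ - g]; in exponential form each derivative is a rational
    expression times the same exponential. *)
Definition log_exponent (a g s : R) : R := a * (- ln s) - g * ln (- ln s).

Definition Flog (a g s : R) : R := - expR (log_exponent a g s).
Definition Flog1 (a g s : R) : R :=
  expR (log_exponent a g s) * slope a g (- ln s)^-1 * s^-1.
Definition Flog2 (a g s : R) : R := - (expR (log_exponent a g s) *
  (slope a g (- ln s)^-1 * slope a g (- ln s)^-1 + slope a g (- ln s)^-1
   + g * ((- ln s)^-1 * (- ln s)^-1)) * (s^-1 * s^-1)).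

Section derivatives.
Variables (a g s : R).
Hypothesis s01 : 0 < s < 1.

Let s0 : 0 < s. Proof. by case/andP: s01. Qed.
Let L0 : 0 < - ln s. Proof. by rewrite oppr_gt0 ln_lt0. Qed.

Lemma is_derive_inv (x : R) : x != 0 -> is_derive x 1 (fun y : R => y^-1) (- (x^-1 * x^-1)).
Proof.
move=> x0; have h := @is_deriveV R id x 1 1 x0 (is_derive_id x 1).
by apply: is_derive_eq h _; rewrite /GRing.scale/= mulr1 -exprVn expr2.
Qed.

Lemma is_derive_negln : is_derive s 1 (fun y : R => - ln y) (- s^-1).
Proof. exact: is_deriveN (is_derive1_ln s0). Qed.

Lemma is_derive_log_exponent :
  is_derive s 1 (log_exponent a g) (- (slope a g (- ln s)^-1 * s^-1)).
Proof.
have d1 := is_derive_negln.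
have d2 : is_derive s 1 (fun y : R => ln (- ln y)) ((- ln s)^-1 * - s^-1).
  exact: (@is_derive1_comp R (@ln R) (fun y => - ln y) s _ _ (is_derive1_ln L0) d1).
have := is_deriveB (is_deriveZ a d1) (is_deriveZ g d2).
by move=> h; apply: is_derive_eq h _; rewrite /slope /GRing.scale/=; ring.
Qed.

Lemma is_derive_expR_log_exponent :
  is_derive s 1 (fun y => expR (log_exponent a g y))
    (expR (log_exponent a g s) * - (slope a g (- ln s)^-1 * s^-1)).
Proof.
exact: (@is_derive1_comp R (@expR R) (log_exponent a g) s _ _ (is_derive_expR _)
  is_derive_log_exponent).
Qed.

Lemma is_derive_inv_negln :
  is_derive s 1 (fun y : R => (- ln y)^-1) ((- ln s)^-1 * (- ln s)^-1 * s^-1).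
Proof.
have L1 : - ln s != 0 by rewrite gt_eqF.
have := @is_derive1_comp R (fun y => y^-1) (fun y => - ln y) s _ _ (is_derive_inv L1) is_derive_negln.
by move=> h; apply: is_derive_eq h _; rewrite mulrNN.
Qed.

Lemma is_derive_slope :
  is_derive s 1 (fun y : R => slope a g (- ln y)^-1)
    (- (g * ((- ln s)^-1 * (- ln s)^-1 * s^-1))).
Proof.
have := is_deriveB (is_derive_cst a s 1) (is_deriveZ g is_derive_inv_negln).
by move=> h; apply: is_derive_eq h _; rewrite /GRing.scale/= sub0r.
Qed.

Lemma is_derive_Flog : is_derive s 1 (Flog a g) (Flog1 a g s).
Proof.
apply: is_derive_eq (is_deriveN is_derive_expR_log_exponent) _.
by rewrite /Flog1; ring.
Qed.

Lemma is_derive_Flog1 : is_derive s 1 (Flog1 a g) (Flog2 a g s).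
Proof.
have sn0 : s != 0 by rewrite gt_eqF.
apply: is_derive_eq (is_deriveM (is_deriveM is_derive_expR_log_exponent is_derive_slope)
  (is_derive_inv sn0)) _.
by rewrite /Flog2 /GRing.scale/= mulrfctE; ring.
Qed.

Lemma derivable_Flog2 : derivable (Flog2 a g) s 1.
Proof.
have sn0 : s != 0 by rewrite gt_eqF.
have dw := is_derive_slope; have dl := is_derive_inv_negln.
have dq := is_deriveD (is_deriveD (is_deriveM dw dw) dw) (is_deriveZ g (is_deriveM dl dl)).
have ds := is_derive_inv sn0.
by have [] := is_deriveN (is_deriveM (is_deriveM is_derive_expR_log_exponent dq) (is_deriveM ds ds)).
Qed.

End derivatives.

Lemma Flog_convexity (n m : nat) (a g s : R) : (0 < m)%N -> (m <= n)%N -> 0 < s ->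
  n%:R * Flog1 a g s + m%:R * (s * Flog2 a g s) =
  m%:R * (expR (log_exponent a g s) * s^-1) *
    convexity ((n - m)%:R / m%:R) a g (- ln s)^-1.
Proof.
move=> m0 mn s0; rewrite /Flog1 /Flog2 /convexity natrB//.
set E := expR _; set w := slope _ _ _; set y := (- ln s)^-1.
have mR : m%:R != 0 :> R by rewrite pnatr_eq0 -lt0n.
by field; rewrite mR gt_eqF.
Qed.

End asymptotics.

(** * The logarithmic family *)

Section log_family.
Variable R : realType.

Lemma C2_on_Flog (a g s0 : R) : s0 <= 1 ->
  C2_on (`]0, s0[%classic : set R) (Flog a g) (Flog1 a g) (Flog2 a g).
Proof.
move=> s01; have h s : (`]0, s0[%classic : set R) s -> 0 < s < 1.
  by rewrite /= in_itv/= => /andP[-> /lt_le_trans]; exact.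
split; first exact: interval_open.
- by move=> s /h; exact: is_derive_Flog.
- by move=> s /h; exact: is_derive_Flog1.
- move=> s /h s1; apply/differentiable_continuous/derivable1_diffP.
  exact: derivable_Flog2.
Qed.

Lemma inv_negln_small (y0 s : R) : 0 < y0 -> 0 < s < expR (- y0^-1) ->
  0 < (- ln s)^-1 <= y0.
Proof.
move=> y00 /andP[s0]; rewrite -[X in X < _]lnK ?posrE// ltr_expR => h.
have h1 : y0^-1 < - ln s by rewrite ltrNr.
have L0 : 0 < - ln s by apply: lt_trans h1; rewrite invr_gt0.
by rewrite invr_gt0 L0/= invf_ple ?posrE// ltW.
Qed.

Lemma expR_Ninv_lt1 (y0 : R) : 0 < y0 -> 0 < expR (- y0^-1) < 1.
Proof. by move=> y0_gt0; rewrite expR_gt0/= expR_lt1 oppr_lt0 invr_gt0. Qed.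

(** The right-hand side is [C s ^ (1 / 2 - n)]: against [s ^ - a] there remains a factor
    [exp (L / 2)], which absorbs the power of [L]. The bound on [s] gives [L > 1], hence
    [ln L >= 0]. *)
Lemma Flog_bound (n : nat) (a g : R) : (0 < n)%N -> a <= n%:R - 1 ->
  exists2 C : R, 0 < C & forall s, 0 < s < expR (-1) ->
    `|Flog a g s| <= C * ((Num.sqrt s)^-1) ^+ (n + n).-1.
Proof.
move=> n0 an; have half0 : 0 < 2^-1 :> R by rewrite invr_gt0.
have [K K0 hK] := ln_le_linear (normr_ge0 g) half0.
exists (expR K); first exact: expR_gt0.
move=> s /andP[s0 s1]; rewrite /Flog normrN (gtr0_norm (expR_gt0 _)).
pose L := - ln s.
have sE : s = expR (- L) by rewrite /L opprK lnK.
have L1 : 1 < L by move: s1; rewrite sE ltr_expR ltrN2.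
have -> : (Num.sqrt s)^-1 = expR (L / 2).
  have -> : s = expR (- (L / 2)) ^+ 2.
    by rewrite sE -expRM_natl; congr expR; field.
  by rewrite sqrtr_sqr (gtr0_norm (expR_gt0 _)) expRN invrK.
rewrite -expRM_natl -expRD ler_expR /log_exponent -/L.
have L0 : 0 < L by apply: lt_trans L1.
have lnL0 : 0 <= ln L by rewrite ln_ge0// ltW.
have h1 : - (g * ln L) <= 2^-1 * L + K.
  apply: le_trans (hK L L0); rewrite -mulNr ler_wpM2r//.
  by rewrite -normrN ler_norm.
have -> : ((n + n).-1)%:R = 2 * n%:R - 1 :> R.
  by rewrite -subn1 natrB ?addn_gt0 ?n0// natrD mulr_natl mulr2n.
have h2 : a * L <= (n%:R - 1) * L by rewrite ler_wpM2r// ltW.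
apply: le_trans (lerD h2 h1) _.
rewrite le_eqVlt; apply/orP; left; by apply/eqP; field.
Qed.

Lemma Flog_ninfty (a g : R) : 0 < a \/ (a = 0 /\ g < 0) ->
  forall M, exists2 s1 : R, 0 < s1 & forall s, 0 < s < s1 -> Flog a g s < M.
Proof.
move=> ag M.
(* Since [exp x >= 1 + x], an exponent of at least [|M|] suffices. *)
suff [L1 L10 hL] : exists2 L1 : R, 1 <= L1 & forall L, L1 < L ->
    `|M| <= a * L - g * ln L.
  exists (expR (- L1)); first exact: expR_gt0.
  move=> s /andP[s0]; rewrite -[X in X < _]lnK ?posrE// ltr_expR ltrNr => sL.
  have := hL _ sL; rewrite -/(log_exponent a g s) => h.
  rewrite /Flog ltrNl; apply: le_lt_trans (ler_norm (- M)) _; rewrite normrN.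
  apply: le_lt_trans h _; apply: lt_le_trans (expR_ge1Dx _).
  by rewrite ltrDr.
case: ag => [a0|[-> g0]].
- have a20 : 0 < a / 2 by rewrite divr_gt0.
  have [K K0 hK] := ln_le_linear (normr_ge0 g) a20.
  have MK0 : 0 <= (`|M| + K) / (a / 2) by rewrite divr_ge0 ?addr_ge0// ltW.
  exists (1 + (`|M| + K) / (a / 2)); first by rewrite lerDl.
  move=> L hL; have L1 : 1 < L by apply: le_lt_trans hL; rewrite lerDl.
  have L0 : 0 < L by apply: lt_trans L1.
  have lnL0 : 0 <= ln L by rewrite ln_ge0// ltW.
  have h1 : g * ln L <= a / 2 * L + K.
    by apply: le_trans (hK L L0); rewrite ler_wpM2r// ler_norm.
  have : (`|M| + K) / (a / 2) <= L by apply: ltW; apply: le_lt_trans hL; rewrite lerDr.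
  rewrite ler_pdivrMr// => h2; rewrite lerBrDr; apply: le_trans (lerD (lexx _) h1) _.
  have -> : a * L = L * (a / 2) + a / 2 * L by field.
  by rewrite addrCA [X in _ <= X]addrC lerD2l.
- exists (Num.max 1 (expR (`|M| / - g))); first by rewrite le_max lexx.
  move=> L; rewrite gt_max => /andP[L1 hL].
  have L0 : 0 < L by apply: lt_trans L1.
  rewrite mul0r sub0r -mulNr mulrC -ler_pdivrMr ?oppr_gt0//.
  by rewrite -ler_expR lnK ?posrE// ltW.
Qed.

Lemma u_logE n (a g : R) (z : 'rV[R]_(n + n)) : 0 < enorm z < 1 ->
  u_log a g z = radial (Flog a g) 0 z.
Proof.
move=> /andP[z0 z1]; rewrite /u_log /radial /Flog addr0; congr (- _).
have q1 : 0 < enorm z ^+ 2 < 1.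
  by rewrite exprn_gt0//= expr_lt1// ltW.
have L0 : 0 < - ln (enorm z ^+ 2) by rewrite oppr_gt0 ln_lt0.
rewrite /powR !gt_eqF// -expRD; congr expR; rewrite /log_exponent.
rewrite lnXn// -mulr_natl; ring.
Qed.

Lemma radial_cst n : u_log 0 0 = (fun _ : 'rV[R]_(n + n) => -1).
Proof.
by apply/funext => z; rewrite /u_log mulr0 oppr0 !powRr0 mulr1.
Qed.

End log_family.

(** * Admissibility and extension of the logarithmic family *)

Section theorem.
Local Open Scope complex_scope.
Variables (R : realType) (n m : nat).
Hypotheses (hm : (1 <= m)%N) (hmn : (m < n)%N).
Let c : R := (n - m)%:R / m%:R.

Let c_gt0 : 0 < c. Proof. by rewrite divr_gt0// ltr0n// subn_gt0. Qed.
Let n_gt0 : (0 < n)%N. Proof. exact: leq_ltn_trans hmn. Qed.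
Let m_le_n : (m <= n)%N. Proof. exact: ltnW. Qed.

(** Brings every pole with [a <= c] within the reach of [Flog_bound]. *)
Let c_le : c <= n%:R - 1.
Proof.
rewrite ler_pdivrMr ?ltr0n// natrB//.
have m1 : 1 <= m%:R :> R by rewrite ler1n.
have n1 : 1 <= n%:R :> R by rewrite ler1n.
by nra.
Qed.

Lemma log_extension (a g : R) :
  (0 < a < c) \/ (a = c /\ 0 <= g) \/ (a = 0 /\ g < 0) ->
  exists2 e : R, 0 < e < 1 &
    m_subharmonic m (@eball R (n + n) e) (@radial_ext R n (Flog a g)).
Proof.
move=> hag; have [|y0 /andP[y00 y01] hy] := @convexity_ge0 R c a g c_gt0.
  by case: hag => [|[|[? /ltW]]]; [left|right; left|right; right].
have ac : a <= n%:R - 1.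
  by apply: le_trans c_le; case: hag => [/andP[_ /ltW]|[[->]|[->]]]//; rewrite ltW.
have [C C0 hC] := Flog_bound g n_gt0 ac.
pose s0 := expR (- y0^-1).
have /andP[s00 s01] := expR_Ninv_lt1 y00.
have s0e : s0 <= expR (-1) by rewrite ler_expR lerN2 invf_ge1.
pose J := (`]0, s0[%classic : set R).
have JP s : J s -> 0 < s < s0 by rewrite /J/= in_itv.
(* Gives [e < 1] and [e ^ 2 <= e <= s0 / 2]. *)
pose e := Num.min 2^-1 (s0 / 2).
have e0 : 0 < e by rewrite lt_min invr_gt0 ltr0n divr_gt0.
have e1 : e <= 2^-1 by rewrite ge_min lexx.
have e2 : e <= s0 / 2 by rewrite ge_min lexx orbT.
have half : (2^-1 : R) < 1 by rewrite invf_lt1// ltr1n.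
exists e; first by rewrite e0 (le_lt_trans e1).
apply: (@radial_ext_m_subharmonic R n m hm m_le_n (Flog a g) (Flog1 a g) (Flog2 a g) s0 C) => //.
- by rewrite s00 ltW.
- by apply: C2_on_Flog; exact: ltW.
- move=> s /JP s1; have [h1 _] := hy _ (inv_negln_small y00 s1).
  case/andP: s1 => sp _.
  by rewrite /Flog1 !mulr_ge0 ?expR_ge0// invr_ge0 ltW.
- move=> s /JP s1; have [_ h1] := hy _ (inv_negln_small y00 s1).
  case/andP: s1 => sp _; rewrite Flog_convexity//.
  by rewrite mulr_ge0// mulr_ge0// mulr_ge0 ?expR_ge0// invr_ge0 ltW.
- by move=> s _; rewrite /Flog oppr_le0 expR_ge0.
- by move=> s /JP /andP[sp ss]; apply: hC; rewrite sp (lt_le_trans ss).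
- apply: Flog_ninfty; case: hag => [/andP[]|[[-> _]|]]; [left|left|right] => //.
- apply: le_trans e2; rewrite expr2 ler_piMr// ?ltW//.
  by apply: le_lt_trans e1 _.
Qed.

Lemma punctured_eball (e : R) : @punctured_ball R (n + n) e `<=` @eball R (n + n) e.
Proof. by move=> z /andP[]. Qed.

Lemma radial_ext_u_log (a g e : R) z : e < 1 -> @punctured_ball R (n + n) e z ->
  radial_ext (Flog a g) z = (u_log a g z)%:E.
Proof.
move=> e1 /andP[z0 ze]; rewrite u_logE; last by rewrite z0 (lt_trans ze).
rewrite /radial_ext; case: eqP => // z00; exfalso.
by move: z0; rewrite lt_neqAle eq_sym enorm_eq0 z00 eqxx.
Qed.

(** Needed for [a = g = 0], where [u_log] is the constant -1 and [log_extension], built on the value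
    [-oo] at the origin, does not apply. *)
Lemma cst_m_subharmonic (e : R) (b : R) :
  m_subharmonic m (@eball R (n + n) e) (fun=> b%:E).
Proof.
have CF : C2_on setT (fun _ : R => b) (fun=> 0) (fun=> 0).
  split=> [|s _|s _|s _]; [exact: openT|exact: is_derive_cst|exact: is_derive_cst|].
  exact: cst_continuous.
have Cb : class_C 2 setT (fun _ : 'rV[R]_(n + n) => b).
  exact: (@class_C_radial R (n + n) setT _ _ _ 0 CF).
have mpos z : m_positive m (ddc (fun _ : 'rV[R]_(n + n) => b) z).
  apply: (@m_positive_radial R n m hm m_le_n setT _ _ _ 0 z CF) => //.
  by move=> s _; rewrite !mulr0 addr0.
split.
- by move=> z _; rewrite ltry.
- move=> K cK KD; have /compact_bounded[M [Mr hM]] := cK.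
  have M0 : 0 <= `|M| + 1 by rewrite addr_ge0.
  have mC : measurable (cube (0 : 'rV[R]_(n + n)) (`|M| + 1)) by exact: measurable_cube.
  apply: (integrableS mC).
  + rewrite -[X in measurable X]setCK preimage_setC; apply: measurableC.
    apply: measurable_preimage_open; apply: closed_openC.
    exact: compact_closed.
  + move=> t Kt; apply/norm_le_cube => //.
    by apply: hM => //; rewrite ltr_pwDr// ler_norm.
  + apply: (@measurable_bounded_integrable _ _ _ (lebesgue_tuple R (n + n))
      (cst b) _ mC) => //; last exact: bounded_cst.
    have h := @lebesgue_cube R (n + n) 0 (`|M| + 1) M0.
    by apply: (@eq_ind_r _ _ (fun x => (x < +oo)%E) _ _ h); exact: ltry.
- apply: subharmonic_locally_C2; first by rewrite addn_gt0 n_gt0.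
    by move=> x d _ bd; apply: filterS (@filterT _ (nbhs x) _) => y _ _.
  move=> x _; right; exists setT, (fun=> b); split=> //; first exact: openT.
  rewrite (@laplacian_radial R (n + n) setT _ _ _ 0 CF x I).
  by rewrite mul0r !mulr0 addr0.
- move=> alpha sa ha phi tphi; apply: weak_ge0_C2 => //.
    by apply: class_CS Cb.
Qed.

Lemma admissible_log (a g : R) :
  (0 < a < c) \/ (a = c /\ 0 <= g) \/ (a = 0 /\ g <= 0) -> admissible n m a g.
Proof.
move=> hag; have [[a0 g0]|nz] := pselect (a = 0 /\ g = 0).
  exists 2^-1; first by rewrite invr_gt0 ltr0n invf_lt1// ltr1n.
  rewrite a0 g0 radial_cst.
  apply: (m_subharmonic_restrict _ _ (@punctured_eball _) _ (cst_m_subharmonic _ _)) => //.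
have [|e /andP[e0 e1] he] := @log_extension a g.
  case: hag => [|[|[a0 g0]]]; [by left|by right; left|right; right; split=> //].
  by rewrite lt_neqAle g0 andbT; apply/eqP => g00; apply: nz.
exists e; first by rewrite e0.
apply: (m_subharmonic_restrict _ _ (@punctured_eball _) _ he) => //.
by move=> z; exact: radial_ext_u_log.
Qed.

Lemma not_admissible_log (a g : R) :
  c < a \/ (a = c /\ g < 0) \/ (a = 0 /\ 0 < g) \/ a < 0 -> ~ admissible n m a g.
Proof.
move=> hag [e /andP[e0 e1] [_ _ _ weak]].
have [y0 /andP[y00 y01] hy] := convexity_lt0 c_gt0 hag.
pose s0 := expR (- y0^-1).
have /andP[s00 s01] := expR_Ninv_lt1 y00.
(* A radius inside the given ball with [r0 ^ 2 < s0], where [convexity] is negative. *)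
pose r0 := Num.min e s0 / 2.
have r00 : 0 < r0 by rewrite divr_gt0// lt_min e0.
have r0e : r0 < e.
  by rewrite /r0 ltr_pdivrMr// (le_lt_trans (_ : _ <= e))// ?ge_min ?lexx// ltr_pMr// ltr1n.
have r0s : r0 < s0.
  by rewrite /r0 ltr_pdivrMr// (le_lt_trans (_ : _ <= s0))// ?ge_min ?lexx ?orbT// ltr_pMr// ltr1n.
pose i0 : 'I_(n + n) := lshift n (Ordinal n_gt0).
pose z0 : 'rV[R]_(n + n) := r0 *: delta_mx 0 i0.
have qz0 : enorm z0 ^+ 2 = r0 ^+ 2.
  rewrite sqr_enorm (bigD1 i0)//= big1 ?addr0.
    by rewrite !mxE !eqxx mulr1.
  by move=> i ii0; rewrite !mxE eqxx/= (negbTE ii0) mulr0 expr0n.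
have ez0 : enorm z0 = r0.
  apply/eqP; rewrite -(@eqrXn2 _ 2) ?sqrtr_ge0// ?ltW//; exact/eqP.
set s := r0 ^+ 2 in qz0.
have s_gt0 : 0 < s by rewrite exprn_gt0.
have ss0 : s < s0.
  apply: le_lt_trans r0s; rewrite /s expr2 ler_piMr// ?ltW//.
  by rewrite (lt_trans r0e).
have s1 : s < 1 by apply: lt_trans s01.
pose F := Flog a g.
have FC := @C2_on_Flog R a g 1 (lexx _).
pose J := (`]0, 1[%classic : set R).
pose D := @punctured_ball R (n + n) e.
have DJ z : D z -> radial_dom J 0 z.
  move=> /andP[zp ze]; rewrite /radial_dom/= addr0 /J/= in_itv/= exprn_gt0//=.
  by rewrite expr_lt1 ?ltW// (lt_trans ze).
have CF : class_C 2 D (@radial R (n + n) F 0).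
  have h := @class_C_radial R (n + n) J _ _ _ 0 FC.
  exact: class_CS h.
have sF : sym_hess D (@radial R (n + n) F 0).
  by move=> z i j Dz; apply: (sym_hess_radial FC); exact: DJ.
have oD : open D.
  rewrite (_ : D = @radial_dom R (n + n) `]0, e ^+ 2[ 0).
    by apply: open_radial_dom; exact: interval_open.
  apply/seteqP; split=> z; rewrite /radial_dom /D /punctured_ball/= addr0 in_itv/=.
    by move=> /andP[zp ze]; rewrite exprn_gt0//= ltr_pXn2r// ?nnegrE ltW.
  move=> /andP[zp]; rewrite ltr_pXn2r// ?nnegrE ?sqrtr_ge0 ?(ltW e0)// => ->.
  rewrite andbT lt_neqAle sqrtr_ge0 andbT; apply: contraTneq zp => <-.
  by rewrite expr0n ltxx.
have Dz0 : D z0 by rewrite /D /punctured_ball/= ez0 r00.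
(* Turns the inequality [n + m b s >= 0] of [m_positive_rank1] into an equality: the form lies on
   the boundary of the m-positive cone. *)
pose b : R := - (n%:R / m%:R) / s.
pose A : 'M[R[i]]_n := (1 : R)%:C *: 1%:M + b%:C *: rank1 (zcoord z0).
have mR : m%:R != 0 :> R by rewrite pnatr_eq0 -lt0n.
have nR : n%:R != 0 :> R by rewrite pnatr_eq0 -lt0n.
have sn0 : s != 0 by rewrite gt_eqF.
have Apos : m_positive m A.
  apply: m_positive_rank1 => //.
  rewrite qz0 (_ : _ + _ = 0)// /b; field.
  by rewrite mR sn0.
pose alpha := nseq m.-1 A.
have sa : size alpha = m.-1 by rewrite size_nseq.
have ha B : B \in alpha -> m_positive m B by move=> /nseqP[->].
have st := size_wedge_tail hm m_le_n sa.
pose tail := alpha ++ nseq (n - m) (beta R n).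
pose G := diffop (wedge_coef tail) (@radial R (n + n) F 0).
have Gz0 : G z0 < 0.
  rewrite /G -wedge_diffop// (ddc_radial FC (DJ _ Dz0)) addr0 qz0.
  pose ab := ((2 * Flog1 a g s)%:C, (2 * Flog2 a g s)%:C) ::
    nseq m.-1 ((1 : R)%:C, b%:C) ++ nseq (n - m) (2, 0 : R[i]).
  have -> : (2 * Flog1 a g s)%:C *: 1%:M + (2 * Flog2 a g s)%:C *: rank1 (zcoord z0) :: tail
      = [seq p.1 *: 1%:M + p.2 *: rank1 (zcoord z0) | p <- ab].
    have hb : beta R n = 2 *: 1%:M + 0 *: rank1 (zcoord z0).
      by rewrite betaE scale0r addr0 scalemx1.
    by rewrite /ab map_cons map_cat !map_nseq /tail hb.
  rewrite wedge_id_rank1//; last by move: st; rewrite /= !size_cat !size_nseq.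
  rewrite [coef_der _]/= {1}/coef_prod big_cons -/(coef_prod _).
  rewrite !coef_prod_cat coef_der_cat !coef_prod_nseq !coef_der_nseq /= !mulr0 addr0.
  rewrite tr_rank1_zcoord qz0 !expr1n.
  have -> : (2 : R[i]) = (2 : R)%:C by rewrite (rmorph_nat (real_complex R)).
  rewrite -!(rmorph_nat (real_complex R)) -!(rmorphXn (real_complex R)).
  rewrite -(fmorphV (real_complex R)).
  pose T : R := 2 ^+ (n - m).
  (* With [b s = - n / m], the terms in [F'] add up to [1 - (m - 1) / m = 1 / m], so that
     [F' / m + s F'' / n] remains, up to positive constants. *)
  pose V : R := n`!%:R * ((2 * T) / (n%:R * m%:R) * (n%:R * Flog1 a g s + m%:R * (s * Flog2 a g s))).
  rewrite (_ : _ * _ = V%:C); last first.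
    rewrite !mul1r !mulr1.
    do 12 rewrite -?(rmorphM (real_complex R)) -?(rmorphD (real_complex R)).
    apply: (congr1 (real_complex R)).
    have -> : m.-1%:R = m%:R - 1 :> R by rewrite -subn1 natrB.
    rewrite /V /b -/T; field.
    by rewrite nR mR sn0.
  rewrite /= /V Flog_convexity// -/c.
  rewrite pmulr_rlt0 ?ltr0n ?fact_gt0// pmulr_rlt0; last first.
    by rewrite divr_gt0// ?mulr_gt0 ?ltr0n// exprn_gt0.
  rewrite pmulr_rlt0; last by rewrite !mulr_gt0 ?ltr0n ?expR_gt0// invr_gt0.
  by apply: hy; apply: inv_negln_small => //; rewrite s_gt0.
have cG : {for z0, continuous G} by exact: (@diffop_continuous R _ _ D _ z0 CF Dz0).
have : nbhs z0 (D `&` G @^-1` [set y | y < 0]).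
  apply: filterI; first exact: open_nbhs_nbhs.
  by apply: cG; apply: open_nbhs_nbhs; split; [exact: open_lt|].
move=> /nbhs_ballP[r /= r_gt0 hr].
have [|phi [tphi phi0 phiB]] := @exists_bump R (n + n) D z0 r r_gt0.
  by move=> z /hr[].
have := weak alpha sa ha phi tphi; rewrite leNgt => /negP; apply.
rewrite (@lintegral_restrict _ _ D D _ (fun z => (radial F 0 z)%:E *
     (diffop (wedge_coef tail) phi z)%:E)%E)//; last first.
  move=> z Dz; rewrite wedge_diffop// u_logE//.
  by case/andP: Dz => -> /lt_trans; exact.
apply: (@diffop_weak_lt0 _ _ D _ _ _ z0 CF sF tphi).
- move=> z; have [->|pz] := eqVneq (phi z) 0; first by rewrite mul0r.
  have [_ /= Gz] := hr _ (phiB _ pz).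
  have [_ _ _ pge] := tphi.
  by apply: mulr_ge0_le0; [exact: pge|exact: (ltW Gz)].
- by rewrite (pmulr_rlt0 _ phi0); exact: Gz0.
Qed.

End theorem.

Theorem theorem3p1 (R : realType) (n m : nat) (hm : (1 <= m)%N)
    (hmn : (m < n)%N) :
  let c : R := (n - m)%:R / m%:R in
  (forall a g : R, 0 < a ->
     (admissible n m a g <-> a < c \/ (a = c /\ 0 <= g))) /\
  (forall g : R, admissible n m 0 g <-> g <= 0) /\
  (forall a g : R, a < 0 -> ~ admissible n m a g) /\
  (forall a g : R, admissible n m a g -> singular_at_0 n a g ->
     exists2 e : R, 0 < e < 1 &
       exists2 v : 'rV[R]_(n + n) -> \bar R,
         m_subharmonic m (@eball R (n + n) e) v &
         forall z, punctured_ball e z -> v z = (u_log a g z)%:E).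
Proof.
move=> c.
have c0 : 0 < c by rewrite divr_gt0// ltr0n// subn_gt0.
have neg (a g : R) : a < 0 -> ~ admissible n m a g.
  by move=> a0; apply: (not_admissible_log hm hmn); right; right; right.
have zero (g : R) : admissible n m 0 g <-> g <= 0.
  split=> [adm|g0]; last by apply: (admissible_log hm hmn); right; right.
  rewrite leNgt; apply/negP => g0; move: adm.
  by apply: (not_admissible_log hm hmn); right; right; left.
have pos (a g : R) : 0 < a -> admissible n m a g <-> a < c \/ (a = c /\ 0 <= g).
  move=> a0; split=> [adm|ac].
    have [ac|ca|ac] := ltgtP a c; [by left| |].
      by exfalso; apply: (not_admissible_log hm hmn) adm; left.
    right; split=> //; rewrite leNgt; apply/negP => g0; move: adm.
    by apply: (not_admissible_log hm hmn); right; left.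
  apply: (admissible_log hm hmn); case: ac => [ac|ac]; first by left; rewrite a0.
  by right; left.
split; first exact: pos.
split; first exact: zero.
split; first exact: neg.
move=> a g adm sing.
have [|e e01 he] := @log_extension R n m hm hmn a g.
  have [a0|a0|a0] := ltgtP a 0.
  - by case: (neg _ _ a0 adm).
  - by have [ac|ac] := (pos _ g a0).1 adm; [left; apply/andP|right; left].
  - right; right; split=> //; move: adm; rewrite a0 => /zero.
    rewrite le_eqVlt => /predU1P[g0|//]; exfalso.
    (* The singularity excludes [a = g = 0]: the constant -1 never exceeds 1 in modulus. *)
    have [|z _] := sing 1 2^-1; first by rewrite invr_gt0 ltr0n invf_lt1// ltr1n.
    by rewrite a0 g0 radial_cst normrN normr1 ltxx.
exists e => //; exists (radial_ext (Flog a g)) => // z ze.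
by apply: radial_ext_u_log ze; case/andP: e01.
Qed.
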